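(* The following two diagrams are commutative diagrams of de Rham complexes, i.e. in each diagram both rows are complexes (consecutive compositions vanish), the vertical maps send the upper spaces into the lower spaces, and all squares commute ($\mathbb{I}^{d^{k+1}}_h d^k=d^k_h\mathbb{I}^{d^k}_h$ for $0\le k\le n-1$): (1) upper row $\mathbb{R}\xrightarrow{\rm inc}H\Lambda^0\xrightarrow{d^0}H\Lambda^1\xrightarrow{d^1}\cdots\xrightarrow{d^{n-1}}H\Lambda^n$, lower row $\mathbb{R}\xrightarrow{\rm inc}\mathbf{W}^{\rm nc}_h\Lambda^0\xrightarrow{d^0_h}\mathbf{W}^{\rm nc}_h\Lambda^1\xrightarrow{d^1_h}\cdots\xrightarrow{d^{n-1}_h}\mathbf{W}^{\rm nc}_h\Lambda^n$, with vertical maps $\mathbb{I}^{d^k}_h:H\Lambda^k\to\mathbf{W}^{\rm nc}_h\Lambda^k$, $0\le k\le n$; (2) upper row $0\to H_0\Lambda^0\xrightarrow{d^0}H_0\Lambda^1\xrightarrow{d^1}\cdots\xrightarrow{d^{n-1}}H_0\Lambda^n$, lower row $0\to\mathbf{W}^{\rm nc}_{h0}\Lambda^0\xrightarrow{d^0_h}\mathbf{W}^{\rm nc}_{h0}\Lambda^1\xrightarrow{d^1_h}\cdots\xrightarrow{d^{n-1}_h}\mathbf{W}^{\rm nc}_{h0}\Lambda^n$, with vertical maps $\mathbb{I}^{d^k}_h:H_0\Lambda^k\to\mathbf{W}^{\rm nc}_{h0}\Lambda^k$, $0\le k\le n$.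
   Context: Let $n\ge 1$, let $\Omega\subset\mathbb{R}^n$ be a bounded polyhedral domain and $\mathcal{G}_h$ a simplicial subdivision of $\Omega$. Forms. $d^k$ is the exterior derivative on $k$-forms ($d^n=0$), $\star$ the Hodge star, $\langle\cdot,\cdot\rangle_{L^2\Lambda^k}$ the $L^2$ inner product, and $\delta_k$ the codifferential on $k$-forms, i.e. the formal adjoint of $d^{k-1}$: $\langle d^{k-1}\mu,\eta\rangle_{L^2\Lambda^k}=\langle\mu,\delta_k\eta\rangle_{L^2\Lambda^{k-1}}$ whenever one of the smooth forms $\mu,\eta$ has compact support (thus $\delta_k=\pm\star d^{n-k}\star$). For $0\le k\le n-1$, $H\Lambda^k(\Xi)=\{\omega\in L^2\Lambda^k(\Xi):d^k\omega\in L^2\Lambda^{k+1}(\Xi)\}$ with the graph norm and $H_0\Lambda^k(\Xi)$ is the closure in it of smooth compactly supported forms; $H\Lambda^n=L^2\Lambda^n$ and $H_0\Lambda^n$ is the space of $n$-forms in $L^2\Lambda^n(\Omega)$ with zero integral over $\Omega$. When no domain is written it is $\Omega$. For $1\le k\le n$, $H^*\Lambda^k(\Omega)=\{\mu\in L^2\Lambda^k(\Omega):\delta_k\mu\in L^2\Lambda^{k-1}(\Omega)\}$ with the graph norm, and $H^*_0\Lambda^k(\Omega)$ is the closure in it of smooth compactly supported forms. ''inc'' is the inclusion of constants. Whitney forms. $\mathcal{P}_0\Lambda^k$ denotes constant-coefficient $k$-forms. The Koszul operator is $\kappa(dx^{\alpha_1}\wedge\dots\wedge dx^{\alpha_k})=\sum_{j=1}^k(-1)^{j+1}x^{\alpha_j}dx^{\alpha_1}\wedge\dots\wedge\widehat{dx^{\alpha_j}}\wedge\dots\wedge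 dx^{\alpha_k}$; $\mathcal{P}_1^-\Lambda^k=\mathcal{P}_0\Lambda^k+\kappa(\mathcal{P}_0\Lambda^{k+1})$, $\mathcal{P}_1^{*,-}\Lambda^k=\star(\mathcal{P}_1^-\Lambda^{n-k})$. $\mathcal{P}_0\Lambda^k(\mathcal{G}_h)$, $\mathcal{P}_1^-\Lambda^k(\mathcal{G}_h)$, $\mathcal{P}_1^{*,-}\Lambda^k(\mathcal{G}_h)$ are the corresponding piecewise spaces (no inter-element continuity). $d^k_h$ is $d^k$ applied cell by cell. Spaces. $\mathbf{W}^*_h\Lambda^k=\mathcal{P}_1^{*,-}\Lambda^k(\mathcal{G}_h)\cap H^*\Lambda^k(\Omega)$, $\mathbf{W}^*_{h0}\Lambda^k=\mathcal{P}_1^{*,-}\Lambda^k(\mathcal{G}_h)\cap H^*_0\Lambda^k(\Omega)$. For $0\le k\le n-1$, $\mathbf{W}^{\rm nc}_h\Lambda^k=\{\omega_h\in\mathcal{P}_1^-\Lambda^k(\mathcal{G}_h):\langle\omega_h,\delta_{k+1}\eta_h\rangle_{L^2\Lambda^k}-\langle d^k_h\omega_h,\eta_h\rangle_{L^2\Lambda^{k+1}}=0\ \forall\,\eta_h\in\mathbf{W}^*_{h0}\Lambda^{k+1}\}$, and $\mathbf{W}^{\rm nc}_{h0}\Lambda^k$ is defined in the same way but with the condition for all $\eta_h\in\mathbf{W}^*_h\Lambda^{k+1}$. $\mathbf{W}^{\rm nc}_h\Lambda^n=\mathcal{P}_0\Lambda^n(\mathcal{G}_h)$ and $\mathbf{W}^{\rm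 nc}_{h0}\Lambda^n$ is its subspace of forms with zero integral over $\Omega$. Interpolators. For $0\le k\le n-1$ and a simplex $T$, $\mathbb{I}^{d^k}_T:H\Lambda^k(T)\to\mathcal{P}_1^-\Lambda^k(T)$ is defined by $\langle\mathbb{I}^{d^k}_T\omega,\delta_{k+1}\eta\rangle_{L^2\Lambda^k(T)}-\langle d^k\mathbb{I}^{d^k}_T\omega,\eta\rangle_{L^2\Lambda^{k+1}(T)}=\langle\omega,\delta_{k+1}\eta\rangle_{L^2\Lambda^k(T)}-\langle d^k\omega,\eta\rangle_{L^2\Lambda^{k+1}(T)}$ for all $\eta\in\mathcal{P}_1^{*,-}\Lambda^{k+1}(T)$, and $(\mathbb{I}^{d^k}_h\omega)|_T=\mathbb{I}^{d^k}_T(\omega|_T)$ for all $T\in\mathcal{G}_h$. $\mathbb{I}^{d^n}_h$ is the $L^2(\Omega)$ projection onto $\mathcal{P}_0\Lambda^n(\mathcal{G}_h)$. *)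

(* Defs.v *)
From HB Require Import structures.
From mathcomp Require Import all_boot all_order all_algebra.
From mathcomp Require Import all_classical all_reals all_analysis.
Import Order.TTheory GRing.Theory Num.Theory.
Import numFieldNormedType.Exports.

Set Implicit Arguments.
Unset Strict Implicit.
Unset Printing Implicit Defensive.

Local Open Scope classical_set_scope.
Local Open Scope ring_scope.

(* The sigma-algebra on 'rV[T]_n is the one generated by the coordinates. *)

Section measurable_rV.
Context {d} {T : measurableType d}.
Variable n : nat.

Let coors : 'I_n -> 'rV[T]_n -> T := fun i x => x ord0 i.

Let rV_set0 : g_sigma_preimage coors set0.
Proof. exact: sigma_algebra0. Qed.

Let rV_setC A : g_sigma_preimage coors A -> g_sigma_preimage coors (~` A).
Proof. exact: sigma_algebraC. Qed.

Let rV_bigcup (F : (set _)^nat) : (forall i, g_sigma_preimage coors (F i)) ->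
  g_sigma_preimage coors (\bigcup_i (F i)).
Proof. exact: sigma_algebra_bigcup. Qed.

HB.instance Definition _ := @isMeasurable.Build (measure_tuple_display d)
  'rV[T]_n (g_sigma_preimage coors) rV_set0 rV_setC rV_bigcup.

End measurable_rV.

Lemma measurable_rV_coord d (T : measurableType d) n (i : 'I_n) :
  measurable_fun [set: 'rV[T]_n] (fun x => x ord0 i).
Proof.
move=> _ Y mY; rewrite setTI; apply: sub_sigma_algebra => /=.
rewrite -bigcup_seq/=; exists i => /=; first by rewrite mem_index_enum.
by exists Y => //; rewrite setTI.
Qed.

Lemma measurable_fun_rVP d1 d2 (T1 : measurableType d1) (T2 : measurableType d2)
    n (f : T1 -> 'rV[T2]_n) :
  (forall i, measurable_fun [set: T1] (fun x => f x ord0 i)) ->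
  measurable_fun [set: T1] f.
Proof.
move=> mf.
have H : g_sigma_preimage (fun i x => f x ord0 i) `<=` measurable.
  apply: smallest_sub; first exact: sigma_algebra_measurable.
  case: n => [|n] in f mf *; first by rewrite big_ord0.
  rewrite -bigcup_mkord_ord; apply: bigcup_sub => i Ii.
  by move=> A [B mB <-]; exact: mf.
move=> _ A mA; apply: H.
rewrite (@g_sigma_preimage_comp _ _ _ 'rV[T2]_n (fun i x => x ord0 i)).
by exists A.
Qed.

Section lebesgue_rV.
Variable R : realType.

Definition rVcons n (p : R * 'rV[R]_n) : 'rV[R]_n.+1 :=
  \row_i (if unlift ord0 i is Some j then p.2 ord0 j else p.1).

Lemma rVcons_behead n (x : 'rV[R]_n.+1) :
  rVcons (x ord0 ord0, \row_j x ord0 (lift ord0 j)) = x.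
Proof.
by apply/rowP => i; rewrite mxE; case: unliftP => [j ->|->] //=; rewrite mxE.
Qed.

Lemma measurable_rVcons n :
  measurable_fun setT (@rVcons n : measurableTypeR R * 'rV[R]_n -> 'rV[R]_n.+1).
Proof.
apply: measurable_fun_rVP => i.
under eq_fun do rewrite mxE.
case: unliftP => [j _|_]; last exact: measurable_fst.
exact: (measurableT_comp (measurable_rV_coord j) measurable_snd).
Qed.

Definition rVcons_measure n (mu : set 'rV[R]_n -> \bar R) :
    set 'rV[R]_n.+1 -> \bar R :=
  pushforward (@lebesgue_measure R \x mu)%E (@rVcons n).

Section rVcons_measure.
Variables (n : nat) (mu : {sigma_finite_measure set 'rV[R]_n -> \bar R}).

Let nu := rVcons_measure mu.

Let nu0 : nu set0 = 0%E.
Proof. by rewrite /nu /rVcons_measure /pushforward preimage_set0 measure0. Qed.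

Let nu_ge0 A : (0 <= nu A)%E.
Proof. by rewrite /nu /rVcons_measure /pushforward measure_ge0. Qed.

Let nu_sigma_additive : semi_sigma_additive nu.
Proof.
move=> F mF tF mUF; rewrite /nu /rVcons_measure /pushforward preimage_bigcup.
have mpre A : measurable A -> measurable (@rVcons n @^-1` A).
  by move=> mA; rewrite -[X in measurable X]setTI; exact: measurable_rVcons.
apply: measure_semi_sigma_additive.
- by move=> k; exact: mpre.
- apply/trivIsetP => /= i j _ _ ij; rewrite -preimage_setI.
  by move/trivIsetP : tF => /(_ _ _ _ _ ij) ->//; rewrite preimage_set0.
- by rewrite -preimage_bigcup; exact: mpre.
Qed.

HB.instance Definition _ :=
  isMeasure.Build _ _ _ nu nu0 nu_ge0 nu_sigma_additive.

Let nu_sigma_finite : sigma_finite setT nu.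
Proof.
pose uncons (x : 'rV[R]_n.+1) : measurableTypeR R * 'rV[R]_n :=
  (x ord0 ord0, \row_j x ord0 (lift ord0 j)).
have unconsK : cancel (@rVcons n) uncons.
  move=> [a x]; congr pair; first by rewrite mxE unlift_none.
  by apply/rowP => j; rewrite !mxE liftK.
have muncons : measurable_fun setT uncons.
  apply/measurable_fun_pair; first exact: measurable_rV_coord.
  apply: measurable_fun_rVP => j; under eq_fun do rewrite mxE.
  exact: measurable_rV_coord.
have /sigma_finiteP[F [TF ndF Foo]] := sigma_finiteT (@lebesgue_measure R).
have /sigma_finiteP[G [TG ndG Goo]] := sigma_finiteT mu.
exists (fun k => uncons @^-1` (F k `*` G k)).
  rewrite -preimage_bigcup (_ : \bigcup_k _ = setT) ?preimage_setT//.
  rewrite -setXTT TF TG predeqE => -[x y]; split.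
    by move=> [k _ []/= ? ?]; split; exists k.
  move=> [/= [k _ Fkx] [l _ Gly]]; exists (maxn k l) => //; split.
  - by move: x Fkx; exact/subsetPset/ndF/leq_maxl.
  - by move: y Gly; exact/subsetPset/ndG/leq_maxr.
move=> k; have [mF Fk] := Foo k; have [mG Gk] := Goo k; split.
  by rewrite -[X in measurable X]setTI; apply: muncons => //; exact: measurableX.
rewrite /nu /rVcons_measure /pushforward -comp_preimage.
rewrite (_ : uncons \o _ = id) ?preimage_id; last first.
  by apply/funext => x /=; rewrite unconsK.
by rewrite product_measure1E// lte_mul_pinfty// ge0_fin_numE.
Qed.

HB.instance Definition _ :=
  Measure_isSigmaFinite.Build _ _ _ nu nu_sigma_finite.

End rVcons_measure.

Fixpoint lebesgue_rV n : {sigma_finite_measure set 'rV[R]_n -> \bar R} :=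
  if n is k.+1 then rVcons_measure (lebesgue_rV k)
  else \d_(0 : 'rV[R]_0).

Lemma lebesgue_rV_box n (A : 'I_n -> set (measurableTypeR R)) :
  (forall i, measurable (A i)) ->
  (lebesgue_rV n [set x | forall i, A i (x ord0 i)] =
   \prod_(i < n) lebesgue_measure (A i))%E.
Proof.
elim: n A => [|n IH] A mA /=.
  by rewrite big_ord0 diracE mem_set//= => -[].
have mB : measurable [set x : 'rV[R]_n | forall i, A (lift ord0 i) (x ord0 i)].
  rewrite (_ : [set x | _] =
      \bigcap_(i in [set: 'I_n]) ((fun x : 'rV[R]_n => x ord0 i) @^-1` A (lift ord0 i))).
    apply: fin_bigcap_measurable => // i _.
    rewrite -[X in measurable X]setTI.
    exact: (@measurable_rV_coord _ (measurableTypeR R) n i measurableT).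
  by apply/seteqP; split=> x /= H i; [move=> _; exact: H|exact: H].
rewrite /rVcons_measure /pushforward big_ord_recl -IH//.
rewrite -product_measure1E//; congr (_ _); apply/seteqP; split=> -[a x] /=.
  move=> H; split; first by have := H ord0; rewrite mxE unlift_none.
  by move=> i; have := H (lift ord0 i); rewrite mxE liftK.
by move=> [H0 H] i; rewrite mxE; case: unliftP => [j ->|->] //; exact: H.
Qed.

End lebesgue_rV.

Section exterior_algebra.
Variables (R : realType) (n : nat).

(* Exterior algebra of the dual of R^n: [u I] is the coefficient of
   dx^{i_1} /\ ... /\ dx^{i_k} where I = {i_1 < ... < i_k}. *)
Definition extalg := {ffun {set 'I_n} -> R}.

Implicit Types (u v : extalg) (i : 'I_n) (I : {set 'I_n}).

Definition homog (k : nat) u := forall I, #|I| != k -> u I = 0.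

Definition extdot u v : R := \sum_I u I * v I.

(* dx^i /\ dx^I = [ext_sign i I] dx^(i |: I) for i not in I; [ext_sign i I]
   does not depend on whether i is in I. *)
Definition ext_sign i I : R := (-1) ^+ #|finset (fun j => (j \in I) && (j < i)%N)|.

(* u |-> dx^i /\ u *)
Definition ext_wedge i u : extalg :=
  [ffun I : {set 'I_n} => if i \in I then ext_sign i I * u (I :\ i)%SET else 0].

(* interior product with the i-th basis vector *)
Definition ext_contr i u : extalg :=
  [ffun I : {set 'I_n} => if i \in I then 0 else ext_sign i I * u (i |: I)%SET].

(* [shuffle_sign I] is the sign s such that dx^I /\ dx^{~: I} = s dx^1 /\ ... /\ dx^n *)
Definition shuffle_sign I : R :=
  (-1) ^+ #|finset (fun p : 'I_n * 'I_n => [&& p.1 \in I, p.2 \notin I & (p.2 < p.1)%N])|.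

Definition hodge u : extalg :=
  [ffun I : {set 'I_n} => shuffle_sign (~: I)%SET * u (~: I)%SET].

Lemma ext_wedge_contr i u v : extdot (ext_wedge i u) v = extdot u (ext_contr i v).
Proof.
rewrite /extdot (bigID (fun I : {set 'I_n} => i \in I)) /= [X in _ + X]big1 ?addr0; last first.
  by move=> I /negbTE iI; rewrite ffunE iI mul0r.
rewrite [RHS](bigID (fun I : {set 'I_n} => i \notin I)) /= [X in _ = _ + X]big1 ?addr0; last first.
  by move=> I; rewrite negbK => iI; rewrite ffunE iI mulr0.
rewrite (reindex_onto (fun I => i |: I)%SET (fun I => I :\ i)%SET) /=; last first.
  by move=> I iI; rewrite finset.setD1K.
apply: eq_big => I.
  rewrite finset.setU11 /=; apply/eqP/idP => [<-|iI]; first by rewrite !inE eqxx.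
  by rewrite finset.setU1K.
move=> /andP[_ /eqP IE]; rewrite !ffunE finset.setU11 IE.
have iI : i \notin I by rewrite -IE !inE eqxx.
rewrite (negbTE iI) mulrCA mulrA; congr (_ * _ * _); rewrite /ext_sign; congr (_ ^+ _).
apply: eq_card => j; rewrite !inE; case: (eqVneq j i) => [->|//].
by rewrite ltnn !andbF.
Qed.

End exterior_algebra.

Section forms.
Variables (R : realType) (n : nat).
Local Notation E := 'rV[R]_n.
Local Notation mu := (lebesgue_rV R n).

Definition dform := E -> extalg R n.

Implicit Types (w u eta : dform) (X : set E) (k : nat).

Definition partial (i : 'I_n) w : dform :=
  fun x => [ffun I : {set 'I_n} => 'D_(delta_mx 0 i) (fun y => w y I) x].

Definition extd w : dform := fun x => \sum_i ext_wedge i (partial i w x).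

(* As d = sum_i dx^i /\ d_i, the formal adjoint follows from [ext_wedge_contr]
   and integration by parts. *)
Definition coextd w : dform := fun x => - \sum_i ext_contr i (partial i w x).

Definition ipL2 X w u : R := \int[mu]_(x in X) extdot (w x) (u x).
Definition L2form X k : set dform := [set w |
  (forall x, X x -> homog k (w x)) /\
  forall I, (fun x => w x I) \_ X \in Lfun mu 2%:E].
Definition integral_top X w : R := \int[mu]_(x in X) w x [set: 'I_n]%SET.

Definition smooth (f : E -> R) := forall s : seq 'I_n,
  let g := foldr (fun i h => 'D_(delta_mx 0 i) h) f s in
  continuous g /\ forall i x, derivable g x (delta_mx 0 i).

Definition test_form X k : set dform := [set w |
  [/\ forall x, homog k (w x), forall I, smooth (fun x => w x I) &
      exists K, [/\ compact K, K `<=` X & forall x, ~ K x -> w x = 0]]].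

Definition is_wextd X k w u :=
  forall eta, test_form X k.+1 eta -> ipL2 X w (coextd eta) = ipL2 X u eta.
(* The weak derivative is determined up to a null set of X; [w] is identified
   with its class modulo equality almost everywhere on X. *)
Definition wextd X k w : dform :=
  xget 0 [set u | L2form X k.+1 u /\ is_wextd X k w u].

Definition HL X k : set dform := [set w |
  L2form X k w /\
  ((k < n)%N -> exists2 u, L2form X k.+1 u & is_wextd X k w u)].

Definition HL_norm X k w : R :=
  Num.sqrt (ipL2 X w w + ipL2 X (wextd X k w) (wextd X k w)).

Definition HL0 X k : set dform := [set w | HL X k w /\
  if (k < n)%N then
    forall e : R, 0 < e ->
      exists2 phi, test_form X k phi & HL_norm X k (w - phi) < e
  else integral_top X w = 0].

(* Here [eta] has degree [k] and its codifferential has degree [k.-1]. *)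
Definition is_wcoextd X k eta u :=
  forall w, test_form X k.-1 w -> ipL2 X (extd w) eta = ipL2 X w u.
Definition wcoextd X k eta : dform :=
  xget 0 [set u | L2form X k.-1 u /\ is_wcoextd X k eta u].

Definition Hstar X k : set dform := [set eta |
  L2form X k eta /\ exists2 u, L2form X k.-1 u & is_wcoextd X k eta u].

Definition Hstar_norm X k eta : R :=
  Num.sqrt (ipL2 X eta eta + ipL2 X (wcoextd X k eta) (wcoextd X k eta)).

Definition Hstar0 X k : set dform := [set eta | Hstar X k eta /\
  forall e : R, 0 < e ->
    exists2 phi, test_form X k phi & Hstar_norm X k (eta - phi) < e].

Definition koszul (c : extalg R n) : dform :=
  fun x => \sum_i x 0 i *: ext_contr i c.

Definition P0forms k : set dform := [set w |
  exists2 c : extalg R n, homog k c & w = cst c].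

Definition P1minus k : set dform := [set w |
  exists c c' : extalg R n,
    [/\ homog k c, homog k.+1 c' & w = (fun x => c + koszul c' x)]].

Definition P1star k : set dform := [set w |
  exists2 s, P1minus (n - k) s & w = (fun x => hodge (s x))].

(* The rows of [v] are points; [A] selects the ones that may be used. *)
Definition hull p (v : 'M[R]_(p, n)) (A : {set 'I_p}) : set E := [set x |
  exists l : 'rV[R]_p, [/\ forall a, 0 <= l 0 a,
    forall a, a \notin A -> l 0 a = 0, \sum_a l 0 a = 1 & x = l *m v]].

(* A bounded domain whose boundary is a finite union of convex polytopes. *)
Definition polyhedral_domain (Om : set E) :=
  [/\ open Om, connected Om, Om !=set0, bounded_set Om &
      exists N (p : 'I_N -> nat) (v : forall j, 'M[R]_(p j, n)),
        closure Om `\` Om = \bigcup_j hull (v j) [set: 'I_(p j)]%SET].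

Definition affine_independent (v : 'M[R]_(n.+1, n)) :=
  \matrix_(a < n) (row (lift ord0 a) v - row ord0 v) \in unitmx.

Definition simplex (v : 'M[R]_(n.+1, n)) : set E := hull v [set: 'I_n.+1]%SET.
Definition cell (v : 'M[R]_(n.+1, n)) : set E := (simplex v)°.

Record simplicial_subdivision (Om : set E) m (G : 'I_m -> 'M[R]_(n.+1, n)) :
    Prop := SimplicialSubdivision {
  subdiv_nondegenerate : forall i, affine_independent (G i);
  subdiv_cell : forall i, cell (G i) `<=` Om;
  subdiv_cover : \bigcup_i simplex (G i) = closure Om;
  subdiv_disjoint : forall i j, i != j -> cell (G i) `&` cell (G j) = set0;
  subdiv_conforming : forall i j, exists A B : {set 'I_n.+1},
    simplex (G i) `&` simplex (G j) = hull (G i) A /\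
    hull (G i) A = hull (G j) B }.

Section mesh.
Variables (Om : set E) (m : nat) (G : 'I_m -> 'M[R]_(n.+1, n)).

(* No condition is put on the interfaces between the cells (a null set), except
   for the measurability required by [L2form]. *)
Definition piecewise (V : nat -> set dform) k : set dform := [set w |
  L2form Om k w /\
  forall i, exists2 p, V k p & forall x, cell (G i) x -> w x = p x].

Definition extd_h w : dform :=
  fun x => \sum_i \1_(cell (G i)) x *: extd w x.

Definition Wstar k : set dform := piecewise P1star k `&` Hstar Om k.
Definition Wstar0 k : set dform := piecewise P1star k `&` Hstar0 Om k.

Definition Wnc k : set dform := if (k < n)%N then
  [set w | piecewise P1minus k w /\ forall eta, Wstar0 k.+1 eta ->
     ipL2 Om w (wcoextd Om k.+1 eta) - ipL2 Om (extd_h w) eta = 0]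
  else piecewise P0forms k.

Definition Wnc0 k : set dform := if (k < n)%N then
  [set w | piecewise P1minus k w /\ forall eta, Wstar k.+1 eta ->
     ipL2 Om w (wcoextd Om k.+1 eta) - ipL2 Om (extd_h w) eta = 0]
  else [set w | piecewise P0forms k w /\ integral_top Om w = 0].

(* The conditions have exactly one solution on the polynomial space. *)
Definition interp_cell (v : 'M[R]_(n.+1, n)) k w : dform :=
  let T := cell v in
  xget 0 [set u | P1minus k u /\ forall eta, P1star k.+1 eta ->
    ipL2 T u (coextd eta) - ipL2 T (extd u) eta =
    ipL2 T w (coextd eta) - ipL2 T (wextd T k w) eta].

Definition proj_P0 k w : dform :=
  xget 0 [set u | piecewise P0forms k u /\
    forall p, piecewise P0forms k p -> ipL2 Om u p = ipL2 Om w p].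

Definition interp k w : dform :=
  if (k < n)%N then
    fun x => \sum_i \1_(cell (G i)) x *: interp_cell (G i) k w x
  else proj_P0 k w.

End mesh.

Definition eqL2 (Om : set E) w u := w = u %[ae mu in Om].

Definition inc (c : R) : dform :=
  fun=> [ffun I : {set 'I_n} => if I == finset.set0 then c else 0].

Definition is_complex (Om : set E) (A : Type) (a : A -> dform)
    (V : nat -> set dform) (D : nat -> dform -> dform) :=
  [/\ forall c, V 0 (a c),
      forall c, eqL2 Om (D 0 (a c)) 0,
      forall k, (k < n)%N -> forall w, V k w -> V k.+1 (D k w) &
      forall k, (k.+1 < n)%N -> forall w, V k w ->
        eqL2 Om (D k.+1 (D k w)) 0].

Definition is_cochain_map (Om : set E) (V : nat -> set dform) (D : nat -> dform -> dform)
    (V' : nat -> set dform) (D' : nat -> dform -> dform) (f : nat -> dform -> dform) :=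
  (forall k, (k <= n)%N -> forall w, V k w -> V' k (f k w)) /\
  (forall k, (k < n)%N -> forall w, V k w ->
     eqL2 Om (f k.+1 (D k w)) (D' k (f k w))).

End forms.

(* Main.v *)
(* On a cell T, write a test form of P_1^{*,-} as eta = e + sum_i x_i dx^i /\ e' and a local
   form of P_1^- as u = c + koszul c'. Then delta eta = -(n - k) e' and d u = (k + 1) c' are
   constant, so the interpolation conditions express c' and then c through the integrals of
   w, d w and x_i d w over T. In particular d (I_T w) is the mean of d w on T, and if d w = 0
   then I_T w is the mean of w; applied to w and to d w, this gives the commuting squares.

   Summing the local conditions over the cells shows that I_h w and w have the same pairing
   <w, delta eta> - <d w, eta> with every eta in W^*_h. For w in H and eta in W^*_{h0}, or w
   in H_0 and eta in W^*_h, the latter vanishes by density of the test forms. The lower rows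
   are complexes because delta eta is piecewise constant, hence is itself an element of W^*
   (of W^*_0 if eta is) with zero codifferential, and is a legitimate test form one degree
   below.

   Weak derivatives are unique almost everywhere by the fundamental lemma of the calculus of
   variations, and the boundaries of the simplices are null since they lie in hyperplanes. *)
From HB Require Import structures.
Require Import Defs.
From mathcomp Require Import all_boot all_order all_algebra.
From mathcomp Require Import all_classical all_reals all_analysis.
From mathcomp Require Import measurable_realfun ring lra.
Import Order.TTheory GRing.Theory Num.Theory.
Import numFieldNormedType.Exports.
Set Implicit Arguments.
Unset Strict Implicit.
Unset Printing Implicit Defensive.
Local Open Scope classical_set_scope.
Local Open Scope ring_scope.

(** * Exterior algebra *)

(** No traces on faces enter: boundary conditions and weak inter-element continuity are expressed
    only by pairings with codifferentials, so the argument is duality in L^2. The obstacle is that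
    [wextd] and [wcoextd] are chosen representatives, known only almost everywhere, whereas [extd_h]
    and the pieces of a discrete form are classical and pointwise on open cells. The two are
    compared cell by cell: a test form on a cell is also one on Om, so weak derivatives restrict to
    cells, where uniqueness applies. The factors k + 1 and n - k count how often a basis form dx^I
    is reproduced by contraction followed by multiplication, or the reverse; both are nonzero for k
    < n. This makes the local system triangular and solvable: constant test forms see only d u, and
    the remaining ones then see u. Top degree is separate, since there the boundary condition is a
    zero mean. It is orthogonality to the constant volume form, an element of W^*_h with zero
    codifferential, and so becomes one more instance of the pairing conditions. *)

Section exterior_algebra_theory.
Variables (R : realType) (n : nat).
Implicit Types (u v : extalg R n) (i j : 'I_n) (I J : {set 'I_n}).

Lemma extdotC u v : extdot u v = extdot v u.
Proof. by apply: eq_bigr => I _; rewrite mulrC. Qed.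

Lemma extdotDl u v w : extdot (u + v) w = extdot u w + extdot v w.
Proof. by rewrite -big_split; apply: eq_bigr => I _; rewrite ffunE mulrDl. Qed.

Lemma extdotZl a u v : extdot (a *: u) v = a * extdot u v.
Proof. by rewrite /extdot mulr_sumr; apply: eq_bigr => I _; rewrite ffunE mulrA. Qed.

Lemma extdot0l u : extdot 0 u = 0.
Proof. by rewrite -(scale0r 0) extdotZl mul0r. Qed.

Lemma extdotNl u v : extdot (- u) v = - extdot u v.
Proof. by rewrite -scaleN1r extdotZl mulN1r. Qed.

Lemma extdotDr u v w : extdot w (u + v) = extdot w u + extdot w v.
Proof. by rewrite !(extdotC w) extdotDl. Qed.

Lemma extdotZr a u v : extdot v (a *: u) = a * extdot v u.
Proof. by rewrite !(extdotC v) extdotZl. Qed.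

Lemma extdot0r u : extdot u 0 = 0.
Proof. by rewrite extdotC extdot0l. Qed.

Lemma extdotNr u v : extdot v (- u) = - extdot v u.
Proof. by rewrite !(extdotC v) extdotNl. Qed.

Lemma extdot_suml (T : Type) (r : seq T) (P : pred T) (F : T -> extalg R n) u :
  extdot (\sum_(t <- r | P t) F t) u = \sum_(t <- r | P t) extdot (F t) u.
Proof.
by apply: (big_morph (fun v => extdot v u)) => [v w|]; rewrite ?extdotDl ?extdot0l.
Qed.

Lemma extdot_sumr (T : Type) (r : seq T) (P : pred T) (F : T -> extalg R n) u :
  extdot u (\sum_(t <- r | P t) F t) = \sum_(t <- r | P t) extdot u (F t).
Proof. by rewrite extdotC extdot_suml; apply: eq_bigr => t _; exact: extdotC. Qed.

Definition ext_basis I : extalg R n := [ffun J => (J == I)%:R].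

Lemma extdot_basisr I u : extdot u (ext_basis I) = u I.
Proof.
rewrite /extdot (bigD1 I) //= ffunE eqxx mulr1 big1 ?addr0 // => J /negbTE JI.
by rewrite ffunE JI mulr0.
Qed.

Lemma homog_basis I : homog #|I| (ext_basis I).
Proof.
by move=> J JI; rewrite ffunE; have [JE|//] := eqVneq J I; rewrite JE eqxx in JI.
Qed.

Lemma extdot_eqP u v : (forall w, extdot w u = extdot w v) -> u = v.
Proof. by move=> uv; apply/ffunP => I; rewrite -!extdot_basisr !(extdotC _ (ext_basis I)) uv. Qed.

Lemma ext_wedge_is_linear i : linear (@ext_wedge R n i).
Proof.
move=> a u v; apply/ffunP => I; rewrite !ffunE; case: ifP => _; rewrite ?scaler0 ?addr0//.
by rewrite mulrDr mulrCA.
Qed.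

HB.instance Definition _ i :=
  GRing.isLinear.Build R (extalg R n) (extalg R n) *:%R (@ext_wedge R n i)
    (ext_wedge_is_linear i).

Lemma ext_contr_is_linear i : linear (@ext_contr R n i).
Proof.
move=> a u v; apply/ffunP => I; rewrite !ffunE; case: ifP => _; rewrite ?scaler0 ?addr0//.
by rewrite mulrDr mulrCA.
Qed.

HB.instance Definition _ i :=
  GRing.isLinear.Build R (extalg R n) (extalg R n) *:%R (@ext_contr R n i)
    (ext_contr_is_linear i).

Lemma ext_sign_sqr i I : ext_sign R i I * ext_sign R i I = 1.
Proof. by rewrite -expr2 sqrr_sign. Qed.

(** Removing i from I changes the number of elements below j exactly when i < j. *)
Lemma ext_signD1 i j I : i \in I ->
  ext_sign R j I = (-1) ^+ (i < j)%N * ext_sign R j (I :\ i)%SET.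
Proof.
move=> iI; rewrite /ext_sign; set A := finset _; set B := finset _.
rewrite -exprD; congr (_ ^+ _).
rewrite (cardsD1 i A) !inE iI /=; congr (_ + _)%N; apply: eq_card => l.
by rewrite !inE andbA.
Qed.

Lemma ext_sign_self i I : ext_sign R i (i |: I)%SET = ext_sign R i I.
Proof.
congr (_ ^+ _); apply: eq_card => l; rewrite !inE; case: (eqVneq l i) => [->|//].
by rewrite ltnn !andbF.
Qed.

Lemma ext_sign_selfD i I : ext_sign R i (I :\ i)%SET = ext_sign R i I.
Proof.
congr (_ ^+ _); apply: eq_card => l; rewrite !inE; case: (eqVneq l i) => [->|//].
by rewrite ltnn !andbF.
Qed.

Lemma ext_wedgeC i j u : ext_wedge i (ext_wedge j u) = - ext_wedge j (ext_wedge i u).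
Proof.
apply/ffunP => I; rewrite !ffunE !inE (eq_sym i j).
have [->|ji] := eqVneq j i; first by rewrite mulr0 if_same oppr0.
have [iI|] := boolP (i \in I); have [jI|] := boolP (j \in I); rewrite /= ?mulr0 ?oppr0 //.
rewrite [(I :\ i :\ j)%SET](_ : _ = (I :\ j :\ i)%SET); last first.
  by apply/setP => l; rewrite !inE andbCA.
rewrite !mulrA -mulNr; congr (_ * _).
rewrite (ext_signD1 j iI) (ext_signD1 i jI) -!mulrA (mulrC (ext_sign R i _)) -mulNr.
(* As i and j differ, exactly one of the two inversions occurs; this is where the minus sign comes
   from. *)
have -> : - (-1) ^+ (i < j)%N = (-1) ^+ (j < i)%N :> R.
  case: (ltngtP i j) => [ij|ij|/val_inj ij]; rewrite ?expr0 ?expr1 ?opprK //.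
  by rewrite ij eqxx in ji.
by rewrite (mulrC (ext_sign R j _)).
Qed.

(** Transpose of [ext_wedgeC], contraction being the adjoint of exterior multiplication. *)
Lemma ext_contrC i j u : ext_contr i (ext_contr j u) = - ext_contr j (ext_contr i u).
Proof.
apply: extdot_eqP => w; rewrite extdotNr -!ext_wedge_contr ext_wedgeC extdotNl.
by [].
Qed.

Lemma ext_wedge_contrE i u : ext_wedge i (ext_contr i u) =
  [ffun I : {set 'I_n} => if i \in I then u I else 0].
Proof.
apply/ffunP => I; rewrite !ffunE; case: ifP => // iI.
by rewrite !inE eqxx /= ext_sign_selfD mulrA ext_sign_sqr mul1r finset.setD1K.
Qed.

Lemma ext_contr_wedgeE i u : ext_contr i (ext_wedge i u) =
  [ffun I : {set 'I_n} => if i \in I then 0 else u I].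
Proof.
apply/ffunP => I; rewrite !ffunE; case: ifP => // /negbT iI.
by rewrite !inE eqxx /= ext_sign_self mulrA ext_sign_sqr mul1r finset.setU1K.
Qed.

(** The i-th term is the projection onto the basis forms containing dx^i, so dx^I is counted #|I|
    times. This gives the factor in d (koszul c'). *)
Lemma sum_wedge_contr k u : homog k u ->
  \sum_i ext_wedge i (ext_contr i u) = k%:R *: u.
Proof.
move=> hu; apply/ffunP => I; rewrite sum_ffunE ffunE.
under eq_bigr do rewrite ext_wedge_contrE ffunE.
rewrite -big_mkcond /= sumr_const scaler_nat.
by have [<-//|/hu ->] := eqVneq #|I| k; rewrite !mul0rn.
Qed.

(** The i-th term projects onto the basis forms without dx^i, so dx^I is counted once for each index
    outside I. *)
Lemma sum_contr_wedge k u : homog k u ->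
  \sum_i ext_contr i (ext_wedge i u) = (n - k)%:R *: u.
Proof.
move=> hu; apply/ffunP => I; rewrite sum_ffunE ffunE.
under eq_bigr do rewrite ext_contr_wedgeE ffunE -if_neg.
rewrite -big_mkcond /= sumr_const scaler_nat.
have [Ik|/hu ->] := eqVneq #|I| k; last by rewrite !mul0rn.
congr (_ *+ _); have IE := cardsC I; rewrite card_ord in IE; rewrite -Ik.
apply/eqP; rewrite -(eqn_add2l #|I|) subnKC; last by have := max_card I; rewrite card_ord.
apply/eqP/(etrans _ IE); congr (_ + _)%N.
by apply: eq_card => i; rewrite !inE.
Qed.

Lemma homogD k u v : homog k u -> homog k v -> homog k (u + v).
Proof. by move=> hu hv I Ik; rewrite ffunE hu // hv // addr0. Qed.

Lemma homogZ k a u : homog k u -> homog k (a *: u).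
Proof. by move=> hu I Ik; rewrite ffunE hu // scaler0. Qed.

Lemma homogN k u : homog k u -> homog k (- u).
Proof. by move=> hu; rewrite -scaleN1r; exact: homogZ. Qed.

Lemma homog0 k : homog k (0 : extalg R n).
Proof. by move=> I _; rewrite ffunE. Qed.

Lemma homog_sum k (T : Type) (r : seq T) (P : pred T) (F : T -> extalg R n) :
  (forall t, homog k (F t)) -> homog k (\sum_(t <- r | P t) F t).
Proof. by move=> hF; elim/big_ind : _ => //; [exact: homog0|exact: homogD]. Qed.

Lemma homog_wedge k i u : homog k u -> homog k.+1 (ext_wedge i u).
Proof.
move=> hu I Ik; rewrite ffunE; case: ifP => // iI; rewrite hu ?mulr0 //.
by apply: contraNneq Ik => <-; rewrite (cardsD1 i) iI.
Qed.

Lemma homog_contr k i u : homog k.+1 u -> homog k (ext_contr i u).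
Proof.
move=> hu I Ik; rewrite ffunE; case: ifP => // /negbT iI; rewrite hu ?mulr0 //.
apply: contraNneq Ik => /eqP; rewrite cardsU1 iI add1n eqSS.
by [].
Qed.

Lemma shuffle_sign_sqr I : shuffle_sign R I * shuffle_sign R I = 1.
Proof. by rewrite -expr2 sqrr_sign. Qed.

(** A parity count. The inversions B of i |: J and C of J share the pairs E avoiding i. What remains
    of B are the pairs (i, q), counted by A; what remains of C are the pairs (p, i), counted by F;
    and J splits into D (below i) and F (above i). *)
Lemma shuffle_signU1 i J : i \notin J ->
  ext_sign R i (~: J)%SET * shuffle_sign R (i |: J)%SET =
  (-1) ^+ #|J| * (shuffle_sign R J * ext_sign R i J).
Proof.
move=> iJ; rewrite /ext_sign /shuffle_sign -!exprD.
set A := finset _; set B := finset _; set C := finset _; set D := finset _.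
pose E := finset (fun p : 'I_n * 'I_n =>
  [&& p.1 \in J, p.2 \notin (i |: J)%SET & (p.2 < p.1)%N]).
pose F := finset (fun j => (j \in J) && (i < j)%N).
have BE : #|B| = (#|E| + #|A|)%N.
  rewrite -(cardsID E B); congr (_ + _)%N.
    by apply: eq_card => -[p q]; rewrite !inE; case: (p == i); case: (q == i);
      case: (p \in J); case: (q \in J); case: (q < p)%N.
  rewrite -(@card_imset _ _ (fun q : 'I_n => (i, q))) => [|? ? []//].
  apply: eq_card => -[p q]; rewrite !inE; apply/idP/imsetP => [|[l]]; last first.
    rewrite !inE => /andP[lJ li] [-> ->]; rewrite eqxx /= (negbTE iJ) negb_or lJ li /= !andbT.
    by apply: contraTneq li => ->; rewrite ltnn.
  have [->|pi] /= := eqVneq p i; last first.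
    by case: (p \in J); case: (q == i); case: (q \in J); case: (q < p)%N.
  rewrite negb_or => /andP[_ /andP[/andP[qi qJ] li]].
  by exists q => //; rewrite !inE qJ.
have CE : #|C| = (#|E| + #|F|)%N.
  rewrite -(cardsID E C); congr (_ + _)%N.
    by apply: eq_card => -[p q]; rewrite !inE; case: (p == i); case: (q == i);
      case: (p \in J); case: (q \in J); case: (q < p)%N.
  rewrite -(@card_imset _ _ (fun p : 'I_n => (p, i))) => [|? ? []//].
  apply: eq_card => -[p q]; rewrite !inE; apply/idP/imsetP => [|[l]]; last first.
    by rewrite !inE => /andP[lJ li] [-> ->]; rewrite eqxx /= iJ lJ li.
  have [->|qi] /= := eqVneq q i; last by case: (p \in J); case: (q \in J); case: (q < p)%N.
  by move=> /andP[_ /and3P[pJ _ ip]]; exists p => //; rewrite !inE pJ.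
have JE : #|J| = (#|D| + #|F|)%N.
  rewrite -(cardsID D J); congr (_ + _)%N; apply: eq_card => l; rewrite !inE.
    by case: (l \in J).
  have [lJ|//] := boolP (l \in J).
    rewrite /= -leqNgt leq_eqVlt andbT orb_idl // => /eqP /val_inj il.
    by rewrite il lJ in iJ.
have {BE CE JE} odd_eq : odd (#|A| + #|B|) = odd (#|J| + (#|C| + #|D|)).
  by rewrite BE CE JE !oddD; case: (odd #|A|); case: (odd #|D|); case: (odd #|E|); case: (odd #|F|).
by rewrite -[LHS]signr_odd odd_eq signr_odd.
Qed.

Lemma hodge_contr k i u : homog k.+1 u ->
  hodge (ext_contr i u) = (-1) ^+ k *: ext_wedge i (hodge u).
Proof.
move=> hu; apply/ffunP => I; rewrite !ffunE inE.
have [iI|iI] := boolP (i \in I); last by rewrite mulr0 scaler0.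
rewrite /=; have -> : (~: (I :\ i))%SET = (i |: ~: I)%SET.
  by apply/setP => l; rewrite !inE negb_and negbK.
have iJ : i \notin (~: I)%SET by rewrite inE iI.
have [kI|kI] := eqVneq #|(~: I)%SET| k; last first.
  by rewrite hu ?mulr0 ?scaler0 // cardsU1 iJ eqSS.
rewrite -[RHS]/((-1) ^+ k *
  (ext_sign R i I * (shuffle_sign R (i |: ~: I)%SET * u (i |: ~: I)%SET))).
have := shuffle_signU1 iJ; rewrite finset.setCK kI => sE.
rewrite !mulrA; congr (_ * _); rewrite -mulrA sE.
by rewrite mulrA -expr2 sqrr_sign mul1r.
Qed.

Lemma hodge_is_linear : linear (@hodge R n).
Proof.
move=> a u v; apply/ffunP => I; rewrite !ffunE mulrDr; congr (_ + _).
by rewrite mulrCA.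
Qed.

HB.instance Definition _ :=
  GRing.isLinear.Build R (extalg R n) (extalg R n) *:%R (@hodge R n) hodge_is_linear.

Lemma homog_hodge k u : (k <= n)%N -> homog (n - k) u -> homog k (hodge u).
Proof.
move=> kn hu I Ik; rewrite ffunE hu ?mulr0 //.
rewrite -(eqn_add2l #|I|) cardsC card_ord; apply: contraNneq Ik => nE.
by rewrite -(eqn_add2r (n - k)) -nE subnKC.
Qed.

(** The inverse star. Taking the shuffle sign of I instead of its complement avoids the
    degree-dependent sign of the square of the star. *)
Definition unhodge u : extalg R n :=
  [ffun I : {set 'I_n} => shuffle_sign R I * u (~: I)%SET].

Lemma unhodgeK u : hodge (unhodge u) = u.
Proof. by apply/ffunP => I; rewrite !ffunE mulrA shuffle_sign_sqr mul1r finset.setCK. Qed.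

Lemma homog_unhodge k u : (k <= n)%N -> homog k u -> homog (n - k) (unhodge u).
Proof.
move=> kn hu I Ik; rewrite ffunE hu ?mulr0 //; apply: contraNneq Ik => kE.
by rewrite -(eqn_add2r #|(~: I)%SET|) cardsC card_ord kE subnK.
Qed.

(* Up to sign, the conjugate of [koszul] by [hodge] (see [hodge_koszul]); [P1starP] uses it
   to describe P_1^{*,-} without Hodge stars. *)
Definition dual_koszul u : dform R n := fun x => \sum_i x 0 i *: ext_wedge i u.

Lemma hodge_koszul k u x : homog k.+1 u ->
  hodge (koszul u x) = (-1) ^+ k *: dual_koszul (hodge u) x.
Proof.
move=> hu; rewrite linear_sum /= scaler_sumr; apply: eq_bigr => i _.
by rewrite linearZ /= (hodge_contr _ hu) scalerA mulrC -scalerA.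
Qed.

Lemma dual_koszulZ a u x : dual_koszul (a *: u) x = a *: dual_koszul u x.
Proof.
by rewrite /dual_koszul scaler_sumr; apply: eq_bigr => i _; rewrite linearZ /= !scalerA mulrC.
Qed.

Lemma P1starP k (eta : dform R n) : (k < n)%N -> P1star k.+1 eta <->
  exists c c', [/\ homog k.+1 c, homog k c' & eta = fun x => c + dual_koszul c' x].
Proof.
move=> kn; have nkE : (n - k = (n - k.+1).+1)%N by rewrite subnSK.
split=> [[s [c [c' [hc hc' ->]]] ->]|[c [c' [hc hc' ->]]]].
  exists (hodge c), ((-1) ^+ (n - k.+1) *: hodge c'); split.
  - exact: homog_hodge.
  - by apply: homogZ; apply: homog_hodge; rewrite ?nkE // ltnW.
  - by apply/funext => x; rewrite linearD /= (hodge_koszul _ hc') dual_koszulZ.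
(* The sign cancels the one produced by [hodge_koszul]. *)
set e : extalg R n := (-1) ^+ (n - k.+1) *: unhodge c'.
have he : homog (n - k.+1).+1 e.
  by apply: homogZ; rewrite -nkE; apply: homog_unhodge => //; exact: ltnW.
exists (fun x => unhodge c + koszul e x).
  by exists (unhodge c), e; split=> //; exact: homog_unhodge.
apply/funext => x; rewrite linearD /= (hodge_koszul _ he) unhodgeK; congr (_ + _).
by rewrite linearZ /= unhodgeK dual_koszulZ scalerA -expr2 sqrr_sign scale1r.
Qed.

Lemma homog_koszul k c x : homog k.+1 c -> homog k (koszul c x : extalg R n).
Proof. by move=> hc; apply: homog_sum => i; apply: homogZ; exact: homog_contr. Qed.

Lemma homog_dual_koszul k c x : homog k c -> homog k.+1 (dual_koszul c x).
Proof. by move=> hc; apply: homog_sum => i; apply: homogZ; exact: homog_wedge. Qed.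

End exterior_algebra_theory.

(** * Lebesgue measure on R^n *)

Section rV_measure.
Variables (R : realType) (n : nat).
Local Notation E := 'rV[R]_n.
Local Notation mu := (lebesgue_rV R n).
Implicit Types (a b x y : E) (X : set E) (i : 'I_n).

Definition obox a b : set E := [set x | forall i, a 0 i < x 0 i < b 0 i].
Definition cbox a b : set E := [set x | forall i, a 0 i <= x 0 i <= b 0 i].

Lemma rV_coord_le x i : `|x 0 i| <= `|x|.
Proof.
rewrite [leRHS]/Num.norm /= mx_normrE; apply/bigmax_geP; right => /=.
by exists (ord0, i).
Qed.

Lemma rV_open_ball X x : open X -> X x ->
  exists2 e : R, 0 < e & forall y, (forall i, `|x 0 i - y 0 i| < e) -> X y.
Proof.
move=> oX Xx; have /nbhs_ballP[e /= e0 eX] : nbhs x X by exact: open_nbhs_nbhs.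
exists e => // y xy; apply: eX; split => // j i; rewrite (ord1 j).
exact: xy.
Qed.

Lemma cbox_compact a b : compact (cbox a b).
Proof.
apply: (@rV_compact R n (fun i => `[a 0 i, b 0 i]%classic)) => i.
exact: segment_compact.
Qed.

Lemma measurable_obox a b : measurable (obox a b).
Proof.
rewrite (_ : obox a b =
    \bigcap_(i in [set: 'I_n]) ((fun x => x ord0 i) @^-1` `]a 0 i, b 0 i[%classic)).
  apply: fin_bigcap_measurable => // i _; rewrite -[X in measurable X]setTI.
  by apply: measurable_rV_coord.
apply/seteqP; split => x /= H i.
  by move=> _; rewrite /= in_itv /=; exact: H.
by have := H i I; rewrite /= in_itv.
Qed.

(** The boxes are cubes with rational centre and radius 1/(N+1), enumerated through [pickle]. The
    closed cubes are required to lie in X so that functions supported in them have compact support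
    in X. *)
Lemma open_bigcup_obox X : open X -> exists (P : set nat) (a b : nat -> E),
  X = \bigcup_(k in P) obox (a k) (b k) /\
  forall k, P k -> cbox (a k) (b k) `<=` X.
Proof.
move=> oX.
pose c k : option ('rV[rat]_n * nat) := unpickle k.
pose cen k : E := if c k is Some q then map_mx ratr q.1 else 0.
pose rad k : R := if c k is Some q then q.2.+1%:R^-1 else 0.
pose a k : E := cen k - const_mx (rad k); pose b k : E := cen k + const_mx (rad k).
pose P := [set k | cbox (a k) (b k) `<=` X].
exists P, a, b; split => //; apply/seteqP; split; last first.
  by move=> x [k Pk abx]; apply: Pk => i; have /andP[/ltW -> /ltW ->] := abx i.
move=> x Xx; have [e e0 eX] := rV_open_ball oX Xx.
(* The radius must be below e/2: a point of the cube is within one radius of the centre, which is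
   itself within one radius of x. *)
pose N := Num.bound (2 / e).
have N2 : 2 / e < N.+1%:R.
  by rewrite (lt_trans (archi_boundP _)) ?ltr_nat// divr_ge0// ltW.
have r0 : 0 < N.+1%:R^-1 :> R by rewrite invr_gt0.
have re : N.+1%:R^-1 < e / 2.
  by rewrite -[ltRHS]invf_div ltf_pV2 ?posrE ?divr_gt0 ?ltr0Sn.
have q_ex i : exists q : rat, ratr q \in `]x 0 i - N.+1%:R^-1, x 0 i + N.+1%:R^-1[.
  by apply: rat_in_itvoo; rewrite ltrD2l gtrN.
pose q : 'rV[rat]_n := \row_i sval (cid (q_ex i)).
have qP i : `|x 0 i - ratr (q 0 i)| < N.+1%:R^-1.
  have := svalP (cid (q_ex i)); rewrite /q mxE; set z := sval _.
  by rewrite in_itv /= ltr_distlC.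
pose k := pickle (q, N).
have ckE : c k = Some (q, N) by rewrite /c /k pickleK.
have abE i : (a k 0 i = ratr (q 0 i) - N.+1%:R^-1) * (b k 0 i = ratr (q 0 i) + N.+1%:R^-1).
  by rewrite /a /b /cen /rad ckE !mxE.
exists k.
  move=> y yab; apply: eX => i; have := yab i; rewrite !abE => yi.
  rewrite (splitr e) -(subrKA (ratr (q 0 i))) (le_lt_trans (ler_normD _ _))// ltrD//.
    exact: lt_trans re.
  apply: le_lt_trans re; rewrite distrC ler_distl.
  by [].
by move=> i; rewrite !abE -ltr_distl.
Qed.

(** The sigma-algebra is generated by the coordinates, so open sets are reached through countable
    unions of boxes. *)
Lemma open_measurable_rV X : open X -> measurable X.
Proof.
move=> /open_bigcup_obox[P [a [b [-> _]]]].
by apply: bigcup_measurable => k _; exact: measurable_obox.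
Qed.

Lemma closed_measurable_rV X : closed X -> measurable X.
Proof.
move=> cX; rewrite -[X]setCK; apply: measurableC; apply: open_measurable_rV.
exact: closed_openC.
Qed.

Lemma continuous_measurable_rV (f : E -> R) : continuous f -> measurable_fun setT f.
Proof.
move=> /continuousP cf; apply: (measurability _ (RGenOpens.measurableE R)).
move=> _ [_ [a [b ->] <-]]; rewrite setTI; apply: open_measurable_rV.
exact/cf/interval_open.
Qed.

Lemma lebesgue_obox a b : (forall i, a 0 i <= b 0 i) ->
  mu (obox a b) = (\prod_i (b 0 i - a 0 i))%:E.
Proof.
move=> ab; rewrite -[LHS]/(mu [set x | forall i, [set t | a 0 i < t < b 0 i] (x ord0 i)]).
rewrite (@lebesgue_rV_box R n (fun i => [set t : measurableTypeR R| a 0 i < t < b 0 i])).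
  rewrite -prodEFin; apply: eq_bigr => i _.
  rewrite (_ : [set _ | _] = `]a 0 i, b 0 i[%classic).
    by rewrite lebesgue_measure_itv /= lte_fin; case: ltP => // ba;
      rewrite (le_anti (introT andP (conj ba (ab i)))) subrr.
  by apply/seteqP; split=> t; rewrite /= in_itv.
by move=> i; rewrite (_ : [set _ | _] = `]a 0 i, b 0 i[%classic).
Qed.

Lemma bounded_lebesgue_lty X : measurable X -> bounded_set X -> (mu X < +oo)%E.
Proof.
(* [bounded_set] gives bounds only strictly above M, hence |M| + 1; one more unit makes the open box
   contain X. *)
move=> mX [M [_ XM]]; pose c : R := `|M| + 2.
have XM' x : X x -> `|x| <= `|M| + 1.
  by move=> Xx; apply: XM => //; rewrite (le_lt_trans (ler_norm _))// ltrDl.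
have c0 : 0 <= c by rewrite addr_ge0.
apply: (@le_lt_trans _ _ (mu (obox (const_mx (- c)) (const_mx c)))).
  apply: le_measure; rewrite ?inE//; first exact: measurable_obox.
  move=> x Xx i; rewrite !mxE -ltr_norml (le_lt_trans (rV_coord_le x i))//.
  by rewrite (le_lt_trans (XM' x Xx))// ltrD2l ltr1n.
rewrite lebesgue_obox ?ltry// => i; rewrite !mxE.
by rewrite (le_trans _ c0)// oppr_le0.
Qed.

Lemma open_lebesgue_gt0 X : open X -> X !=set0 -> (0 < mu X)%E.
Proof.
move=> oX [x Xx]; have [e e0 eX] := rV_open_ball oX Xx.
pose a : E := x - const_mx e; pose b : E := x + const_mx e.
apply: (@lt_le_trans _ _ (mu (obox a b))).
  rewrite lebesgue_obox => [|i]; last by rewrite !mxE lerD2l ge0_cp// ltW.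
  rewrite lte_fin prodr_gt0// => i _; rewrite !mxE.
  by rewrite opprD opprK addrACA subrr add0r addr_gt0.
apply: le_measure; rewrite ?inE//; [exact: measurable_obox|exact: open_measurable_rV|].
by move=> y yab; apply: eX => i; have := yab i; rewrite !mxE -ltr_distl distrC.
Qed.

End rV_measure.

(** * Slices of R^n and directional derivatives along them *)

Section rV_slices.
Variables (R : realType).

Lemma continuous_sumr (T : topologicalType) (I : Type) (r : seq I) (P : pred I)
    (F : I -> T -> R) : (forall i, continuous (F i)) ->
  continuous (fun x => \sum_(i <- r | P i) F i x).
Proof.
move=> cF; elim: r => [|i r IH].
  rewrite (_ : (fun x => _) = cst 0); first exact: cst_continuous.
  by apply/funext => x; rewrite big_nil.
rewrite (_ : (fun x => _) = fun x => if P i then F i x + \sum_(j <- r | P j) F j x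
    else \sum_(j <- r | P j) F j x); last by apply/funext => x; rewrite big_cons.
case: (P i) => // x.
by apply: cvgD; [exact: cF|exact: IH].
Qed.

Lemma rV_continuous (T : topologicalType) n (h : T -> 'rV[R]_n) :
  (forall i, continuous (fun t => h t 0 i)) -> continuous h.
Proof.
move=> ch t A /nbhs_ballP[e /= e0 eA].
have /filterS : \forall s \near t, forall i, `|h t 0 i - h s 0 i| < e.
  apply: filter_forall => i; have := ch i t; move/cvgrPdist_lt; exact.
apply => s hs; apply: eA; split => // j i; rewrite (ord1 j); exact: hs.
Qed.

Lemma rVcons_continuousl n (y : 'rV[R]_n) : continuous (fun t : R => rVcons (t, y)).
Proof.
apply: rV_continuous => i t; under eq_fun do rewrite mxE.
by case: unliftP => [j _|_]; [exact: cvg_cst|exact: cvg_id].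
Qed.

Lemma rVcons_continuousr n (t : R) : continuous (fun y : 'rV[R]_n => rVcons (t, y)).
Proof.
apply: rV_continuous => i y; under eq_fun do rewrite mxE.
case: unliftP => [j _|_] /=; first exact: (@coord_continuous R 1 n ord0 j).
exact: cst_continuous.
Qed.

Lemma rVcons_shift0 n (h t : R) (y : 'rV[R]_n) :
  rVcons (h + t, y) = h *: delta_mx 0 ord0 + rVcons (t, y).
Proof.
apply/rowP => i; rewrite !mxE /=; case: unliftP => [j ->|->] //=.
  by rewrite mulr0 add0r.
by rewrite mulr1.
Qed.

Lemma rVcons_shift n (h t : R) (y : 'rV[R]_n) j :
  rVcons (t, h *: delta_mx 0 j + y) = h *: delta_mx 0 (lift ord0 j) + rVcons (t, y).
Proof.
apply/rowP => i; rewrite !mxE /=; case: unliftP => [l ->|->] //=.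
  by rewrite !mxE (inj_eq lift_inj).
by rewrite mulr0 add0r.
Qed.

(** The two difference quotients are the same function of h. This moves directional derivatives
    between R^n, its slices and the real line. *)
Lemma derive_transfer (V W : normedModType R) (F : V -> R) (G : W -> R) x v y w :
  (forall h : R, F (h *: v + x) = G (h *: w + y)) ->
  (derivable F x v <-> derivable G y w) * ('D_v F x = 'D_w G y).
Proof.
move=> FG; have F0 : F x = G y by have := FG 0; rewrite !scale0r !add0r.
have qE : (fun h => h^-1 *: ((F \o shift x) (h *: v) - F x)) =
          (fun h => h^-1 *: ((G \o shift y) (h *: w) - G y)).
  by apply/funext => h /=; rewrite FG F0.
by rewrite /derivable /derive qE; split.
Qed.

Lemma is_derive_line (V : normedModType R) (F : V -> R) x v t :
  derivable F (x + t *: v) v ->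
  is_derive t 1 (fun s : R => F (x + s *: v)) ('D_v F (x + t *: v)).
Proof.
move=> dF; have [d1 d2] := @derive_transfer R^o V
  (fun s : R => F (x + s *: v)) F t 1 (x + t *: v) v (ltac:(by move=> h;
    rewrite addrCA -scalerDl [h *: 1]mulr1)).
by split; [apply/d1|].
Qed.

Lemma derive_out_closed (V : normedModType R) (F : V -> R) (K : set V) v x :
  closed K -> (forall y, ~ K y -> F y = 0) -> ~ K x -> 'D_v F x = 0.
Proof.
move=> cK F0 Kx; rewrite -(derive_cst (0 : R) x v).
apply: near_eq_derive.
have : nbhs x (~` K) by apply: open_nbhs_nbhs; split => //; exact: closed_openC.
by apply: filterS => y; exact: F0.
Qed.

End rV_slices.

(** * Fubini's theorem and null hyperplanes *)

Section rV_fubini.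
Variable R : realType.
Local Notation mu n := (lebesgue_rV R n).

(** The measure in dimension n + 1 is by construction the push-forward of a product measure by
    [rVcons]. Both orders of integration are kept: the inner variable is chosen according to the
    direction of the derivative in [integral_partial]. *)
Lemma rV_fubini n (f : 'rV[R]_n.+1 -> \bar R) : (mu n.+1).-integrable setT f ->
  (\int[mu n.+1]_x f x =
     \int[@lebesgue_measure R]_t \int[mu n]_y f (rVcons (t, y)))%E /\
  (\int[mu n.+1]_x f x =
     \int[mu n]_y \int[@lebesgue_measure R]_t f (rVcons (t, y)))%E.
Proof.
move=> intf; have mc := @measurable_rVcons R n.
have mf : measurable_fun setT f by case/integrableP : intf.
have intg : ((@lebesgue_measure R \x mu n)%E).-integrable setT (f \o @rVcons R n).
  apply/integrableP; split; first exact: measurableT_comp.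
  have /integrableP[_] := intf; apply: le_lt_trans.
  rewrite [leRHS](_ : _ =
    \int[pushforward (@lebesgue_measure R \x mu n)%E (@rVcons R n)]_x `|f x|)%E//.
  by rewrite ge0_integral_pushforward//; exact: measurableT_comp.
have -> : (\int[mu n.+1]_x f x =
    \int[(@lebesgue_measure R \x mu n)%E]_z (f \o @rVcons R n) z)%E.
  rewrite -[LHS]/(\int[pushforward (@lebesgue_measure R \x mu n)%E (@rVcons R n)]_x f x)%E.
  by rewrite integral_pushforward.
by split; [rewrite -integral12_prod_meas1|rewrite -integral21_prod_meas1].
Qed.

Lemma hyperplane_closed n (a : 'I_n -> R) (b : R) :
  closed [set x : 'rV[R]_n | \sum_i a i * x 0 i = b].
Proof.
rewrite (_ : [set _ | _] = (fun x : 'rV[R]_n => \sum_i a i * x 0 i) @^-1` [set b]) //.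
apply: closed_comp; last exact: closed_eq.
move=> x _; apply: continuous_sumr => i y.
exact: (cvgMl_tmp (coord_continuous (x := y))).
Qed.

(** Slice by the first coordinate t. If a later coefficient is nonzero, every slice is a hyperplane
    one dimension lower; otherwise the slice is empty except at the single value t = b / a_0. *)
Lemma lebesgue_hyperplane n (a : 'I_n -> R) (b : R) : (exists i, a i != 0) ->
  mu n [set x : 'rV[R]_n | \sum_i a i * x 0 i = b] = 0%E.
Proof.
elim: n a b => [|n IH] a b [i ai0]; first by case: i ai0.
set N := [set x | _].
have mN : measurable N by apply: closed_measurable_rV; exact: hyperplane_closed.
have mN' : measurable (@rVcons R n @^-1` N).
  by rewrite -[X in measurable X]setTI; exact: measurable_rVcons.
rewrite -[LHS]/((@lebesgue_measure R \x mu n)%E (@rVcons R n @^-1` N)).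
rewrite /product_measure1 /=.
have sE t : xsection (@rVcons R n @^-1` N) t =
    [set y | \sum_j a (lift ord0 j) * y 0 j = b - a ord0 * t].
  apply/seteqP; split=> y; rewrite /xsection /= inE /N /= big_ord_recl mxE unlift_none /=.
    move=> <-; rewrite addrAC subrr add0r; apply: eq_bigr => j _.
    by rewrite mxE liftK.
  move=> yE; rewrite (_ : \sum_(_ < n) _ = b - a ord0 * t) ?subrKC //.
  by rewrite -yE; apply: eq_bigr => j _; rewrite mxE liftK.
have [[j aj0]|a0] := pselect (exists j, a (lift ord0 j) != 0).
  rewrite integral0_eq// => t _; rewrite sE; apply: (IH (fun j => a (lift ord0 j))).
  by exists j.
have {}a0 j : a (lift ord0 j) = 0.
  by apply/eqP/negPn/negP => aj; apply: a0; exists j.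
have a00 : a ord0 != 0.
  by move: ai0; case: (unliftP ord0 i) => [j ->|->//]; rewrite a0 eqxx.
rewrite (@ge0_negligible_integral _ _ _ (@lebesgue_measure R) setT [set b / a ord0])//=.
- rewrite integral0_eq// => t [_ /= tN]; rewrite sE (_ : [set _ | _] = set0) ?measure0//.
  apply/seteqP; split=> // y /=; rewrite big1 => [/esym/eqP|j _]; last by rewrite a0 mul0r.
  by rewrite subr_eq0 => /eqP bE; apply: tN; rewrite bE mulrAC mulfV // mul1r.
- exact: measurable_fun_xsection.
- exact: lebesgue_measure_set1.
Qed.

End rV_fubini.

(** * Integration by parts *)

Section integration_by_parts.
Variable R : realType.
Local Notation mu n := (lebesgue_rV R n).

Lemma compact_closed_rV n (K : set 'rV[R]_n) : compact K -> closed K.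
Proof. by move=> cK; apply: compact_closed; [exact: norm_hausdorff|exact: cK]. Qed.

Lemma closed_cbox n (a b : 'rV[R]_n) : closed (cbox a b).
Proof. by apply: compact_closed_rV; exact: cbox_compact. Qed.

Lemma measurable_cbox n (a b : 'rV[R]_n) : measurable (cbox a b).
Proof. by apply: closed_measurable_rV; exact: closed_cbox. Qed.

Lemma lebesgue_compact_lty n (K : set 'rV[R]_n) : compact K -> (mu n K < +oo)%E.
Proof.
move=> cK; apply: bounded_lebesgue_lty; last exact: compact_bounded.
by apply: closed_measurable_rV; exact: compact_closed_rV.
Qed.

Lemma integrable_compact_support n (K : set 'rV[R]_n) (g : 'rV[R]_n -> R) :
  compact K -> continuous g -> (forall x, ~ K x -> g x = 0) ->
  (mu n).-integrable setT (EFin \o g).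
Proof.
move=> cK cg g0.
have mK : measurable K.
  by apply: closed_measurable_rV; exact: compact_closed_rV.
have gK : (mu n).-integrable K (EFin \o g).
  apply: measurable_bounded_integrable => //.
  - exact: lebesgue_compact_lty.
  - by apply: measurable_funTS; exact: continuous_measurable_rV.
  - have /compact_bounded[M [Mr MP]] : compact (g @` K).
      by apply: continuous_compact => //; exact: continuous_subspaceT.
    by exists M; split => // y My x Kx; apply: MP => //; exists x.
have -> : EFin \o g = (EFin \o g) \_ K.
  by apply/funext => x; rewrite patchE; case: ifPn => //; rewrite notin_setE /= => /g0 ->.
by apply/integrable_restrict => //; rewrite setTI.
Qed.

(** For the first coordinate, integrate along it first and use the fundamental theorem of calculus;
    for the others, freeze the first coordinate and use induction. The support is enclosed in a cube
    because its slices lie in a cube with the same M. *)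
Lemma integral_partial n (i : 'I_n) (f : 'rV[R]_n -> R) (M : R) :
  continuous f -> (forall x, derivable f x (delta_mx 0 i)) ->
  continuous ('D_(delta_mx 0 i) f) ->
  (forall x, ~ cbox (const_mx (- M)) (const_mx M) x -> f x = 0) ->
  (\int[mu n]_x ('D_(delta_mx 0 i) f x)%:E = 0)%E.
Proof.
elim: n i f => [[]//|n IH] i f cf df cdf f0.
pose K n : set 'rV[R]_n := cbox (const_mx (- M)) (const_mx M).
have df0 x : ~ K _ x -> 'D_(delta_mx 0 i) f x = 0.
  by apply: derive_out_closed => //; exact: closed_cbox.
have intdf : (mu n.+1).-integrable setT (EFin \o 'D_(delta_mx 0 i) f).
  by apply: integrable_compact_support df0 => //; exact: cbox_compact.
have [fub1 fub2] := rV_fubini intdf; rewrite /= in fub1 fub2.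
case: (unliftP ord0 i) => [j|] iE.
  rewrite fub1 integral0_eq// => t _.
  pose g (y : 'rV[R]_n) := f (rVcons (t, y)).
  have dg y : (derivable f (rVcons (t, y)) (delta_mx 0 i) <->
      derivable g y (delta_mx 0 j)) *
      ('D_(delta_mx 0 i) f (rVcons (t, y)) = 'D_(delta_mx 0 j) g y).
    by apply: derive_transfer => h; rewrite /g rVcons_shift iE.
  have dgE : 'D_(delta_mx 0 j) g = ('D_(delta_mx 0 i) f) \o (fun y => rVcons (t, y)).
    by apply/funext => y; rewrite /= dg.
  under eq_integral do rewrite dg; apply: IH.
  - by move=> y; apply: continuous_comp; [exact: rVcons_continuousr|exact: cf].
  - by move=> y; have [[+ _] _] := dg y; apply; exact: df.
  - by rewrite dgE => y; apply: continuous_comp; [exact: rVcons_continuousr|exact: cdf].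
  - move=> y Ky; apply: f0 => Kty; apply: Ky => l.
    by have := Kty (lift ord0 l); rewrite !mxE liftK.
rewrite fub2 integral0_eq// => y _.
pose F (t : R) : R := f (rVcons (t, y)).
pose F' (t : R) : R := 'D_(delta_mx 0 i) f (rVcons (t, y)).
have Kt t : M < `|t| -> ~ K n.+1 (rVcons (t, y)).
  move=> Mt /(_ ord0); rewrite !mxE unlift_none /= -ler_norml => tM.
  by rewrite ltNge tM in Mt.
have dF (t : R) : is_derive t 1 F (F' t).
  have Fh (h : R) : F (h *: 1 + t) = f (h *: delta_mx 0 i + rVcons (t, y)).
    by rewrite /F [h *: 1]mulr1 rVcons_shift0 iE.
  have [[_ d1] d2] := @derive_transfer R R^o _ F f t 1 _ _ Fh.
  by split => //; apply: d1; exact: df.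
have cF : continuous F.
  by move=> t; apply: continuous_comp; [exact: rVcons_continuousl|exact: cf].
have cF' : continuous F'.
  move=> t; apply: (@continuous_comp _ _ _ (fun s => rVcons (s, y)) ('D_(delta_mx 0 i) f)).
    exact: rVcons_continuousl.
  exact: cdf.
(* Both endpoints -c and c lie outside the support, so the boundary terms vanish. *)
pose c := `|M| + 1.
have Mc : M < c by rewrite (le_lt_trans (ler_norm M))// ltrDl.
have c0 : 0 < c by rewrite ltr_wpDl.
have -> : (\int[@lebesgue_measure R]_t (F' t)%:E =
    \int[@lebesgue_measure R]_(t in `[(- c)%R, c]) (F' t)%:E)%E.
  rewrite [RHS]integral_mkcond; apply: eq_integral => t _.
  rewrite patchE; case: ifPn => //; rewrite notin_setE /= in_itv /= => /negP tc.
  congr EFin; apply: df0; apply: Kt; apply: (lt_trans Mc).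
  by rewrite ltNge ler_norml.
rewrite (@continuous_FTC2 R F' F); first 1 last.
- by rewrite gtrN.
- exact: continuous_subspaceT.
- split; first by move=> t _; exact: (@ex_derive _ _ _ _ _ _ _ (dF t)).
    by apply: cvg_at_right_filter; exact: cF.
  by apply: cvg_at_left_filter; exact: cF.
- by move=> t _; rewrite derive1E (@derive_val _ _ _ _ _ _ _ (dF t)).
by rewrite /F !f0 ?subee//; apply: Kt; rewrite ?normrN gtr0_norm.
Qed.

(** [integral_partial] applied to the product, which inherits the compact support of f; g may be any
    function of class C^1 in the direction i, in particular a polynomial. *)
Lemma integral_partialM n (i : 'I_n) (f g : 'rV[R]_n -> R) (K : set 'rV[R]_n) :
  compact K -> (forall x, ~ K x -> f x = 0) ->
  continuous f -> continuous g ->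
  (forall x, derivable f x (delta_mx 0 i)) -> (forall x, derivable g x (delta_mx 0 i)) ->
  continuous ('D_(delta_mx 0 i) f) -> continuous ('D_(delta_mx 0 i) g) ->
  \int[mu n]_x ('D_(delta_mx 0 i) f x * g x) = - \int[mu n]_x (f x * 'D_(delta_mx 0 i) g x).
Proof.
move=> cK f0 cf cg df dg cdf cdg.
have clK : closed K by exact: compact_closed_rV.
have df0 x : ~ K x -> 'D_(delta_mx 0 i) f x = 0 by exact: derive_out_closed.
have cM (u v : 'rV[R]_n -> R) : continuous u -> continuous v -> continuous (u \* v).
  by move=> cu cv x; apply: continuousM; [exact: cu|exact: cv].
have int1 : (mu n).-integrable setT (EFin \o ('D_(delta_mx 0 i) f \* g)).
  by apply: (integrable_compact_support cK); [exact: cM|move=> x /df0 /= ->; rewrite mul0r].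
have int2 : (mu n).-integrable setT (EFin \o (f \* 'D_(delta_mx 0 i) g)).
  by apply: (integrable_compact_support cK); [exact: cM|move=> x /f0 /= ->; rewrite mul0r].
have DE : 'D_(delta_mx 0 i) (f \* g) = ('D_(delta_mx 0 i) f \* g) \+ (f \* 'D_(delta_mx 0 i) g).
  apply/funext => x; rewrite (deriveM (df x) (dg x)) /= addrC.
  by congr (_ + _); rewrite /GRing.scale /= mulrC.
apply/eqP; rewrite -addr_eq0 -RintegralD//; apply/eqP.
have [M0 [_ /(_ (`|M0| + 1)) KM]] := compact_bounded cK.
set M := `|M0| + 1 in KM.
suff -> : \int[mu n]_x ('D_(delta_mx 0 i) f x * g x + f x * 'D_(delta_mx 0 i) g x) =
    fine (\int[mu n]_x ('D_(delta_mx 0 i) (f \* g) x)%:E)%E.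
  rewrite (@integral_partial n i _ M)//.
  - exact: cM.
  - by move=> x; exact: derivableM.
  - rewrite DE => x; apply: continuousD.
      exact: (cM _ _ cdf cg x).
    exact: (cM _ _ cf cdg x).
  - move=> x Kx; rewrite /= f0 ?mul0r // => /KM xM; apply: Kx => l.
    rewrite !mxE -ler_norml (le_trans (rV_coord_le x l))// xM//.
    by rewrite (le_lt_trans (ler_norm _))// ltrDl.
congr fine; apply: eq_integral => x _; congr EFin.
by have /(congr1 (@^~ x)) := DE.
Qed.

End integration_by_parts.

(** * Smooth functions and bump functions *)

Section smooth_functions.
Variables (R : realType) (n : nat).
Local Notation E := 'rV[R]_n.
Local Notation pd i := (derive^~ (delta_mx 0 i)).
Implicit Types (f g : E -> R) (i j : 'I_n).

Lemma smooth_continuous f : smooth f -> continuous f.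
Proof. by move=> /(_ [::])[]. Qed.

Lemma smooth_derivable f i x : smooth f -> derivable f x (delta_mx 0 i).
Proof. by move=> /(_ [::])[_]; exact. Qed.

Lemma smooth_partial f i : smooth f -> smooth ('D_(delta_mx 0 i) f).
Proof. by move=> sf s; have := sf (rcons s i); rewrite foldr_rcons. Qed.

(** [smooth] quantifies over all words of directions; a class stable under partial derivatives
    disposes of the induction on words once and for all. *)
Lemma smooth_coind (P : set (E -> R)) :
  (forall f, P f -> continuous f /\ forall i x, derivable f x (delta_mx 0 i)) ->
  (forall f i, P f -> P ('D_(delta_mx 0 i) f)) ->
  P `<=` @smooth R n.
Proof.
move=> P1 P2 f Pf s; apply: P1.
by elim: s => //= i s IH; exact: P2.
Qed.

Lemma smoothD f g : smooth f -> smooth g -> smooth (f + g).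
Proof.
move=> sf sg; apply: (@smooth_coind [set h | exists f g, [/\ smooth f, smooth g & h = f + g]]).
- move=> _ [f1 [g1 [sf1 sg1 ->]]]; split=> [x|i x].
    by apply: continuousD; exact: smooth_continuous.
  by apply: derivableD; exact: smooth_derivable.
- move=> _ i [f1 [g1 [sf1 sg1 ->]]].
  exists ('D_(delta_mx 0 i) f1), ('D_(delta_mx 0 i) g1).
  split; try exact: smooth_partial.
  by apply/funext => x; rewrite deriveD //; exact: smooth_derivable.
- by exists f, g.
Qed.

Lemma smoothZ (a : R) f : smooth f -> smooth (a \*: f).
Proof.
move=> sf; apply: (@smooth_coind [set h | exists f, smooth f /\ h = a \*: f]).
- move=> _ [f1 [sf1 ->]]; split=> [x|i x].
    by apply: continuousZr; exact: smooth_continuous.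
  by apply: derivableZ; exact: smooth_derivable.
- move=> _ i [f1 [sf1 ->]]; exists ('D_(delta_mx 0 i) f1).
  split; first exact: smooth_partial.
  by apply/funext => x; rewrite deriveZ //; exact: smooth_derivable.
- by exists f.
Qed.

Lemma smooth0 : smooth (fun _ : E => 0 : R).
Proof.
apply: (@smooth_coind [set cst 0]) => // [f ->|f i ->].
  by split=> [x|i x]; [exact: cst_continuous|exact: derivable_cst].
by apply/funext => x; rewrite derive_cst.
Qed.

Lemma smooth_sum (I : Type) (r : seq I) (F : I -> E -> R) :
  (forall k, smooth (F k)) -> smooth (fun x => \sum_(k <- r) F k x).
Proof.
move=> sF; elim: r => [|k r IH].
  by rewrite (_ : (fun x => _) = fun=> 0); [exact: smooth0|apply/funext => x; rewrite big_nil].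
rewrite (_ : (fun x => _) = F k + fun x => \sum_(l <- r) F l x); first exact: smoothD.
by apply/funext => x; rewrite big_cons.
Qed.

(* The second difference quotient of f in the directions i and j is, by two
   applications of the mean value theorem, a value of the mixed derivative. *)
Lemma mixed_difference f i j x (h : R) : smooth f -> 0 < h ->
  exists2 st : R * R, 0 < st.1 < h /\ 0 < st.2 < h &
  f (x + h *: delta_mx 0 j + h *: delta_mx 0 i) - f (x + h *: delta_mx 0 i) -
    (f (x + h *: delta_mx 0 j) - f x) =
  'D_(delta_mx 0 j) ('D_(delta_mx 0 i) f)
    (x + st.1 *: delta_mx 0 i + st.2 *: delta_mx 0 j) * h * h.
Proof.
move=> sf h0; set ei : E := delta_mx 0 i; set ej : E := delta_mx 0 j.
have line g (y v : E) (t : R) : smooth g -> (v = ei \/ v = ej) ->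
    is_derive t 1 (fun s : R => g (y + s *: v)) ('D_v g (y + t *: v)).
  by move=> sg [] ->; apply: is_derive_line; exact: smooth_derivable.
pose G (s : R) := f (x + h *: ej + s *: ei) - f (x + s *: ei).
pose G' (s : R) := 'D_ei f (x + h *: ej + s *: ei) - 'D_ei f (x + s *: ei).
have dG (s : R) : is_derive s 1 G (G' s).
  by apply: is_deriveB; apply: line => //; left.
have cts (g g' : R -> R) a b : (forall s : R, is_derive s 1 g (g' s)) ->
    {within `[a, b], continuous g}.
  move=> dg; apply: derivable_within_continuous => s _.
  by have := dg s; case.
have [s s0h Gs] := MVT h0 (fun s _ => dG s) (cts _ _ _ _ dG).
pose H (t : R) := 'D_ei f (x + s *: ei + t *: ej).
have dH (t : R) : is_derive t 1 H ('D_ej ('D_ei f) (x + s *: ei + t *: ej)).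
  by apply: line; [exact: smooth_partial|right].
have [t t0h Ht] := MVT h0 (fun s _ => dH s) (cts _ _ _ _ dH).
exists (s, t) => /=; first by rewrite !in_itv /= in s0h t0h.
have {}Gs : G h - G 0 = (H h - H 0) * h.
  by rewrite Gs subr0 /G' /H scale0r addr0 (addrAC x).
move: Gs; rewrite Ht subr0 /G scale0r !addr0 => ->.
by [].
Qed.

Lemma dist_le_half (a b c e : R) :
  `|a - c| < e / 2 -> `|b - c| < e / 2 -> `|a - b| <= e.
Proof.
move=> ac bc; rewrite -(subrKA c) (le_trans (ler_normD _ _))//.
by rewrite (splitr e) lerD// ltW// distrC.
Qed.

(** The second difference is symmetric in i and j, so after cancelling h^2 the two mixed derivatives
    share a value at points near x; their continuity at x concludes. *)
Lemma smooth_partialC f i j : smooth f ->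
  'D_(delta_mx 0 i) ('D_(delta_mx 0 j) f) = 'D_(delta_mx 0 j) ('D_(delta_mx 0 i) f).
Proof.
move=> sf; apply/funext => x; set ei : E := delta_mx 0 i; set ej : E := delta_mx 0 j.
set F := 'D_ei ('D_ej f); set F' := 'D_ej ('D_ei f).
have cF : continuous F by apply: smooth_continuous; do 2 apply: smooth_partial.
have cF' : continuous F' by apply: smooth_continuous; do 2 apply: smooth_partial.
apply/eqP; rewrite -subr_eq0 -normr_le0; apply/ler_addgt0Pl => e e0; rewrite addr0.
have nF : \forall y \near x, `|F x - F y| < e / 2 /\ `|F' x - F' y| < e / 2.
  apply: filterI; have e20 : 0 < e / 2 by rewrite divr_gt0.
    by have /cvgrPdist_lt := cF x; exact.
  by have /cvgrPdist_lt := cF' x; exact.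
have /nbhs_ballP[d /= d0 dF] := nF.
(* The evaluation points are reached by two shifts of length below h, hence stay within d of x. *)
pose h := d / 2; have h0 : 0 < h by rewrite divr_gt0.
have near_x s t l l' : 0 < s < h /\ 0 < t < h ->
    ball x d (x + s *: delta_mx 0 l + t *: delta_mx 0 l').
  move=> [/andP[s0 sh] /andP[t0 th]]; split => // a b; rewrite (ord1 a) !mxE /=.
  rewrite /ball /= -addrA opprD addNKr normrN (le_lt_trans (ler_normD _ _))//.
  rewrite (splitr d) ltrD// normrM (gtr0_norm s0, gtr0_norm t0).
    by case: (_ == _); rewrite ?normr1 ?normr0 ?mulr1 ?mulr0.
  by case: (_ == _); rewrite ?normr1 ?normr0 ?mulr1 ?mulr0.
have [[s t] /= sth E1] := mixed_difference i j x sf h0.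
have [[s' t'] /= sth' E2] := mixed_difference j i x sf h0.
have FE : F (x + s' *: ej + t' *: ei) = F' (x + s *: ei + t *: ej).
  have hN0 : h != 0 by rewrite gt_eqF.
  have hI (u v : R) : u * h * h = v * h * h -> u = v by move=> /(mulIf hN0)/(mulIf hN0).
  apply: hI; apply: (etrans (esym E2)); apply: (etrans _ E1).
  by rewrite (addrAC x) !opprB !addrA; ring.
have [F1 _] := dF _ (near_x _ _ j i sth'); have [_ F2] := dF _ (near_x _ _ i j sth).
rewrite FE in F1; apply: dist_le_half F1 F2.
Qed.

End smooth_functions.

Section flat_functions.
Variable R : realType.
Implicit Types (k : nat) (t : R).

(** All derivatives of e^(-1/t) are linear combinations of these functions, so treating every k at
    once closes the family under differentiation. *)
Definition flat k t : R := if 0 < t then t^-1 ^+ k * expR (- t^-1) else 0.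

(** At s = 1/t, e^s is at least s^(k+1) / (k+1)!, one power more than needed; this leaves the factor
    t. *)
Lemma flat_bound k t : `|flat k t| <= k.+1`!%:R * `|t|.
Proof.
rewrite /flat; case: ifPn => t0; last by rewrite normr0 mulr_ge0.
have s0 : 0 < t^-1 by rewrite invr_gt0.
rewrite gtr0_norm ?mulr_gt0 ?exprn_gt0 ?expR_gt0// gtr0_norm//.
have C0 : 0 < k.+1`!%:R :> R by rewrite ltr0n fact_gt0.
have : t^-1 ^+ k.+1 / k.+1`!%:R <= expR t^-1.
  by rewrite (le_trans _ (expR_ge1Dxn k (ltW s0)))// lerDr.
rewrite ler_pdivrMr// exprSr ler_pdivrMr// => kt.
by rewrite expRN ler_pdivrMr ?expR_gt0// mulrAC (mulrC _ (expR _)).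
Qed.

Lemma flat_cvg0 k : flat k t @[t --> 0] --> 0.
Proof.
apply/cvgr0Pnorm_lt => e e0; have C0 : 0 < k.+1`!%:R :> R by rewrite ltr0n fact_gt0.
near=> t; rewrite (le_lt_trans (flat_bound k t))// -ltr_pdivlMl//.
near: t.
  apply: (@pseudometric_normed_Zmodule.nbhs0_lt R R^o).
  by rewrite mulr_gt0// invr_gt0.
Unshelve. all: by end_near. Qed.

Lemma is_derive_flat k t :
  is_derive t 1 (flat k) (flat k.+2 t - k%:R * flat k.+1 t).
Proof.
have [t0|t0|->] := ltgtP t 0.
- rewrite /flat lt_gtF // mulr0 subr0.
  apply: near_eq_is_derive (is_derive_cst 0 t 1).
  near=> s; rewrite lt_gtF //; near: s; exact: lt_nbhsl.
- apply: (@near_eq_is_derive R R^o R^o (fun s => s^-1 ^+ k * expR (- s^-1)) _ t 1).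
    near=> s; rewrite /flat ifT //; near: s; exact: lt_nbhsr.
  rewrite /flat t0.
  have dV : is_derive t 1 (fun s : R => s^-1) (- t ^- 2 *: 1).
    by apply: is_deriveV; rewrite gt_eqF.
  have dE : is_derive t 1 (fun s : R => expR (- s^-1)) (expR (- t^-1) * (- (- t ^- 2 *: 1))).
    exact: is_derive1_comp.
  rewrite (_ : (fun s => _) = (fun s => s^-1) ^+ k * (fun s => expR (- s^-1))); last first.
    by apply/funext => s; rewrite !fctE.
  apply: is_derive_eq (is_deriveM (is_deriveX k dV) dE) _.
  rewrite exprfctE /GRing.scale /= !mulr1 opprK -!exprVn.
  by case: k => [|k]; rewrite /= ?expr0 !exprS; ring.
rewrite /flat ltxx mulr0 subr0.
(* At 0 the difference quotient of [flat k] is [flat k.+1], which tends to 0. *)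
have q : h^-1 *: ((flat k \o shift 0) (h *: 1) - flat k 0) @[h --> 0^'] --> (0 : R).
  have : flat k.+1 h @[h --> 0^'] --> (0 : R) by apply: cvg_within_filter; exact: flat_cvg0.
  apply: cvg_trans; apply: near_eq_cvg; near=> h.
  rewrite /= /flat ltxx subr0 addr0 [h *: 1]mulr1; case: ifPn => h0; last by rewrite scaler0.
  by rewrite exprS -mulrA.
by split; [apply/cvg_ex; exists 0|apply/cvg_lim].
Unshelve. all: by end_near. Qed.

Lemma continuous_flat k : continuous (flat k).
Proof.
move=> t; apply/differentiable_continuous/derivable1_diffP.
exact: (@ex_derive _ _ _ _ _ _ _ (is_derive_flat k t)).
Qed.

Lemma flat0_le1 t : 0 <= flat 0 t <= 1.
Proof.
rewrite /flat; case: ifPn => [t0|_]; last by rewrite lexx ler01.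
by rewrite mul1r expR_ge0 expR_le1 oppr_le0 invr_ge0 ltW.
Qed.

Lemma flat0_cvg t : flat 0 (N.+1%:R * t) @[N --> \oo] --> ((0 < t)%R%:R : R).
Proof.
case: (ltP 0 t) => [t0|t0]; last first.
  rewrite (_ : (fun N => _) = cst 0); first exact: cvg_cst.
  apply/funext => N; rewrite /flat ltNge mulr_ge0_le0 //.
rewrite (_ : (fun N => _) = fun N => expR (- (N.+1%:R^-1 * t^-1))); last first.
  by apply/funext => N; rewrite /flat mulr_gt0// mul1r invfM.
have cE : continuous_at (- (0 / t)) (@expR R) by exact: continuous_expR.
rewrite [_%:R](_ : _ = expR (- (0 / t))); last by rewrite mul0r oppr0 expR0.
apply: continuous_cvg; first exact: cE.
by apply: cvgN; apply: cvgMr_tmp; exact: (@cvg_harmonic R).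
Qed.

End flat_functions.

Section elementary_smooth.
Variables (R : realType) (n : nat).
Local Notation E := 'rV[R]_n.

(* An explicit class of functions that is closed under partial derivatives, hence consists
   of smooth functions. *)
Inductive flat_generated : (E -> R) -> Prop :=
| fg_cst c : flat_generated (fun=> c)
| fg_add f g : flat_generated f -> flat_generated g -> flat_generated (f + g)
| fg_mul f g : flat_generated f -> flat_generated g -> flat_generated (f * g)
| fg_flat k i a b : flat_generated (fun x => flat k (a * x 0 i + b)).

Lemma flat_generated_continuous f : flat_generated f -> continuous f.
Proof.
elim=> [c|{}f g _ IHf _ IHg x|{}f g _ IHf _ IHg x|k i a b x].
- exact: cst_continuous.
- by apply: continuousD; [exact: IHf|exact: IHg].
- by apply: continuousM; [exact: IHf|exact: IHg].
- apply: (@continuous_comp _ _ _ (fun x : E => a * x 0 i + b) (flat k)).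
    apply: continuousD; last exact: cst_continuous.
    exact: (cvgMl_tmp (coord_continuous (x := x))).
  exact: continuous_flat.
Qed.

Lemma is_derive_flat_coord k i j a b (x : E) :
  is_derive x (delta_mx 0 j) (fun x => flat k (a * x 0 i + b))
   ((i == j)%:R * a * (flat k.+2 (a * x 0 i + b) - k%:R * flat k.+1 (a * x 0 i + b))).
Proof.
pose F (t : R) : R := flat k (a * t + b).
have dF : is_derive (x 0 i) (1 : R) F
    (a * (flat k.+2 (a * x 0 i + b) - k%:R * flat k.+1 (a * x 0 i + b))).
  have d1 : is_derive (x 0 i) 1 (fun t : R => a * t + b) a.
    have -> : (fun t : R => a * t + b) = (a \*: id) + cst b by [].
    by apply: is_derive_eq; rewrite addr0 [_ *: _]mulr1.
  by rewrite mulrC; apply: is_derive1_comp; exact: is_derive_flat.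
have [<-|ij] := eqVneq i j; last first.
  rewrite !mul0r.
  have [|[_ d1] d2] := @derive_transfer R _ R^o (fun x : E => flat k (a * x 0 i + b))
      (fun t : R => flat k (a * x 0 i + b)) x (delta_mx 0 j) 0 1.
    by move=> h; rewrite !mxE (negbTE ij) andbF mulr0 add0r.
  split; last by rewrite d2 derive_cst.
  by apply: d1; exact: derivable_cst.
rewrite mul1r.
have [|[_ d1] d2] := @derive_transfer R _ R^o (fun x : E => flat k (a * x 0 i + b))
    F x (delta_mx 0 i) (x 0 i) 1.
  by move=> h; rewrite !mxE !eqxx.
move: dF => [dF1 dF2]; split; last exact: (etrans d2 dF2).
exact: d1.
Qed.

Lemma flat_generated_partial f j : flat_generated f ->
  (forall x, derivable f x (delta_mx 0 j)) /\ flat_generated ('D_(delta_mx 0 j) f).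
Proof.
elim=> [c|{}f g ef [df IHf] eg [dg IHg]|{}f g ef [df IHf] eg [dg IHg]|k i a b].
- split=> [x|]; first exact: derivable_cst.
  rewrite (_ : 'D_ _ _ = fun=> 0); first exact: fg_cst.
  by apply/funext => x; rewrite derive_cst.
- split=> [x|]; first exact: derivableD.
  rewrite (_ : 'D_ _ _ = 'D_(delta_mx 0 j) f + 'D_(delta_mx 0 j) g); first exact: fg_add.
  by apply/funext => x; rewrite deriveD.
- split=> [x|]; first exact: derivableM.
  rewrite (_ : 'D_ _ _ = f * 'D_(delta_mx 0 j) g + g * 'D_(delta_mx 0 j) f).
    by apply: fg_add; exact: fg_mul.
  by apply/funext => x; rewrite deriveM.
- have dk x := @is_derive_flat_coord k i j a b x.
  split=> [x|]; first by case: (dk x).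
  rewrite (_ : 'D_ _ _ = (fun=> (i == j)%:R * a) *
    ((fun x : E => flat k.+2 (a * x 0 i + b)) +
     (fun=> - k%:R : R) * (fun x : E => flat k.+1 (a * x 0 i + b)))).
    by apply: fg_mul; [exact: fg_cst|apply: fg_add; [exact: fg_flat|
       apply: fg_mul; [exact: fg_cst|exact: fg_flat]]].
  apply/funext => x; case: (dk x) => _ ->; rewrite !fctE.
  by rewrite mulNr.
Qed.

Lemma flat_generated_smooth f : flat_generated f -> smooth f.
Proof.
apply: smooth_coind => {}f.
  move=> ef; split; first exact: flat_generated_continuous.
  by move=> i x; case: (flat_generated_partial i ef).
by move=> i ef; case: (flat_generated_partial i ef).
Qed.

(** A smooth approximation from inside of the indicator of the open box: the steps at both ends of
    each side steepen as N grows, while the support stays in the box. *)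
Definition bump (a b : E) (N : nat) (x : E) : R :=
  \prod_i (flat 0 (N.+1%:R * (x 0 i - a 0 i)) * flat 0 (N.+1%:R * (b 0 i - x 0 i))).

Lemma bump_smooth a b N : smooth (bump a b N).
Proof.
apply: flat_generated_smooth; rewrite /bump.
elim: (index_enum _) => [|i r IH].
  by rewrite (_ : (fun x => _) = fun=> 1); [exact: fg_cst|apply/funext => x; rewrite big_nil].
rewrite (_ : (fun x => _) = (fun x : E => flat 0 (N.+1%:R * x 0 i + - (N.+1%:R * a 0 i))) *
    (fun x : E => flat 0 (- N.+1%:R * x 0 i + N.+1%:R * b 0 i)) *
    (fun x : E => \prod_(l <- r) (flat 0 (N.+1%:R * (x 0 l - a 0 l)) *
                              flat 0 (N.+1%:R * (b 0 l - x 0 l))))).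
  by apply: fg_mul => //; apply: fg_mul; exact: fg_flat.
apply/funext => x; rewrite big_cons !fctE; congr (flat _ _ * flat _ _ * _); ring.
Qed.

Lemma bump_ge0_le1 a b N x : 0 <= bump a b N x <= 1.
Proof.
rewrite /bump; elim/big_rec : _ => [|i y _ /andP[y0 y1]]; first by rewrite ler01 lexx.
have /andP[u0 u1] := flat0_le1 (N.+1%:R * (x 0 i - a 0 i)).
have /andP[v0 v1] := flat0_le1 (N.+1%:R * (b 0 i - x 0 i)).
by rewrite !mulr_ge0 //= !mulr_ile1 // mulr_ge0.
Qed.

Lemma bump_support a b N x : ~ obox a b x -> bump a b N x = 0.
Proof.
move=> /existsNP[i /negP abi]; rewrite /bump (bigD1 i) //= /flat.
move: abi; rewrite negb_and -!leNgt => /orP[] h.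
  by rewrite [in X in X * _ * _]ltNge mulr_ge0_le0 ?subr_le0 //= !mul0r.
by rewrite [X in _ * X * _]ifF ?mulr0 ?mul0r// ltNge mulr_ge0_le0 ?subr_le0.
Qed.

Lemma bump_cvg a b x : bump a b N x @[N --> \oo] --> (\1_(obox a b) x : R).
Proof.
have -> : (\1_(obox a b) x : R) =
    \prod_i ((0 < x 0 i - a 0 i)%R%:R * (0 < b 0 i - x 0 i)%R%:R).
  rewrite indicE; case: (boolP (x \in obox a b)) => [/set_mem xab|].
    by rewrite big1// => i _; rewrite !subr_gt0; have /andP[-> ->] := xab i; rewrite mulr1.
  rewrite notin_setE => /existsNP[i /negP]; rewrite negb_and => h.
  by rewrite (bigD1 i)//= !subr_gt0; case/orP: h => /negbTE ->; rewrite ?mulr0 !mul0r.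
rewrite /bump; elim: (index_enum _) => [|i r IH].
  rewrite big_nil (_ : (fun N => _) = cst 1); first exact: cvg_cst.
  by apply/funext => N; rewrite big_nil.
rewrite big_cons (_ : (fun N => _) = (fun N =>
    flat 0 (N.+1%:R * (x 0 i - a 0 i)) * flat 0 (N.+1%:R * (b 0 i - x 0 i)) *
    \prod_(l <- r) (flat 0 (N.+1%:R * (x 0 l - a 0 l)) * flat 0 (N.+1%:R * (b 0 l - x 0 l))))).
  by apply: cvgM => //; apply: cvgM; exact: flat0_cvg.
by apply/funext => N; rewrite big_cons.
Qed.

End elementary_smooth.

(** * The fundamental lemma of the calculus of variations *)

Section fundamental_lemma.
Variables (R : realType) (n : nat).
Local Notation E := 'rV[R]_n.
Local Notation mu := (lebesgue_rV R n).

Definition oboxes : set (set E) := [set A | exists a b, A = obox a b].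

Lemma oboxI (a b c d : E) : obox a b `&` obox c d =
  obox (\row_i Num.max (a 0 i) (c 0 i)) (\row_i Num.min (b 0 i) (d 0 i)).
Proof.
apply/seteqP; split => x.
  move=> [/= xab xcd] i; rewrite !mxE gt_max lt_min.
  by have /andP[-> ->] := xab i; have /andP[-> ->] := xcd i.
by move=> h; split => i; have := h i; rewrite !mxE gt_max lt_min => /andP[/andP[? ?] /andP[? ?]];
  apply/andP.
Qed.

(** The coordinate half-spaces are open, hence countable unions of boxes. Boxes are stable under
    intersection, which prepares the Dynkin argument. *)
Lemma measurable_oboxes : @measurable _ E = <<s oboxes >>.
Proof.
apply/seteqP; split; last first.
  apply: smallest_sub; first exact: sigma_algebra_measurable.
  by move=> _ [a [b ->]]; exact: measurable_obox.
move=> A mA; pose T1 : measurableType _ := g_sigma_algebraType oboxes.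
suff : measurable_fun [set: T1] (fun x : T1 => x : E).
  by move=> /(_ measurableT A mA); rewrite setTI.
apply: measurable_fun_rVP => i.
apply: (measurability _ (RGenOInfty.measurableE R)) => _ [_ [c ->] <-].
rewrite setTI.
have : open ((fun x : E => x ord0 i) @^-1` `]c, +oo[%classic).
  have /continuousP := @coord_continuous R 1 n ord0 i; apply.
  exact: interval_open.
move=> /open_bigcup_obox[P [a [b [-> _]]]].
apply: (@bigcup_measurable _ T1) => k _; apply: sub_sigma_algebra.
by exists (a k), (b k).
Qed.

(** The sets over which u has zero integral form a Dynkin class containing all boxes, hence all
    measurable sets. The restriction to one box makes u integrable. *)
Lemma ae_eq0_obox (a b : E) (u : E -> R) :
  mu.-integrable (obox a b) (EFin \o u) ->
  (forall c d, (\int[mu]_(x in obox c d `&` obox a b) (u x)%:E = 0)%E) ->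
  ae_eq mu (obox a b) u (cst 0).
Proof.
move=> iu u0; set B := obox a b.
have mB : measurable B by exact: measurable_obox.
have intS A : measurable A -> mu.-integrable (A `&` B) (EFin \o u).
  by move=> mA; apply: integrableS iu => //; exact: measurableI.
have uA A : measurable A -> (\int[mu]_(x in A `&` B) (u x)%:E = 0)%E.
  pose P : set (set E) := [set A | (\int[mu]_(x in A `&` B) (u x)%:E = 0)%E].
  have uB : (\int[mu]_(x in B) (u x)%:E = 0)%E by have := u0 a b; rewrite setIid.
  suff : forall S, <<s oboxes >> S -> P S.
    by move=> h mA; apply: h; rewrite -measurable_oboxes.
  move=> {A}; apply: (dynkin_induction measurable_oboxes).
  - by move=> _ _ [a1 [b1 ->]] [c1 [d1 ->]]; rewrite oboxI; do 2 eexists.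
  - by rewrite /P /= setTI.
  - by move=> _ [c [d ->]]; exact: u0.
  - move=> S mS PS; rewrite /P /=.
    have := uB; rewrite -{1}(setTI B) -(setUv S) setIUl integral_setU_EFin//.
    + by rewrite PS add0e.
    + exact: measurableI.
    + by apply: measurableI => //; exact: measurableC.
    + rewrite -setIUl setUv setTI; by case/integrableP : iu => /measurable_EFinP.
    + by rewrite /disj_set setIACA setICr set0I.
  - move=> F mF tF PF; rewrite /P /= setI_bigcupl integral_bigcup//.
    + by rewrite eseries0// => i _ _; exact: PF.
    + by apply: trivIset_setIr.
    + by move=> k; exact: measurableI.
    + rewrite -setI_bigcupl; apply: intS; exact: bigcup_measurable.
suff : ae_eq mu B (EFin \o u) (cst 0)%E.
  by apply: filterS => x /= h /h [].
apply: integral_ae_eq => //.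
move=> A AB mA; have := uA A mA; rewrite (setIidl AB) => ->.
by rewrite integral0.
Qed.

(** On a closed box in X the functions [bump] converge to the indicator of the open box, with |u| on
    the closed box as majorant; so u has zero integral over such boxes, countably many of which
    cover X. *)
Lemma ae_eq0_test (X : set E) (u : E -> R) : open X -> measurable_fun X u ->
  (forall K, compact K -> K `<=` X -> mu.-integrable K (EFin \o u)) ->
  (forall phi K, smooth phi -> compact K -> K `<=` X -> (forall x, ~ K x -> phi x = 0) ->
     \int[mu]_(x in X) (u x * phi x) = 0) ->
  ae_eq mu X u (cst 0).
Proof.
move=> oX mu_ iu u0; have mX : measurable X by exact: open_measurable_rV.
have boxes a b : cbox a b `<=` X -> (\int[mu]_(x in obox a b) (u x)%:E = 0)%E.
  move=> abX.
  have oc : obox a b `<=` cbox a b by move=> x xab i; have /andP[/ltW -> /ltW ->] := xab i.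
  have mo := @measurable_obox R n a b; have mc := @measurable_cbox R n a b.
  have ic : mu.-integrable (cbox a b) (EFin \o u) by apply: iu => //; exact: cbox_compact.
  pose f_ N x : \bar R := (u x * bump a b N x)%:E.
  pose f x : \bar R := (u x * \1_(obox a b) x)%:E.
  pose g : E -> \bar R := (abse \o (EFin \o u)) \_ (cbox a b).
  have mf_ N : measurable_fun X (f_ N).
    apply/measurable_EFinP; apply: measurable_funM => //.
    apply: measurable_funTS; apply: continuous_measurable_rV.
    by apply: smooth_continuous; exact: bump_smooth.
  have mf : measurable_fun X f.
    by apply/measurable_EFinP; apply: measurable_funM.
  have f_f : {ae mu, forall x, X x -> f_ ^~ x @ \oo --> f x}.
    apply: aeW => x Xx; apply: cvg_EFin; first exact: nearW.
    by apply: cvgMl_tmp; exact: bump_cvg.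
  have ig : mu.-integrable X g.
    apply/integrable_restrict => //; rewrite setIidr//.
    exact: integrable_abse.
  have f_g : {ae mu, forall x N, X x -> (`|f_ N x| <= g x)%E}.
    apply: aeW => x N Xx; rewrite /f_ /g patchE; case: ifPn => [_|].
      rewrite /= lee_fin normrM ler_piMr//.
      by have /andP[h1 h2] := bump_ge0_le1 a b N x; rewrite ger0_norm.
    rewrite notin_setE => xab; rewrite bump_support; last by move=> /oc.
    by rewrite mulr0 abse0; exact: lexx.
  have [_ _ cvg_f] := dominated_convergence mX mf_ mf f_f ig f_g.
  have f0 N : (\int[mu]_(x in X) f_ N x = 0)%E.
    have intf : mu.-integrable X (f_ N).
      apply: le_integrable ig => // x Xx.
      rewrite /f_ /g patchE; case: ifPn => [_|].
        rewrite /= lee_fin normr_id normrM ler_piMr//.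
        by have /andP[h1 h2] := bump_ge0_le1 a b N x; rewrite ger0_norm.
      rewrite notin_setE => xab; rewrite bump_support; last by move=> /oc.
      by rewrite mulr0 !abse0; exact: lexx.
    rewrite -(fineK (integrable_fin_num _ intf))//; congr EFin.
    apply: (u0 (bump a b N) (cbox a b)) => //.
    - exact: bump_smooth.
    - exact: cbox_compact.
    - by move=> x xab; apply: bump_support => /oc.
  have -> : (\int[mu]_(x in obox a b) (u x)%:E = \int[mu]_(x in X) f x)%E.
    have -> : obox a b = X `&` obox a b by rewrite setIidr// => x /oc /abX.
    rewrite integral_mkcondr; apply: eq_integral => x xX; rewrite patchE /f indicE.
    by case: (x \in _); rewrite ?mulr1 ?mulr0.
  move: cvg_f; rewrite (_ : [sequence _]_N = cst 0%E); last by apply/funext.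
  by move=> /cvg_lim <- //; rewrite lim_cst.
have [P [a [b [XE abX]]]] := open_bigcup_obox oX.
have aek k : {ae mu, forall x, P k -> obox (a k) (b k) x -> u x = 0}.
  have [Pk|nPk] := pselect (P k); last by apply: aeW.
  have oc : obox (a k) (b k) `<=` cbox (a k) (b k).
    by move=> x xab i; have /andP[/ltW -> /ltW ->] := xab i.
  have : ae_eq mu (obox (a k) (b k)) u (cst 0).
    apply: ae_eq0_obox => [|c d].
      apply: (@integrableS _ _ _ _ (cbox (a k) (b k))) => //.
      - exact: measurable_cbox.
      - exact: measurable_obox.
      - by apply: iu; [exact: cbox_compact|exact: abX].
    rewrite oboxI; apply: boxes => x h; apply: (abX k Pk) => i; have := h i.
    by rewrite !mxE ge_max le_min => /andP[/andP[_ ->] /andP[_ ->]].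
  by apply: filterS => x h _ /h.
have := ae_foralln aek; apply: filterS => x h; rewrite XE => -[k Pk xk].
exact: h xk.
Qed.

End fundamental_lemma.

(** * Square integrable forms *)

Section square_integrable.
Context d (T : measurableType d) (R : realType) (mu : {measure set T -> \bar R}).
Variables (X : set T) (mX : measurable X).
Implicit Types f g : T -> R.

Definition sqint f := measurable_fun X f /\ mu.-integrable X (fun x => (f x ^+ 2)%:E).

Lemma Lfun2P f : (f \_ X \in Lfun mu 2%:E) <-> sqint f.
Proof.
have sqE : (EFin \o (fun x => (f \_ X) x ^+ 2)) = (fun x => (f x ^+ 2)%:E) \_ X.
  apply/funext => x /=; rewrite !patchE; case: ifP => // _.
  by rewrite -[RHS]/(0%:E) -[point]/(0 : R) expr0n.
split=> [fL|[mf fi]].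
  split.
    apply/measurable_restrictT => //.
    by move: fL; rewrite inE => /andP[]; rewrite inE.
  rewrite -[X in integrable _ X](setTI X); apply/(integrable_restrict _ mX measurableT).
  by rewrite -sqE; exact: Lfun2_integrable_sqr.
have mfX : measurable_fun setT (f \_ X) by apply/(measurable_restrictT _ mX).
rewrite inE; apply/andP; split; first by rewrite inE.
rewrite inE /= /finite_norm; apply: (@lty_poweRy _ _ 2) => //.
rewrite powR_Lnorm//.
have /integrableP[_] : mu.-integrable setT (EFin \o (fun x => (f \_ X) x ^+ 2)).
  by rewrite sqE; apply/integrable_restrict => //; rewrite setTI.
apply: le_lt_trans; rewrite le_eqVlt; apply/orP; left; apply/eqP.
apply: eq_integral => x _ /=.
by rewrite powR_mulrn// real_normK ?num_real// ger0_norm// sqr_ge0.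
Qed.

(** The product is dominated by f^2 + g^2. *)
Lemma sqint_mul_integrable f g : sqint f -> sqint g ->
  mu.-integrable X (EFin \o (fun x => f x * g x)).
Proof.
move=> [mf fi] [mg gi].
apply: (le_integrable mX _ _ (integrableD mX fi gi)).
  by apply/measurable_EFinP; exact: measurable_funM.
move=> x _ /=; rewrite lee_fin normrM.
rewrite [leRHS]ger0_norm ?addr_ge0 ?sqr_ge0//.
have := sqr_ge0 (`|f x| - `|g x|); rewrite sqrrB !real_normK ?num_real//.
have := mulr_ge0 (normr_ge0 (f x)) (normr_ge0 (g x)); nra.
Qed.

Lemma sqintD f g : sqint f -> sqint g -> sqint (fun x => f x + g x).
Proof.
move=> sf sg; have fg := sqint_mul_integrable sf sg.
move: sf sg => [mf fi] [mg gi]; split; first exact: measurable_funD.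
have := integrableD mX (integrableD mX fi gi) (integrableZl mX 2 fg).
by apply: eq_integrable => // x _; rewrite /= -EFinM -!EFinD; congr EFin; ring.
Qed.

Lemma sqintZ a f : sqint f -> sqint (fun x => a * f x).
Proof.
move=> [mf fi]; split; first exact: measurable_funM.
have := integrableZl mX (a ^+ 2) fi.
by apply: eq_integrable => // x _; rewrite /= -EFinM; congr EFin; ring.
Qed.

Lemma sqint0 : sqint (fun=> 0).
Proof.
split; first exact: measurable_cst.
by rewrite expr0n; exact: integrable0.
Qed.

Lemma sqint_sum (I : Type) (r : seq I) (P : pred I) (F : I -> T -> R) :
  (forall i, sqint (F i)) -> sqint (fun x => \sum_(i <- r | P i) F i x).
Proof.
move=> sF; elim: r => [|i r IH].
  rewrite (_ : (fun x => _) = fun=> 0); first exact: sqint0.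
  by apply/funext => x; rewrite big_nil.
rewrite (_ : (fun x => _) = fun x => (P i)%:R * F i x + \sum_(j <- r | P j) F j x).
  by apply: sqintD => //; exact: sqintZ.
by apply/funext => x; rewrite big_cons; case: (P i); rewrite ?mul1r// mul0r add0r.
Qed.

Lemma sqint_bounded f (M : R) : (mu X < +oo)%E -> measurable_fun X f ->
  (forall x, X x -> `|f x| <= M) -> sqint f.
Proof.
move=> Xoo mf fM; split => //.
apply: measurable_bounded_integrable => //; first exact: measurable_funX.
exists (M ^+ 2); split; first exact: num_real.
move=> y My x Xx /=; apply: le_trans (ltW My); rewrite normrX lerXn2r ?nnegrE//; last exact: fM.
by rewrite (le_trans _ (fM x Xx)).
Qed.

Lemma Rintegral_sum (I : Type) (r : seq I) (P : pred I) (F : I -> T -> R) :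
  (forall i, mu.-integrable X (EFin \o F i)) ->
  \int[mu]_(x in X) (\sum_(i <- r | P i) F i x) =
  \sum_(i <- r | P i) \int[mu]_(x in X) F i x.
Proof.
move=> iF; rewrite /Rintegral.
under eq_integral do rewrite -sumEFin.
rewrite integral_sum// sum_fine//.
by move=> i _; exact: (integrable_fin_num mX (iF i)).
Qed.

Lemma integrable_Rsum (I : Type) (r : seq I) (P : pred I) (F : I -> T -> R) :
  (forall i, mu.-integrable X (EFin \o F i)) ->
  mu.-integrable X (EFin \o (fun x => \sum_(i <- r | P i) F i x)).
Proof.
move=> iF; have := integrable_sum mX r (P := P) (fun i (_ : P i) => iF i).
by apply: eq_integrable => // x _; rewrite /= -sumEFin.
Qed.

Lemma sqintS (Y : set T) f : measurable Y -> Y `<=` X -> sqint f ->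
  measurable_fun Y f /\ mu.-integrable Y (fun x => (f x ^+ 2)%:E).
Proof.
move=> mY YX [mf fi]; split; first exact: measurable_funS mf.
exact: integrableS fi.
Qed.

Lemma eq_sqint f g : (forall x, X x -> f x = g x) -> sqint f -> sqint g.
Proof.
move=> fg [mf fi]; split.
  by apply: eq_measurable_fun mf => x /set_mem; exact: fg.
by apply: eq_integrable fi => // x /set_mem /fg ->.
Qed.

Lemma ae_eq_Rintegral f g : measurable_fun X f -> measurable_fun X g ->
  ae_eq mu X f g -> \int[mu]_(x in X) f x = \int[mu]_(x in X) g x.
Proof.
move=> mf mg fg; congr fine; apply: ae_eq_integral => //; try exact/measurable_EFinP.
by apply: filterS fg => x /[apply] ->.
Qed.

End square_integrable.

Section L2_forms.
Variables (R : realType) (n : nat) (X : set 'rV[R]_n).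
Hypothesis mX : measurable X.
Local Notation mu := (lebesgue_rV R n).
Implicit Types (w u v : dform R n) (k : nat) (I : {set 'I_n}).

Definition sqform w := forall I, sqint mu X (fun x => w x I).

Lemma L2formP k w : L2form X k w <-> (forall x, X x -> homog k (w x)) /\ sqform w.
Proof.
by split=> -[hw sw]; split => // I; apply/Lfun2P => //; exact: sw.
Qed.

Lemma L2form_sqform k w : L2form X k w -> sqform w.
Proof. by move=> /L2formP[]. Qed.

Lemma sqformD w u : sqform w -> sqform u -> sqform (w + u).
Proof.
move=> sw su I; rewrite (_ : (fun x => _) = fun x => w x I + u x I).
  exact: sqintD.
by apply/funext => x; rewrite ffunE.
Qed.

Lemma sqformZ (a : R) w : sqform w -> sqform (fun x => a *: w x).
Proof.
move=> sw I; rewrite (_ : (fun x => _) = fun x => a * w x I); first exact: sqintZ.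
by apply/funext => x; rewrite ffunE.
Qed.

Lemma sqformN w : sqform w -> sqform (- w).
Proof.
move=> sw I; rewrite (_ : (fun x => _) = fun x => -1 * w x I); first exact: sqintZ.
by apply/funext => x; rewrite !fctE ffunE mulN1r.
Qed.

Lemma sqformB w u : sqform w -> sqform u -> sqform (w - u).
Proof. by move=> sw su; apply: sqformD => //; exact: sqformN. Qed.

Lemma sqform0 : sqform 0.
Proof.
move=> I; rewrite (_ : (fun x => _) = fun=> 0); first exact: sqint0.
by apply/funext => x; rewrite ffunE.
Qed.

Lemma L2formB k w u : L2form X k w -> L2form X k u -> L2form X k (w - u).
Proof.
move=> /L2formP[hw sw] /L2formP[hu su]; apply/L2formP; split; last exact: sqformB.
by move=> x Xx; apply: homogD; [exact: hw|apply: homogN; exact: hu].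
Qed.

Lemma L2form0 k : L2form X k 0.
Proof. by apply/L2formP; split=> [x _|]; [exact: homog0|exact: sqform0]. Qed.

Lemma ip_integrable w u : sqform w -> sqform u ->
  mu.-integrable X (EFin \o (fun x => extdot (w x) (u x))).
Proof.
move=> sw su; apply: integrable_Rsum => // I.
exact: sqint_mul_integrable.
Qed.

Lemma ip_measurable w u : sqform w -> sqform u ->
  measurable_fun X (fun x => extdot (w x) (u x)).
Proof.
by move=> sw su; apply/measurable_EFinP; have /integrableP[] := ip_integrable sw su.
Qed.

Lemma ipL2C w u : ipL2 X w u = ipL2 X u w.
Proof. by apply: eq_Rintegral => x _; rewrite extdotC. Qed.

Lemma ipL2Dl w u v : sqform w -> sqform u -> sqform v ->
  ipL2 X (w + u) v = ipL2 X w v + ipL2 X u v.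
Proof.
move=> sw su sv; rewrite /ipL2 -RintegralD//; try exact: ip_integrable.
by apply: eq_Rintegral => x _; rewrite -extdotDl.
Qed.

Lemma ipL2Zl a w u : sqform w -> sqform u ->
  ipL2 X (fun x => a *: w x) u = a * ipL2 X w u.
Proof.
move=> sw su; rewrite /ipL2 -RintegralZl//; last exact: ip_integrable.
by apply: eq_Rintegral => x _; rewrite -extdotZl.
Qed.

Lemma ipL2Nl w u : sqform w -> sqform u -> ipL2 X (- w) u = - ipL2 X w u.
Proof.
move=> sw su; rewrite -[RHS]mulN1r -ipL2Zl//.
by apply: eq_Rintegral => x _; rewrite scaleN1r.
Qed.

Lemma ipL2Bl w u v : sqform w -> sqform u -> sqform v ->
  ipL2 X (w - u) v = ipL2 X w v - ipL2 X u v.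
Proof. by move=> sw su sv; rewrite ipL2Dl// ?ipL2Nl//; exact: sqformN. Qed.

Lemma ipL2Br w u v : sqform w -> sqform u -> sqform v ->
  ipL2 X v (w - u) = ipL2 X v w - ipL2 X v u.
Proof. by move=> sw su sv; rewrite !(ipL2C v) ipL2Bl. Qed.

Lemma ipL20l w : ipL2 X 0 w = 0.
Proof.
rewrite /ipL2 /Rintegral; under eq_integral do rewrite extdot0l.
by rewrite integral0.
Qed.

Lemma ipL20r w : ipL2 X w 0 = 0.
Proof. by rewrite ipL2C ipL20l. Qed.

Lemma ipL2_ge0 w : 0 <= ipL2 X w w.
Proof. by apply: Rintegral_ge0 => x _; apply: sumr_ge0 => I _; rewrite -expr2 sqr_ge0. Qed.

Lemma ipL2_cauchy_schwarz w u : sqform w -> sqform u ->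
  `|ipL2 X w u| <= Num.sqrt (ipL2 X w w) * Num.sqrt (ipL2 X u u).
Proof.
move=> sw su; set a := ipL2 X w w; set b := ipL2 X w u; set c := ipL2 X u u.
have a0 : 0 <= a by exact: ipL2_ge0.
have c0 : 0 <= c by exact: ipL2_ge0.
have q t : 0 <= a + 2 * t * b + t ^+ 2 * c.
  have stu : sqform (fun x => t *: u x) by exact: sqformZ.
  have := ipL2_ge0 (w + (fun x => t *: u x)).
  rewrite ipL2Dl//; last exact: sqformD.
  rewrite !(ipL2C _ (w + _)) !ipL2Dl// !ipL2Zl// (ipL2C w) ipL2Zl//.
  rewrite (ipL2C u (fun x => t *: u x)) ipL2Zl// (ipL2C u w) -/a -/b -/c.
  by congr (_ <= _); ring.
have bac : b ^+ 2 <= a * c.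
  (* If c > 0 the quadratic is evaluated at its minimum -b/c. If c = 0 it is affine in t, and when b
     is nonzero the chosen t would give it the value -1. *)
  have [c0'|] := eqVneq c 0; last first.
    move=> cn0; have cgt0 : 0 < c by rewrite lt_def cn0.
    have := q (- b / c); rewrite -(pmulr_rge0 _ cgt0).
    rewrite (_ : c * _ = a * c - b ^+ 2) ?subr_ge0//.
    by field; exact: cn0.
  rewrite c0' mulr0; have [->|bn0] := eqVneq b 0; first by rewrite expr0n.
  have := q (- (a + 1) / (2 * b)); rewrite c0' mulr0 addr0.
  rewrite (_ : a + _ = -1); first by rewrite ler0N1.
  by field.
by rewrite -sqrtrM// -sqrtr_sqr ler_wsqrtr.
Qed.

Lemma ipL2_bound w u (e M : R) : sqform w -> sqform u ->
  Num.sqrt (ipL2 X w w) <= e -> Num.sqrt (ipL2 X u u) <= M -> `|ipL2 X w u| <= e * M.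
Proof.
move=> sw su we uM; rewrite (le_trans (ipL2_cauchy_schwarz sw su))//.
by apply: ler_pM => //; exact: sqrtr_ge0.
Qed.

Lemma eqL2_ipl w w' u : sqform w -> sqform w' -> sqform u ->
  eqL2 X w w' -> ipL2 X w u = ipL2 X w' u.
Proof.
move=> sw sw' su ww'; apply: ae_eq_Rintegral => //; try exact: ip_measurable.
by apply: filterS ww' => x /[apply] ->.
Qed.

Lemma eqL2_ipr w u u' : sqform w -> sqform u -> sqform u' ->
  eqL2 X u u' -> ipL2 X w u = ipL2 X w u'.
Proof. by move=> sw su su' uu'; rewrite !(ipL2C w); exact: eqL2_ipl. Qed.

End L2_forms.

(** * Weak derivatives *)

Section smooth_forms.
Variables (R : realType) (n : nat).
Local Notation E := 'rV[R]_n.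
Local Notation mu := (lebesgue_rV R n).
Implicit Types (w u eta : dform R n) (X K : set E) (k : nat) (f g : E -> R).

(** The regularity needed for one integration by parts; it covers both test forms and polynomial
    forms. *)
Definition C1 f := continuous f /\ forall i : 'I_n,
  (forall x, derivable f x (delta_mx 0 i)) /\ continuous ('D_(delta_mx 0 i) f).

Definition C1form w := forall I, C1 (fun x => w x I).
Definition smooth_form w := forall I, smooth (fun x => w x I).

Lemma smooth_C1 f : smooth f -> C1 f.
Proof.
move=> sf; split; first exact: smooth_continuous.
move=> i; split=> [x|]; first exact: smooth_derivable.
by apply: smooth_continuous; exact: smooth_partial.
Qed.

Lemma smooth_form_C1 w : smooth_form w -> C1form w.
Proof. by move=> sw I; exact: smooth_C1. Qed.

Lemma derive_scale (a : R) f v x : derivable f x v ->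
  'D_v (fun y => a * f y) x = a * 'D_v f x.
Proof. by move=> df; rewrite -[RHS]/(a *: 'D_v f x) -deriveZ. Qed.

Lemma C1_scale (a : R) f : C1 f -> C1 (fun x => a * f x).
Proof.
move=> [cf df]; split=> [x|i]; first exact: (cvgMl_tmp (cf x)).
have [di cdi] := df i; split=> [x|]; first exact: (derivableZ (di x)).
rewrite (_ : 'D_ _ _ = fun x => a * 'D_(delta_mx 0 i) f x) => [x|].
  exact: (cvgMl_tmp (cdi x)).
by apply/funext => x; rewrite derive_scale.
Qed.

(** Each coefficient of a product or contraction is a scalar times one coefficient of the form; with
    the case distinction hidden in the scalar, derivatives pass through by linearity. *)
Definition wedge_coef (i : 'I_n) (I : {set 'I_n}) : R :=
  if i \in I then ext_sign R i I else 0.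
Definition contr_coef (i : 'I_n) (I : {set 'I_n}) : R :=
  if i \in I then 0 else ext_sign R i I.

Lemma ext_wedge_coef i (c : extalg R n) I :
  ext_wedge i c I = wedge_coef i I * c (I :\ i)%SET.
Proof. by rewrite ffunE /wedge_coef; case: ifP; rewrite ?mul0r. Qed.

Lemma ext_contr_coef i (c : extalg R n) I :
  ext_contr i c I = contr_coef i I * c (i |: I)%SET.
Proof. by rewrite ffunE /contr_coef; case: ifP; rewrite ?mul0r. Qed.

Lemma C1_contr i eta I : C1form eta -> C1 (fun x => ext_contr i (eta x) I).
Proof.
move=> C; rewrite (_ : (fun x => _) = fun x => contr_coef i I * eta x (i |: I)%SET).
  exact: C1_scale.
by apply/funext => x; rewrite ext_contr_coef.
Qed.

Lemma derive_contr i eta I x : C1form eta ->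
  'D_(delta_mx 0 i) (fun x => ext_contr i (eta x) I) x = ext_contr i (partial i eta x) I.
Proof.
move=> C; rewrite ext_contr_coef ffunE.
rewrite (_ : (fun x => _) = fun x => contr_coef i I * eta x (i |: I)%SET); last first.
  by apply/funext => y; rewrite ext_contr_coef.
by rewrite derive_scale//; have [_ /(_ i)[+ _]] := C (i |: I)%SET; apply.
Qed.

Lemma extdot_extd w eta x : extdot (extd w x) (eta x) =
  \sum_i \sum_I 'D_(delta_mx 0 i) (fun y => w y I) x * ext_contr i (eta x) I.
Proof.
rewrite extdot_suml; apply: eq_bigr => i _.
by rewrite ext_wedge_contr; apply: eq_bigr => I _; rewrite ffunE.
Qed.

Lemma extdot_coextd w eta x : C1form eta -> extdot (w x) (coextd eta x) =
  \sum_i \sum_I - (w x I * 'D_(delta_mx 0 i) (fun y => ext_contr i (eta y) I) x).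
Proof.
move=> C; rewrite extdotNr extdot_sumr -sumrN; apply: eq_bigr => i _.
by rewrite -sumrN; apply: eq_bigr => I _; rewrite derive_contr.
Qed.

Lemma Rintegral_support X K f : K `<=` X -> (forall x, ~ K x -> f x = 0) ->
  \int[mu]_(x in X) f x = \int[mu]_x f x.
Proof.
move=> KX f0; rewrite Rintegral_mkcond; apply: eq_Rintegral => x _.
by rewrite patchE; case: ifPn => //; rewrite notin_setE => Xx; rewrite f0// => /KX.
Qed.

Lemma extd_support K w x : closed K -> (forall y, ~ K y -> w y = 0) -> ~ K x ->
  extd w x = 0.
Proof.
move=> cK w0 Kx; rewrite /extd big1// => i _.
rewrite (_ : partial i w x = 0) ?linear0//; apply/ffunP => I; rewrite !ffunE.
by apply: derive_out_closed Kx => // y /w0 ->; rewrite ffunE.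
Qed.

Lemma coextd_support K w x : closed K -> (forall y, ~ K y -> w y = 0) -> ~ K x ->
  coextd w x = 0.
Proof.
move=> cK w0 Kx; rewrite /coextd big1 ?oppr0// => i _.
rewrite (_ : partial i w x = 0) ?linear0//; apply/ffunP => I; rewrite !ffunE.
by apply: derive_out_closed Kx => // y /w0 ->; rewrite ffunE.
Qed.

(** Expanded over directions and basis forms, this is a sum of scalar integrations by parts. Either
    factor may carry the compact support, since weak derivatives test against eta and weak
    codifferentials against w. *)
Lemma ipL2_extd X K w eta : compact K -> K `<=` X -> C1form w -> C1form eta ->
  (forall x, ~ K x -> w x = 0) \/ (forall x, ~ K x -> eta x = 0) ->
  ipL2 X (extd w) eta = ipL2 X w (coextd eta).
Proof.
move=> cK KX Cw Ceta supp; have clK := compact_closed_rV cK.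
rewrite /ipL2 (Rintegral_support KX) => [|x Kx]; last first.
  case: supp => [w0|->//]; last by rewrite extdot0r.
  by rewrite (extd_support clK w0)// extdot0l.
rewrite (Rintegral_support KX) => [|x Kx]; last first.
  case: supp => [->//|eta0]; first by rewrite extdot0l.
  by rewrite (coextd_support clK eta0)// extdot0r.
have suppI : (forall I x, ~ K x -> w x I = 0) \/
    (forall i I x, ~ K x -> ext_contr i (eta x) I = 0).
  case: supp => [w0|eta0]; [left=> I x /w0 ->|right=> i I x /eta0 ->].
    by rewrite ffunE.
  by rewrite linear0 ffunE.
have cM (a b : E -> R) : continuous a -> continuous b -> continuous (a \* b).
  by move=> ca cb x; apply: continuousM; [exact: ca|exact: cb].
have int1 i I : mu.-integrable setT (EFin \o (fun x =>
    'D_(delta_mx 0 i) (fun y => w y I) x * ext_contr i (eta x) I)).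
  apply: (integrable_compact_support cK).
    apply: cM; first by have [_ /(_ i)[_ +]] := Cw I.
    by have [+ _] := C1_contr i I Ceta.
  move=> x Kx; case: suppI => [w0|eta0]; last by rewrite eta0// mulr0.
  by rewrite (derive_out_closed _ clK (w0 I) Kx) mul0r.
have int2 i I : mu.-integrable setT (EFin \o (fun x =>
    - (w x I * 'D_(delta_mx 0 i) (fun y => ext_contr i (eta y) I) x))).
  apply: (integrable_compact_support cK).
    have c1 : continuous (fun x => w x I) by have [+ _] := Cw I.
    have [_ /(_ i)[_ c2]] := C1_contr i I Ceta.
    by move=> x; exact: (cvgN (cM _ _ c1 c2 x)).
  move=> x Kx; case: suppI => [w0|eta0]; first by rewrite w0// mul0r oppr0.
  by rewrite (derive_out_closed _ clK (eta0 i I) Kx) mulr0 oppr0.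
under eq_Rintegral do rewrite extdot_extd.
under [RHS]eq_Rintegral do rewrite (extdot_coextd _ _ Ceta).
rewrite !Rintegral_sum//; try by move=> i; apply: integrable_Rsum.
apply: eq_bigr => i _; rewrite !Rintegral_sum//; apply: eq_bigr => I _.
have [cw /(_ i)[dw cdw]] := Cw I; have [ce /(_ i)[de cde]] := C1_contr i I Ceta.
have -> : \int[mu]_x - (w x I * 'D_(delta_mx 0 i) (fun y => ext_contr i (eta y) I) x) =
   - \int[mu]_x (w x I * 'D_(delta_mx 0 i) (fun y => ext_contr i (eta y) I) x).
  rewrite -[RHS]mulN1r -RintegralZl//; last first.
    have := integrableN (int2 i I); apply: eq_integrable => // x _ /=.
    by rewrite opprK.
  by apply: eq_Rintegral => x _; rewrite mulN1r.
case: suppI => [w0|eta0]; first exact: (integral_partialM cK (w0 I)).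
(* The support now sits in the second factor, so the formula is used with the factors exchanged. *)
have := integral_partialM cK (eta0 i I) ce cw de dw cde cdw.
under [X in X = _ -> _]eq_Rintegral do rewrite mulrC.
under [X in _ = - X -> _]eq_Rintegral do rewrite mulrC.
by move=> ->; rewrite opprK.
Qed.

Lemma partial_sum (i : 'I_n) (c : 'I_n -> R) (f : 'I_n -> E -> R) x :
  (forall j, smooth (f j)) ->
  'D_(delta_mx 0 i) (fun y => \sum_j c j * f j y) x = \sum_j c j * 'D_(delta_mx 0 i) (f j) x.
Proof.
move=> sf; rewrite (_ : (fun y => _) = \sum_j (c j \*: f j)); last first.
  by apply/funext => y; rewrite fct_sumE.
have -> : 'D_(delta_mx 0 i) (\sum_j c j \*: f j) x =
    \sum_j 'D_(delta_mx 0 i) (c j \*: f j) x.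
  apply: derive_val; apply: is_derive_sum => j; apply/derivableP.
  by apply: derivableZ; exact: smooth_derivable.
by apply: eq_bigr => j _; rewrite deriveZ//; exact: smooth_derivable.
Qed.

Lemma smooth_form_partial i w : smooth_form w -> smooth_form (partial i w).
Proof.
move=> sw I; rewrite (_ : (fun x => _) = 'D_(delta_mx 0 i) (fun y => w y I)).
  exact: smooth_partial.
by apply/funext => x; rewrite ffunE.
Qed.

Lemma extdE w x I : extd w x I = \sum_i wedge_coef i I * partial i w x (I :\ i)%SET.
Proof. by rewrite sum_ffunE; apply: eq_bigr => i _; rewrite ext_wedge_coef. Qed.

Lemma coextdE w x I : coextd w x I = \sum_i - contr_coef i I * partial i w x (i |: I)%SET.
Proof.
rewrite ffunE sum_ffunE -sumrN; apply: eq_bigr => i _.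
by rewrite ext_contr_coef mulNr.
Qed.

Lemma smooth_form_extd w : smooth_form w -> smooth_form (extd w).
Proof.
move=> sw I; rewrite (_ : (fun x => _) =
    fun x => \sum_i (wedge_coef i I \*: (fun y => partial i w y (I :\ i)%SET)) x).
  by apply: smooth_sum => i; apply: smoothZ; exact: smooth_form_partial.
by apply/funext => x; rewrite extdE.
Qed.

Lemma smooth_form_coextd w : smooth_form w -> smooth_form (coextd w).
Proof.
move=> sw I; rewrite (_ : (fun x => _) =
    fun x => \sum_i ((- contr_coef i I) \*: (fun y => partial i w y (i |: I)%SET)) x).
  by apply: smooth_sum => i; apply: smoothZ; exact: smooth_form_partial.
by apply/funext => x; rewrite coextdE.
Qed.

Lemma partial_extd i w x : smooth_form w ->
  partial i (extd w) x = \sum_j ext_wedge j (partial i (partial j w) x).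
Proof.
move=> sw; apply/ffunP => I; rewrite ffunE sum_ffunE.
under eq_fun do rewrite extdE.
rewrite partial_sum => [|j]; last exact: smooth_form_partial.
by apply: eq_bigr => j _; rewrite ext_wedge_coef [in RHS]ffunE.
Qed.

Lemma partial_coextd i w x : smooth_form w ->
  partial i (coextd w) x = - \sum_j ext_contr j (partial i (partial j w) x).
Proof.
move=> sw; apply/ffunP => I; rewrite !ffunE sum_ffunE.
under eq_fun do rewrite coextdE.
rewrite partial_sum => [|j]; last exact: smooth_form_partial.
rewrite -sumrN.
by apply: eq_bigr => j _; rewrite ext_contr_coef [in RHS]ffunE mulNr.
Qed.

Lemma partialE i w x I : partial i w x I = 'D_(delta_mx 0 i) (fun y => w y I) x.
Proof. by rewrite ffunE. Qed.

Lemma partial2E i j w x I : partial i (partial j w) x I =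
  'D_(delta_mx 0 i) ('D_(delta_mx 0 j) (fun y => w y I)) x.
Proof.
rewrite partialE; congr ('D_(_) _ x).
by apply/funext => y; rewrite partialE.
Qed.

Lemma partialC i j w x : smooth_form w ->
  partial i (partial j w) x = partial j (partial i w) x.
Proof.
move=> sw; apply/ffunP => I.
have := congr1 (@^~ x) (smooth_partialC i j (sw I)) => dC.
exact: (etrans (partial2E i j w x I) (etrans dC (esym (partial2E j i w x I)))).
Qed.

(* The antisymmetric composition of the L_i kills the symmetric second
   derivatives. *)
Lemma antisym_sum0 (L : 'I_n -> {linear extalg R n -> extalg R n})
    (P : 'I_n -> 'I_n -> extalg R n) :
  (forall i j c, L i (L j c) = - L j (L i c)) -> (forall i j, P i j = P j i) ->
  \sum_i \sum_j L i (L j (P i j)) = 0.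
Proof.
move=> LC PC; set S := \sum_i _.
have SN : S = - S.
  rewrite {1}/S exchange_big /= -sumrN; apply: eq_bigr => i _.
  by rewrite -sumrN; apply: eq_bigr => j _; rewrite LC PC.
clearbody S; apply/ffunP => I; have := congr1 (fun c : extalg R n => c I) SN.
move=> /eqP; rewrite [X in _ == X]ffunE -addr_eq0 -mulr2n mulrn_eq0 => /eqP ->.
by rewrite ffunE.
Qed.

Lemma extd_extd w : smooth_form w -> extd (extd w) = 0.
Proof.
move=> sw; apply/funext => x; rewrite /extd.
under eq_bigr => i _ do rewrite (partial_extd i x sw) linear_sum.
apply: (antisym_sum0 (L := fun i => @ext_wedge R n i)) => *; first exact: ext_wedgeC.
exact: partialC.
Qed.

Lemma coextd_coextd w : smooth_form w -> coextd (coextd w) = 0.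
Proof.
move=> sw; apply/funext => x; rewrite /coextd.
under eq_bigr => i _ do rewrite (partial_coextd i x sw) linearN linear_sum.
rewrite sumrN opprK.
apply: (antisym_sum0 (L := fun i => @ext_contr R n i)) => *; first exact: ext_contrC.
exact: partialC.
Qed.

End smooth_forms.

Section weak_derivatives.
Variables (R : realType) (n : nat) (X : set 'rV[R]_n).
Hypothesis oX : open X.
Local Notation E := 'rV[R]_n.
Local Notation mu := (lebesgue_rV R n).
Implicit Types (w u eta phi : dform R n) (K : set E) (k : nat).

Let mX : measurable X := open_measurable_rV oX.

Lemma test_form_smooth k phi : test_form X k phi -> smooth_form phi.
Proof. by case. Qed.

Lemma test_form_extd k phi : test_form X k phi -> test_form X k.+1 (extd phi).
Proof.
move=> [hphi sphi [K [cK KX phi0]]]; split.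
- move=> x; apply: homog_sum => i; apply: homog_wedge => I Ik.
  rewrite partialE (_ : (fun y => _) = cst 0); first by rewrite derive_cst.
  by apply/funext => y; rewrite hphi.
- exact: smooth_form_extd.
- exists K; split => // x Kx; apply: extd_support Kx => //.
  exact: compact_closed_rV.
Qed.

Lemma test_form_coextd k phi : test_form X k.+1 phi -> test_form X k (coextd phi).
Proof.
move=> [hphi sphi [K [cK KX phi0]]]; split.
- move=> x; apply: homogN; apply: homog_sum => i; apply: homog_contr => I Ik.
  rewrite partialE (_ : (fun y => _) = cst 0); first by rewrite derive_cst.
  by apply/funext => y; rewrite hphi.
- exact: smooth_form_coextd.
- exists K; split => // x Kx; apply: coextd_support Kx => //.
  exact: compact_closed_rV.
Qed.

Lemma test_form_L2 k phi : test_form X k phi -> L2form X k phi.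
Proof.
move=> [hphi sphi [K [cK KX phi0]]]; apply/(L2formP mX); split=> [x _|I]; first exact: hphi.
have cphi : continuous (fun x => phi x I) by apply: smooth_continuous; exact: sphi.
split; first by apply: measurable_funTS; exact: continuous_measurable_rV.
apply: (@integrableS _ _ _ _ setT) => //.
apply: (@integrable_compact_support R n K (fun x => phi x I ^+ 2)) => //.
  by move=> x; apply: continuousM; exact: cphi.
by move=> x /phi0 ->; rewrite ffunE expr0n.
Qed.

Lemma test_form0 k : test_form X k 0.
Proof.
split; [by move=> x; exact: homog0| |].
  move=> I; rewrite (_ : (fun x => _) = fun=> 0); first exact: smooth0.
  by apply/funext => x; rewrite ffunE.
by exists set0; split => //; exact: compact0.
Qed.

Lemma sqint_locally_integrable K (f : E -> R) : compact K -> K `<=` X ->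
  sqint mu X f -> mu.-integrable K (EFin \o f).
Proof.
move=> cK KX sf; have mK : measurable K.
  by apply: closed_measurable_rV; exact: compact_closed_rV.
have sfK : sqint mu K f by exact: sqintS KX sf.
have s1 : sqint mu K (fun=> 1).
  apply: (@sqint_bounded _ _ _ _ _ mK _ 1) => //; first exact: lebesgue_compact_lty.
  by move=> x _; rewrite normr1.
have := sqint_mul_integrable mK sfK s1.
by apply: eq_integrable => // x _; rewrite /= mulr1.
Qed.

(** The forms phi dx^I with #|I| = k isolate the coefficients of u, to which the fundamental lemma
    applies; the coefficients of other degrees vanish by homogeneity. *)
Lemma weak_unique k u : L2form X k u ->
  (forall eta, test_form X k eta -> ipL2 X u eta = 0) -> eqL2 X u 0.
Proof.
move=> /(L2formP mX)[hu su] u0.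
have uI (I : {set 'I_n}) : {ae mu, forall x, X x -> u x I = 0}.
  have [Ik|Ik] := eqVneq #|I| k; last by apply: aeW => x /hu; exact.
  apply: (@ae_eq0_test R n X (fun x => u x I)) => //; first by case: (su I).
    by move=> K cK KX; exact: sqint_locally_integrable.
  move=> phi K sphi cK KX phi0.
  rewrite -(u0 (fun x => phi x *: ext_basis R I)).
    by apply: eq_Rintegral => x _; rewrite extdotZr extdot_basisr mulrC.
  split.
  - by move=> x; apply: homogZ; rewrite -Ik; exact: homog_basis.
  - move=> J; rewrite (_ : (fun x => _) = (J == I)%:R \*: phi); first exact: smoothZ.
    by apply/funext => x; rewrite !ffunE [LHS]mulrC.
  - by exists K; split => // x /phi0 ->; rewrite scale0r.
have uall : {ae mu, forall x, forall I, X x -> u x I = 0} by exact: filter_forall.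
by apply: filterS uall => x h Xx; apply/ffunP => I; rewrite h// ffunE.
Qed.

Lemma is_wextd_test k phi : test_form X k phi -> is_wextd X k phi (extd phi).
Proof.
move=> [_ sphi [K [cK KX phi0]]] eta [_ seta _]; apply/esym/(ipL2_extd cK KX).
- exact: smooth_form_C1.
- exact: smooth_form_C1.
- by left.
Qed.

Lemma is_wcoextd_test k phi : test_form X k.+1 phi -> is_wcoextd X k.+1 phi (coextd phi).
Proof.
move=> [_ sphi [K [cK KX phi0]]] w [_ sw _]; apply: (ipL2_extd cK KX).
- exact: smooth_form_C1.
- exact: smooth_form_C1.
- by right.
Qed.

(** The test form supplies the compact support, so this applies to polynomial forms on a cell and to
    constant forms on the whole domain. *)
Lemma is_wcoextd_C1 k eta : C1form eta -> is_wcoextd X k eta (coextd eta).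
Proof.
move=> C w [_ sw [K [cK KX w0]]]; apply: (ipL2_extd cK KX) => //.
- exact: smooth_form_C1.
- by left.
Qed.

Lemma is_wextd_C1 k w : C1form w -> is_wextd X k w (extd w).
Proof.
move=> C eta [_ seta [K [cK KX eta0]]]; apply/esym/(ipL2_extd cK KX) => //.
- exact: smooth_form_C1.
- by right.
Qed.

Lemma is_wextd_unique k w u u' : L2form X k.+1 u -> L2form X k.+1 u' ->
  is_wextd X k w u -> is_wextd X k w u' -> eqL2 X u u'.
Proof.
move=> L L' wu wu'; have sq := L2form_sqform mX.
have : eqL2 X (u - u') 0.
  apply: (weak_unique (L2formB mX L L')) => eta Teta.
  have Leta := test_form_L2 Teta.
  rewrite ipL2Bl //; try exact: sq L; try exact: sq L'; try exact: sq Leta.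
  by rewrite -wu// -wu'// subrr.
by apply: filterS => x /[apply] /eqP; rewrite subr_eq0 => /eqP.
Qed.

Lemma is_wcoextd_unique k eta u u' : L2form X k.-1 u -> L2form X k.-1 u' ->
  is_wcoextd X k eta u -> is_wcoextd X k eta u' -> eqL2 X u u'.
Proof.
move=> L L' wu wu'; have sq := L2form_sqform mX.
have : eqL2 X (u - u') 0.
  apply: (weak_unique (L2formB mX L L')) => w Tw.
  have Lw := test_form_L2 Tw.
  rewrite ipL2C ipL2Br //; try exact: sq L; try exact: sq L'; try exact: sq Lw.
  by rewrite -wu// -wu'// subrr.
by apply: filterS => x /[apply] /eqP; rewrite subr_eq0 => /eqP.
Qed.

(** Any explicit weak derivative u guarantees that the choice in [wextd] succeeds, and uniqueness
    identifies the chosen form with u almost everywhere. *)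
Lemma wextdP k w u : L2form X k.+1 u -> is_wextd X k w u ->
  [/\ L2form X k.+1 (wextd X k w), is_wextd X k w (wextd X k w) & eqL2 X (wextd X k w) u].
Proof.
move=> Lu wu; have [|L' wu'] := @xgetPex _ 0 [set u | L2form X k.+1 u /\ is_wextd X k w u].
  by exists u.
by split => //; exact: is_wextd_unique wu.
Qed.

Lemma wcoextdP k eta u : L2form X k.-1 u -> is_wcoextd X k eta u ->
  [/\ L2form X k.-1 (wcoextd X k eta), is_wcoextd X k eta (wcoextd X k eta) &
      eqL2 X (wcoextd X k eta) u].
Proof.
move=> Lu wu; have [|L' wu'] := @xgetPex _ 0 [set u | L2form X k.-1 u /\ is_wcoextd X k eta u].
  by exists u.
by split => //; exact: is_wcoextd_unique wu.
Qed.

Lemma is_wextdB k w w' u u' : sqform X w -> sqform X w' -> sqform X u -> sqform X u' ->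
  is_wextd X k w u -> is_wextd X k w' u' -> is_wextd X k (w - w') (u - u').
Proof.
move=> sw sw' su su' wu wu' eta Teta; have seta := L2form_sqform mX (test_form_L2 Teta).
by rewrite !ipL2Bl// ?wu ?wu' //; apply: (L2form_sqform mX (k := k));
   exact: test_form_L2 (test_form_coextd Teta).
Qed.

Lemma is_wcoextdB k eta eta' u u' : (0 < k)%N ->
  sqform X eta -> sqform X eta' -> sqform X u -> sqform X u' ->
  is_wcoextd X k eta u -> is_wcoextd X k eta' u' -> is_wcoextd X k (eta - eta') (u - u').
Proof.
move=> k0 se se' su su' wu wu' w Tw; have sw := L2form_sqform mX (test_form_L2 Tw).
by rewrite !ipL2Br// ?wu ?wu' //; apply: (L2form_sqform mX (k := k)); apply: test_form_L2;
   rewrite -(prednK k0); exact: test_form_extd.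
Qed.

(** The codifferential of a test form is again a test form, and its own codifferential vanishes. *)
Lemma is_wextd_wextd k w u : L2form X k.+1 u -> is_wextd X k w u -> is_wextd X k.+1 u 0.
Proof.
move=> Lu wu eta Teta; rewrite ipL20l -(wu _ (test_form_coextd Teta)).
by rewrite (coextd_coextd (test_form_smooth Teta)) ipL20r.
Qed.

Lemma is_wcoextd_wcoextd k eta u : L2form X k.+1 u -> is_wcoextd X k.+2 eta u ->
  is_wcoextd X k.+1 u 0.
Proof.
move=> Lu wu w Tw; rewrite ipL20r /= -(wu _ (test_form_extd Tw)).
by rewrite (extd_extd (test_form_smooth Tw)) ipL20l.
Qed.

End weak_derivatives.

(** * Approximation by test forms in the graph norms *)

Section closures.
Variables (R : realType) (n : nat) (X : set 'rV[R]_n).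
Hypothesis oX : open X.
Local Notation mu := (lebesgue_rV R n).
Implicit Types (w u eta zeta phi : dform R n) (k : nat).

Let mX : measurable X := open_measurable_rV oX.
Let sq k w : L2form X k w -> sqform X w := @L2form_sqform R n X mX k w.
Let tsq k phi : test_form X k phi -> sqform X phi := fun T => sq (test_form_L2 oX T).

Lemma eq0_small (c M : R) : (forall e, 0 < e -> `|c| <= e * M) -> c = 0.
Proof.
move=> cM; apply/eqP; rewrite -normr_le0 leNgt; apply/negP => c0.
have M0 : 0 < M by have := lt_le_trans c0 (cM 1 ltr01); rewrite mul1r.
have := cM (`|c| / (2 * M)); rewrite divr_gt0 ?mulr_gt0// => /(_ isT).
rewrite (_ : `|c| / (2 * M) * M = `|c| / 2); last by field; rewrite gt_eqF.
by apply/negP; rewrite -ltNge; lra.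
Qed.

Lemma HLP k w : (k < n)%N -> HL X k w ->
  [/\ L2form X k w, L2form X k.+1 (wextd X k w) & is_wextd X k w (wextd X k w)].
Proof. by move=> kn [Lw /(_ kn)[u Lu wu]]; have [] := wextdP oX Lu wu. Qed.

Lemma HstarP k eta : Hstar X k eta ->
  [/\ L2form X k eta, L2form X k.-1 (wcoextd X k eta) & is_wcoextd X k eta (wcoextd X k eta)].
Proof. by move=> [Lw [u Lu wu]]; have [] := wcoextdP oX Lu wu. Qed.

Lemma eqL2_is_wcoextd k eta eta' u : sqform X eta -> sqform X eta' ->
  eqL2 X eta eta' -> is_wcoextd X k.+1 eta u -> is_wcoextd X k.+1 eta' u.
Proof.
move=> se se' ee' wu w Tw; rewrite -(wu w Tw).
have sw := tsq (test_form_extd Tw).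
by symmetry; apply: eqL2_ipr.
Qed.

(** Separates the graph norm into its two parts, and replaces the representative chosen for the weak
    derivative of w - phi by the explicit difference. *)
Lemma HL0_approx k w (e : R) : (k < n)%N -> HL0 X k w -> 0 < e ->
  exists phi, [/\ test_form X k phi,
    Num.sqrt (ipL2 X (w - phi) (w - phi)) <= e &
    Num.sqrt (ipL2 X (wextd X k w - extd phi) (wextd X k w - extd phi)) <= e].
Proof.
move=> kn [Hw]; rewrite kn => app e0; have [phi T we] := app e e0.
exists phi; have [Lw Ldw wd] := HLP kn Hw.
have Lphi := test_form_L2 oX T; have Ldphi := test_form_L2 oX (test_form_extd T).
have wB : is_wextd X k (w - phi) (wextd X k w - extd phi).
  apply: is_wextdB => //; try exact: sq Lw; try exact: sq Ldw; try exact: sq Lphi;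
    try exact: sq Ldphi.
  exact: is_wextd_test.
have [LB _ BE] := wextdP oX (L2formB mX Ldw Ldphi) wB.
have sB := sq (L2formB mX Ldw Ldphi); have sB' := sq LB.
move: we; rewrite /HL_norm.
rewrite (eqL2_ipl mX sB' sB sB' BE) (eqL2_ipr mX sB sB' sB BE) => we.
split=> //; apply: le_trans (ltW we); apply: ler_wsqrtr.
  by rewrite lerDl; exact: ipL2_ge0.
by rewrite lerDr; exact: ipL2_ge0.
Qed.

Lemma Hstar0_approx k eta (e : R) : Hstar0 X k.+1 eta -> 0 < e ->
  exists phi, [/\ test_form X k.+1 phi,
    Num.sqrt (ipL2 X (eta - phi) (eta - phi)) <= e &
    Num.sqrt (ipL2 X (wcoextd X k.+1 eta - coextd phi) (wcoextd X k.+1 eta - coextd phi)) <= e].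
Proof.
move=> [Hw app e0]; have [phi T we] := app e e0.
exists phi; have [Lw Ldw wd] := HstarP Hw.
have Lphi := test_form_L2 oX T; have Ldphi := test_form_L2 oX (test_form_coextd T).
have wB : is_wcoextd X k.+1 (eta - phi) (wcoextd X k.+1 eta - coextd phi).
  apply: is_wcoextdB => //; try exact: sq Lw; try exact: sq Ldw; try exact: sq Lphi;
    try exact: sq Ldphi.
  exact: is_wcoextd_test.
have [LB _ BE] := wcoextdP oX (L2formB mX Ldw Ldphi : L2form X k.+1.-1 _) wB.
have sB := sq (L2formB mX Ldw Ldphi); have sB' := sq LB.
move: we; rewrite /Hstar_norm.
rewrite (eqL2_ipl mX sB' sB sB' BE) (eqL2_ipr mX sB sB' sB BE) => we.
split=> //; apply: le_trans (ltW we); apply: ler_wsqrtr.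
  by rewrite lerDl; exact: ipL2_ge0.
by rewrite lerDr; exact: ipL2_ge0.
Qed.

(** Both sides are continuous in the graph norm of w, so the identity passes from test forms to
    their closure. It serves for eta in W^*_h with its codifferential zeta, and for the volume form
    with zeta = 0. *)
Lemma HL0_pair k w eta zeta : (k < n)%N -> HL0 X k w -> sqform X eta -> sqform X zeta ->
  (forall phi, test_form X k phi -> ipL2 X phi zeta = ipL2 X (extd phi) eta) ->
  ipL2 X w zeta = ipL2 X (wextd X k w) eta.
Proof.
move=> kn H se sz tz; apply/eqP; rewrite -subr_eq0; apply/eqP.
apply: (@eq0_small _ (Num.sqrt (ipL2 X zeta zeta) + Num.sqrt (ipL2 X eta eta))) => e e0.
have [phi [T we dwe]] := HL0_approx kn H e0.
have [Lw Ldw _] := HLP kn (proj1 H).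
have sp := tsq T; have sdp := tsq (test_form_extd T).
have sw := sq Lw; have sdw := sq Ldw.
rewrite (_ : _ - _ = ipL2 X (w - phi) zeta - ipL2 X (wextd X k w - extd phi) eta); last first.
  rewrite (ipL2Bl mX sw sp sz) (ipL2Bl mX sdw sdp se) (tz _ T).
  by rewrite opprB addrA subrK.
rewrite mulrDr (le_trans (ler_normB _ _))//; apply: lerD.
  exact: (ipL2_bound mX (sqformB mX sw sp) sz we (lexx _)).
exact: (ipL2_bound mX (sqformB mX sdw sdp) se dwe (lexx _)).
Qed.

Lemma Hstar0_pair k eta w u : Hstar0 X k.+1 eta -> sqform X w -> sqform X u ->
  (forall phi, test_form X k.+1 phi -> ipL2 X w (coextd phi) = ipL2 X u phi) ->
  ipL2 X w (wcoextd X k.+1 eta) = ipL2 X u eta.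
Proof.
move=> H sw su tz; apply/eqP; rewrite -subr_eq0; apply/eqP.
apply: (@eq0_small _ (Num.sqrt (ipL2 X w w) + Num.sqrt (ipL2 X u u))) => e e0.
have [phi [T we dwe]] := Hstar0_approx H e0.
have [Le Lde _] := HstarP (proj1 H).
have sp := tsq T; have sdp := tsq (test_form_coextd T).
have se := sq Le; have sde := sq Lde.
rewrite (_ : _ - _ = ipL2 X (wcoextd X k.+1 eta - coextd phi) w - ipL2 X (eta - phi) u); last first.
  rewrite (ipL2Bl mX sde sdp sw) (ipL2Bl mX se sp su).
  rewrite (ipL2C X (coextd phi)) (tz _ T) (ipL2C X phi) (ipL2C X eta) (ipL2C X (wcoextd _ _ _)).
  by rewrite opprB addrA subrK.
rewrite mulrDr (le_trans (ler_normB _ _))//; apply: lerD.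
  exact: (ipL2_bound mX (sqformB mX sde sdp) sw dwe (lexx _)).
exact: (ipL2_bound mX (sqformB mX se sp) su we (lexx _)).
Qed.

Lemma HL_wextd k w : (k < n)%N -> HL X k w -> HL X k.+1 (wextd X k w).
Proof.
move=> kn Hw; have [Lw Ldw wd] := HLP kn Hw; split => // _.
by exists 0; [exact: L2form0|exact: is_wextd_wextd wd].
Qed.

Lemma wextd_wextd k w : (k.+1 < n)%N -> HL X k w ->
  eqL2 X (wextd X k.+1 (wextd X k w)) 0.
Proof.
move=> kn Hw; have [Lw Ldw wd] := HLP (ltnW kn) Hw.
have w0 : is_wextd X k.+1 (wextd X k w) 0 by exact: is_wextd_wextd wd.
by have [] := wextdP oX (L2form0 mX k.+2) w0.
Qed.

(** If phi approximates w, then d phi approximates d w: both are closed, so the derivative part of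
    the graph norm of their difference vanishes. *)
Lemma HL0_wextd k w : (k.+1 < n)%N -> HL0 X k w -> HL0 X k.+1 (wextd X k w).
Proof.
move=> kn H; have kn' := ltnW kn; have Hw := proj1 H.
split; first exact: HL_wextd.
(* [HL0_approx] yields a weak inequality and the closure asks for a strict one, hence the half. *)
rewrite kn => e e0; have e20 : 0 < e / 2 by rewrite divr_gt0.
have [phi [T _ dwe]] := HL0_approx kn' H e20.
exists (extd phi); first exact: test_form_extd.
have [Lw Ldw wd] := HLP kn' Hw; have Ldp := test_form_L2 oX (test_form_extd T).
have w0 : is_wextd X k.+1 (wextd X k w - extd phi) 0.
  rewrite -[X in is_wextd _ _ _ X](subr0 0); apply: is_wextdB => //; try exact: sqform0.
  - exact: sq Ldw.
  - exact: sq Ldp.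
  - exact: is_wextd_wextd wd.
  - by have := is_wextd_test (test_form_extd T); rewrite (extd_extd (test_form_smooth T)).
have [LB _ BE] := wextdP oX (L2form0 mX k.+2) w0.
rewrite /HL_norm (eqL2_ipl mX (sq LB) (sqform0 _) (sq LB) BE) ipL20l addr0.
by rewrite (le_lt_trans dwe)// ltr_pdivrMr// ltr_pMr// ltr1n.
Qed.

(** Stated for an arbitrary representative eta' of the codifferential, since membership in a
    piecewise polynomial space is a pointwise condition that the chosen representative may
    violate. *)
Lemma Hstar_wcoextd k eta eta' : Hstar X k.+2 eta -> L2form X k.+1 eta' ->
  eqL2 X (wcoextd X k.+2 eta) eta' ->
  Hstar X k.+1 eta' /\ eqL2 X (wcoextd X k.+1 eta') 0.
Proof.
move=> H L' ee'; have [Le Lde wd] := HstarP H.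
have w0 : is_wcoextd X k.+1 eta' 0.
  apply: (@eqL2_is_wcoextd k (wcoextd X k.+2 eta)) => //.
  - exact: sq Lde.
  - exact: sq L'.
  - exact: is_wcoextd_wcoextd wd.
have [_ _ E0] := wcoextdP oX (L2form0 mX k.+1.-1) w0.
by split => //; split => //; exists 0 => //; exact: L2form0.
Qed.

Lemma Hstar0_wcoextd k eta eta' : Hstar0 X k.+2 eta -> L2form X k.+1 eta' ->
  eqL2 X (wcoextd X k.+2 eta) eta' -> Hstar0 X k.+1 eta'.
Proof.
move=> H L' ee'; have [Le Lde wd] := HstarP (proj1 H).
have [H' wc'] := Hstar_wcoextd (proj1 H) L' ee'.
split => // e e0; have e20 : 0 < e / 2 by rewrite divr_gt0.
have [phi [T _ dwe]] := Hstar0_approx H e20.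
exists (coextd phi); first exact: test_form_coextd.
have Ldp := test_form_L2 oX (test_form_coextd T).
have [_ [u Lu wu]] := H'.
have w0 : is_wcoextd X k.+1 (eta' - coextd phi) 0.
  rewrite -[X in is_wcoextd _ _ _ X](subr0 0); apply: is_wcoextdB => //; try exact: sqform0.
  - exact: sq L'.
  - exact: sq Ldp.
  - apply: (@eqL2_is_wcoextd k (wcoextd X k.+2 eta)) => //.
    + exact: sq Lde.
    + exact: sq L'.
    + exact: is_wcoextd_wcoextd wd.
  - by have := is_wcoextd_test (test_form_coextd T); rewrite (coextd_coextd (test_form_smooth T)).
have [LB _ BE] := wcoextdP oX (L2form0 mX k.+1.-1) w0.
rewrite /Hstar_norm (eqL2_ipl mX (sq LB) (sqform0 _) (sq LB) BE) ipL20l addr0.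
have dB : eqL2 X (wcoextd X k.+2 eta - coextd phi) (eta' - coextd phi).
  by apply: filterS ee' => x /[apply] h; rewrite !fctE h.
have sB := sq (L2formB mX Lde Ldp); have sB' := sq (L2formB mX L' Ldp).
rewrite -(eqL2_ipl mX sB sB' sB' dB) -(eqL2_ipr mX sB sB sB' dB).
by rewrite (le_lt_trans dwe)// ltr_pdivrMr// ltr_pMr// ltr1n.
Qed.

End closures.

(** * Affine forms and simplices *)

Section affine_forms.
Variables (R : realType) (n : nat).
Local Notation E := 'rV[R]_n.
Implicit Types (c : extalg R n) (A : 'I_n -> extalg R n) (k : nat) (w : dform R n).

Lemma is_derive_affine A c (i : 'I_n) (x : E) I :
  is_derive x (delta_mx 0 i) (fun y : E => (c + \sum_j y 0 j *: A j) I) (A i I).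
Proof.
set F := fun y : E => _.
have dG : is_derive (0 : R) 1 (fun t : R => F x + t * A i I) (A i I).
  have -> : (fun t : R => F x + t * A i I) = cst (F x) + (A i I \*: id).
    by apply/funext => t; rewrite !fctE [RHS]/= /GRing.scale /= mulrC.
  by apply: is_derive_eq; rewrite add0r [_ *: _]mulr1.
have FG (h : R) : F (h *: delta_mx 0 i + x) = F x + (h *: 1 + 0) * A i I.
  have FE y : F y = c I + \sum_j y 0 j * A j I.
    by rewrite /F ffunE sum_ffunE; congr (_ + _); apply: eq_bigr => j _; rewrite ffunE.
  rewrite !FE addr0 [h *: 1]mulr1 -addrA; congr (_ + _).
  under eq_bigr do rewrite !mxE eqxx /= mulrDl.
  rewrite big_split /= addrC; congr (_ + _).
  rewrite (bigD1 i)//= eqxx mulr1 big1 ?addr0// => j /negbTE ->.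
  by rewrite mulr0 mul0r.
have [[_ d1] d2] := @derive_transfer R _ R^o F (fun t : R => F x + t * A i I) x _ 0 1 FG.
case: dG => [dG1 dG2]; split; [exact: d1|exact: (etrans d2 dG2)].
Qed.

Lemma partial_affine A c i x : partial i (fun y : E => c + \sum_j y 0 j *: A j) x = A i.
Proof.
apply/ffunP => I; rewrite partialE.
by case: (is_derive_affine A c i x I).
Qed.

Lemma C1form_affine A c : C1form (fun y : E => c + \sum_j y 0 j *: A j).
Proof.
move=> I; split=> [|i].
  rewrite (_ : (fun x => _) = fun x : E => c I + \sum_j x 0 j * A j I); last first.
    apply/funext => x; rewrite ffunE sum_ffunE; congr (_ + _).
    by apply: eq_bigr => j _; rewrite ffunE.
  move=> x; apply: continuousD; first exact: cst_continuous.
  apply: continuous_sumr => j y.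
  exact: (cvgMr_tmp (coord_continuous (x := y))).
split=> [x|]; first by case: (is_derive_affine A c i x I).
rewrite (_ : 'D_ _ _ = cst (A i I)); first exact: cst_continuous.
by apply/funext => x; case: (is_derive_affine A c i x I).
Qed.

Lemma C1form_cst c : C1form (cst c : dform R n).
Proof.
rewrite (_ : cst c = fun y : E => c + \sum_j y 0 j *: (fun=> 0 : extalg R n) j).
  exact: C1form_affine.
by apply/funext => x /=; rewrite big1 ?addr0// => j _; rewrite scaler0.
Qed.

Lemma partial_cst c i x : partial i (cst c : dform R n) x = 0.
Proof. by apply/ffunP => I; rewrite partialE derive_cst ffunE. Qed.

Lemma extd_cst c : extd (cst c) = 0 :> dform R n.
Proof. by apply/funext => x; rewrite /extd big1// => i _; rewrite partial_cst linear0. Qed.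

Lemma coextd_cst c : coextd (cst c) = 0 :> dform R n.
Proof.
by apply/funext => x; rewrite /coextd big1 ?oppr0// => i _; rewrite partial_cst linear0.
Qed.

Lemma C1form_koszul c c' : C1form (fun x : E => c + koszul c' x).
Proof. exact: (C1form_affine (fun i => ext_contr i c')). Qed.

Lemma C1form_dual_koszul c c' : C1form (fun x : E => c + dual_koszul c' x).
Proof. exact: (C1form_affine (fun i => ext_wedge i c')). Qed.

Lemma extd_koszul k c c' : homog k.+1 c' ->
  extd (fun x : E => c + koszul c' x) = cst (k.+1%:R *: c').
Proof.
move=> hc'; apply/funext => x; rewrite /extd -(sum_wedge_contr hc').
by apply: eq_bigr => i _; rewrite (partial_affine (fun i => ext_contr i c')).
Qed.

Lemma coextd_dual_koszul k c c' : homog k c' ->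
  coextd (fun x : E => c + dual_koszul c' x) = cst (- ((n - k)%:R *: c')).
Proof.
move=> hc'; apply/funext => x; rewrite /coextd -(sum_contr_wedge hc').
congr (- _).
by apply: eq_bigr => i _; rewrite (partial_affine (fun i => ext_wedge i c')).
Qed.

Lemma extd_near w u (x : E) : (\near x, w x = u x) -> extd w x = extd u x.
Proof.
move=> wu; apply: eq_bigr => i _; congr ext_wedge; apply/ffunP => I.
rewrite !partialE; apply: near_eq_derive.
by apply: filterS wu => y ->.
Qed.

End affine_forms.

(** * Barycentric coordinates and the null boundary of a simplex *)

Section simplices.
Variables (R : realType) (n : nat) (v : 'M[R]_(n.+1, n)).
Hypotheses (n_gt0 : (0 < n)%N) (v_indep : affine_independent v).
Local Notation E := 'rV[R]_n.

Let D : 'M[R]_n := \matrix_(a < n) (row (lift ord0 a) v - row ord0 v).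
Let M := invmx D.
Let v0 : E := row ord0 v.

(* The barycentric coordinate of index a is x |-> bary_cst a + <bary_vec a, x>. *)
Let bary_vec (a : 'I_n.+1) (j : 'I_n) : R :=
  if unlift ord0 a is Some b then M j b else - \sum_b M j b.
Let bary_cst (a : 'I_n.+1) : R :=
  if unlift ord0 a is Some b then - (v0 *m M) 0 b else 1 + \sum_b (v0 *m M) 0 b.
Let bary (a : 'I_n.+1) (x : E) : R := bary_cst a + \sum_j bary_vec a j * x 0 j.

Let bary_lift b x : bary (lift ord0 b) x = ((x - v0) *m M) 0 b.
Proof.
rewrite /bary /bary_cst /bary_vec liftK mulmxBl [in RHS]mxE [X in _ = _ + X]mxE addrC.
by congr (_ + _); rewrite mxE; apply: eq_bigr => j _; rewrite mulrC.
Qed.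

Let bary0 x : bary ord0 x = 1 - \sum_b ((x - v0) *m M) 0 b.
Proof.
rewrite /bary /bary_cst /bary_vec unlift_none -addrA; congr (_ + _).
have -> : \sum_b ((x - v0) *m M) 0 b = \sum_b (x *m M) 0 b - \sum_b (v0 *m M) 0 b.
  by rewrite -sumrB; apply: eq_bigr => b _; rewrite mulmxBl !mxE.
rewrite opprB; congr (_ + _).
have -> : \sum_b (x *m M) 0 b = \sum_j x 0 j * \sum_b M j b.
  under eq_bigr do rewrite mxE.
  by rewrite exchange_big; apply: eq_bigr => j _; rewrite mulr_sumr.
by rewrite -sumrN; apply: eq_bigr => j _; rewrite mulNr mulrC.
Qed.

Let Mu : M \in unitmx. Proof. by rewrite unitmx_inv. Qed.

Let bary_vec_neq0 a : exists j, bary_vec a j != 0.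
Proof.
apply: contrapT => h0.
have h j : bary_vec a j = 0 by apply/eqP/negPn/negP => hj; apply: h0; exists j.
(* A vanishing gradient would put a nonzero vector in the kernel of the invertible M: a unit vector,
   or for the vertex 0 the all-ones vector, which is nonzero because n > 0. *)
pose z : 'cV[R]_n := if unlift ord0 a is Some b then delta_mx b 0 else const_mx 1.
have z0 : M *m z = 0.
  apply/colP => j; rewrite !mxE; have := h j; rewrite /bary_vec /z.
  case: (unlift ord0 a) => [b|] /=.
    move=> Mb; rewrite (bigD1 b)//= Mb mul0r add0r big1// => l /negbTE lb.
    by rewrite mxE lb mulr0.
  move/eqP; rewrite oppr_eq0 => /eqP s0; rewrite -[RHS]s0.
  by apply: eq_bigr => l _; rewrite mxE mulr1.
have : z = 0 by rewrite -[z]mul1mx -(mulVmx Mu) -mulmxA z0 mulmx0.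
rewrite /z; case: (unlift ord0 a) => [b|] /matrixP.
  by move=> /(_ b 0); rewrite !mxE !eqxx => /eqP; rewrite oner_eq0.
by move=> /(_ (Ordinal n_gt0) 0); rewrite !mxE => /eqP; rewrite oner_eq0.
Qed.

Let bary_simplex x : (forall a, 0 <= bary a x) -> simplex v x.
Proof.
move=> x0; exists (\row_a bary a x).
have sumE : \sum_b bary (lift ord0 b) x = 1 - bary ord0 x.
  by rewrite bary0 opprB addrC subrK; apply: eq_bigr => b _; rewrite bary_lift.
split=> [a|a|| ]; rewrite ?inE// ?mxE//.
  under eq_bigr do rewrite mxE.
  by rewrite big_ord_recl sumE addrC subrK.
have xE : x - v0 = ((x - v0) *m M) *m D by rewrite -mulmxA mulVmx// mulmx1.
rewrite mulmx_sum_row big_ord_recl !mxE -[LHS](subrK v0) xE.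
have -> : ((x - v0) *m M) *m D = \sum_b bary (lift ord0 b) x *: (row (lift ord0 b) v - v0).
  rewrite mulmx_sum_row; apply: eq_bigr => b _; rewrite bary_lift; congr (_ *: _).
  by apply/rowP => j; rewrite !mxE.
under eq_bigr do rewrite scalerBr.
rewrite sumrB -scaler_suml sumE scalerBl scale1r opprB.
rewrite addrA subrK addrC; congr (_ + _).
by apply: eq_bigr => b _; rewrite mxE.
Qed.

Let simplex_bary x : simplex v x -> forall a, 0 <= bary a x.
Proof.
move=> [l [l0 _ l1 xE]].
have lE b : ((x - v0) *m M) 0 b = l 0 (lift ord0 b).
  have -> : x - v0 = (\row_a l 0 (lift ord0 a)) *m D.
    rewrite xE !mulmx_sum_row big_ord_recl.
    rewrite (_ : l 0 ord0 = 1 - \sum_a l 0 (lift ord0 a)); last first.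
      by rewrite -l1 big_ord_recl addrK.
    rewrite scalerBl scale1r -/v0 addrAC [_ - v0]addrAC subrr add0r addrC scaler_suml.
    rewrite -sumrB; apply: eq_bigr => a _; rewrite mxE -scalerBr; congr (_ *: _).
    by apply/rowP => j; rewrite !mxE.
  by rewrite -mulmxA mulmxV// mulmx1 mxE.
move=> a; case: (unliftP ord0 a) => [b|] ->; first by rewrite bary_lift lE.
rewrite bary0; under eq_bigr do rewrite lE.
by rewrite -l1 big_ord_recl addrK.
Qed.

Let continuous_bary a : continuous (bary a).
Proof.
move=> x; apply: continuousD; first exact: cst_continuous.
apply: continuous_sumr => j y.
exact: (cvgMl_tmp (coord_continuous (x := y))).
Qed.

Let bary_cell x : (forall a, 0 < bary a x) -> cell v x.
Proof.
move=> x0; rewrite /cell /interior /=.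
have : \forall y \near x, forall a, 0 < bary a y.
  have FF : Filter (nbhs x) by exact: nbhs_filter.
  apply: (@filter_forall _ _ (fun a y => is_true (0 < bary a y)) (nbhs x) FF) => a.
  have /cvgrPdist_lt/(_ _ (x0 a)) := continuous_bary (a := a) (x := x).
  by apply: filterS => y; rewrite ltr_norml => /andP[_]; rewrite ltrBlDr ltrDl.
by apply: filterS => y h; apply: bary_simplex => a; exact: ltW.
Qed.

Lemma ae_simplex_cell :
  {ae lebesgue_rV R n, forall x, simplex v x -> cell v x}.
Proof.
have aeh a : {ae lebesgue_rV R n, forall x, bary a x != 0}.
  exists [set x : E | \sum_j bary_vec a j * x 0 j = - bary_cst a]; split.
  - by apply: closed_measurable_rV; exact: hyperplane_closed.
  - exact: lebesgue_hyperplane.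
  - move=> x /= /negP; rewrite negbK /bary addrC addr_eq0 => /eqP.
    exact.
have all_h : {ae lebesgue_rV R n, forall x, forall a, bary a x != 0}.
  exact: filter_forall.
apply: filterS all_h => x h /simplex_bary x0; apply: bary_cell => a.
by rewrite lt_def h x0.
Qed.

End simplices.

(** * Restriction of weak derivatives to an open subset *)

Section restriction.
Variables (R : realType) (n : nat) (X T : set 'rV[R]_n).
Hypotheses (oX : open X) (oT : open T) (TX : T `<=` X).
Local Notation mu := (lebesgue_rV R n).
Implicit Types (w u eta phi : dform R n) (k : nat).

Let mX : measurable X := open_measurable_rV oX.
Let mT : measurable T := open_measurable_rV oT.

Lemma sqform_sub w : sqform X w -> sqform T w.
Proof. by move=> sw I; exact: (sqintS mX mT TX (sw I)). Qed.

Lemma L2form_sub k w : L2form X k w -> L2form T k w.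
Proof.
move=> /(L2formP mX)[hw sw]; apply/(L2formP mT); split; last exact: sqform_sub.
by move=> x /TX; exact: hw.
Qed.

Lemma test_form_sub k phi : test_form T k phi -> test_form X k phi.
Proof.
move=> [hphi sphi [K [cK KT phi0]]]; split => //; exists K; split => //.
exact: subset_trans KT TX.
Qed.

Lemma ipL2_test_sub k w phi : test_form T k phi -> ipL2 T w phi = ipL2 X w phi.
Proof.
move=> [_ _ [K [cK KT phi0]]]; rewrite /ipL2.
have f0 x : ~ K x -> extdot (w x) (phi x) = 0 by move=> /phi0 ->; rewrite extdot0r.
by rewrite (Rintegral_support KT f0) (Rintegral_support (subset_trans KT TX) f0).
Qed.

(** A test form on T is one on X, and since it and its codifferential vanish off T the integrals
    over T and X agree. *)
Lemma is_wextd_sub k w u : is_wextd X k w u -> is_wextd T k w u.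
Proof.
move=> wu eta Teta; rewrite (ipL2_test_sub u Teta) (ipL2_test_sub w (test_form_coextd Teta)).
by apply: wu; exact: test_form_sub.
Qed.

Lemma is_wcoextd_sub k eta u : is_wcoextd X k eta u -> is_wcoextd T k eta u.
Proof.
move=> wu w Tw; rewrite (ipL2C T (extd w) eta) (ipL2_test_sub eta (test_form_extd Tw)).
rewrite (ipL2C T w u) (ipL2_test_sub u Tw) (ipL2C X eta) (ipL2C X u).
by apply: wu; exact: test_form_sub.
Qed.

End restriction.

Section bounded_sets.
Variables (R : realType) (n : nat) (X : set 'rV[R]_n).
Hypotheses (mX : measurable X) (bX : bounded_set X).
Local Notation mu := (lebesgue_rV R n).

Lemma continuous_bounded_on (f : 'rV[R]_n -> R) : continuous f ->
  exists M : R, forall x, X x -> `|f x| <= M.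
Proof.
move=> cf; have [M [_ XM]] := bX; pose c : R := `|M| + 1.
pose K : set 'rV[R]_n := cbox (const_mx (- c)) (const_mx c).
have XK : X `<=` K.
  move=> x Xx i; rewrite !mxE -ler_norml (le_trans (rV_coord_le x i))//.
  by apply: XM => //; rewrite (le_lt_trans (ler_norm _))// ltrDl.
have /compact_bounded[N [_ NP]] : compact (f @` K).
  apply: continuous_compact; last exact: cbox_compact.
  exact: continuous_subspaceT.
exists (`|N| + 1) => x Xx; apply: (NP (`|N| + 1)).
  by rewrite (le_lt_trans (ler_norm _))// ltrDl.
by exists x => //; exact: XK.
Qed.

Lemma sqint_continuous_indic (A : set 'rV[R]_n) (f : 'rV[R]_n -> R) : measurable A ->
  continuous f -> sqint mu X (fun x => \1_A x * f x).
Proof.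
move=> mA cf; have [M fM] := continuous_bounded_on cf.
apply: (@sqint_bounded _ _ _ _ _ mX _ M); first exact: bounded_lebesgue_lty.
  apply: measurable_funM; first exact: measurable_indic.
  by apply: measurable_funTS; exact: continuous_measurable_rV.
move=> x Xx; rewrite normrM (le_trans _ (fM x Xx))// ler_piMl// indicE.
by case: (_ \in _); rewrite ?normr1// normr0.
Qed.

Lemma sqform_continuous (w : dform R n) : (forall I, continuous (fun x => w x I)) ->
  sqform X w.
Proof.
move=> cw I; have := sqint_continuous_indic measurableT (cw I).
by apply: eq_sqint => // x _; rewrite indicT mul1r.
Qed.

Lemma sqform_C1 (w : dform R n) : C1form w -> sqform X w.
Proof. by move=> C; apply: sqform_continuous => I; case: (C I). Qed.

Lemma sqform_cst (c : extalg R n) : sqform X (cst c).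
Proof. exact: sqform_C1 (C1form_cst c). Qed.

End bounded_sets.

(** * Gluing forms over the cells of the mesh *)

Section mesh_theory.
Variables (R : realType) (n : nat) (Om : set 'rV[R]_n) (m : nat) (G : 'I_m -> 'M[R]_(n.+1, n)).
Hypotheses (n_gt0 : (0 < n)%N) (oOm : open Om) (bOm : bounded_set Om).
Hypothesis (subdiv : simplicial_subdivision Om G).
Local Notation E := 'rV[R]_n.
Local Notation mu := (lebesgue_rV R n).
Local Notation T i := (cell (G i)).
Implicit Types (w u eta : dform R n) (k : nat) (i : 'I_m).

Let mOm : measurable Om := open_measurable_rV oOm.

Lemma open_cell i : open (T i).
Proof. exact: open_interior. Qed.

Lemma measurable_cell i : measurable (T i).
Proof. by apply: open_measurable_rV; exact: open_cell. Qed.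

Lemma cell_sub i : T i `<=` Om.
Proof. exact: subdiv_cell subdiv i. Qed.

Lemma bounded_cell i : bounded_set (T i).
Proof.
move: bOm => [M [Mr MP]]; exists M; split => // y My x Tx.
exact: (MP y My x (cell_sub Tx)).
Qed.

Lemma ae_cell : {ae mu, forall x, Om x -> exists i, T i x}.
Proof.
have aei : {ae mu, forall x, forall i, simplex (G i) x -> T i x}.
  have aei i := ae_simplex_cell n_gt0 (subdiv_nondegenerate subdiv i).
  exact: filter_forall.
apply: filterS aei => x h Ox.
have : closure Om x by exact: subset_closure.
by rewrite -(subdiv_cover subdiv) => -[i _ /h Tx]; exists i.
Qed.

Lemma eqL2_cells w u : (forall i, eqL2 (T i) w u) -> eqL2 Om w u.
Proof.
move=> wu; have all_i : {ae mu, forall x, forall i, T i x -> w x = u x}.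
  exact: filter_forall.
by apply: filterS2 all_i ae_cell => x h /[apply] -[i]; exact: h.
Qed.

(** The common shape of [extd_h] and [interp], which unfold to instances of it; the value is 0 off
    the open cells. *)
Definition glue (F : 'I_m -> dform R n) : dform R n :=
  fun x => \sum_i \1_(T i) x *: F i x.

Lemma glueE F i x : T i x -> glue F x = F i x.
Proof.
move=> Tx; rewrite /glue (bigD1 i)//= indicE mem_set// scale1r big1 ?addr0// => j ji.
rewrite indicE memNset ?scale0r// => Tjx.
have : (T j `&` T i) x by [].
by rewrite (subdiv_disjoint subdiv ji).
Qed.

Lemma glue_homog (F : 'I_m -> dform R n) k x :
  (forall i, T i x -> homog k (F i x)) -> homog k (glue F x).
Proof.
move=> hF; apply: homog_sum => i; rewrite indicE; case: (boolP (x \in T i)) => [/set_mem Tx|_].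
  by rewrite scale1r; exact: hF.
by rewrite scale0r; exact: homog0.
Qed.

Lemma sqform_glue (F : 'I_m -> dform R n) :
  (forall i I, continuous (fun x => F i x I)) -> sqform Om (glue F).
Proof.
move=> cF I; rewrite (_ : (fun x => _) = fun x => \sum_i \1_(T i) x * F i x I).
  apply: sqint_sum => // i; apply: sqint_continuous_indic => //.
  exact: measurable_cell.
by apply/funext => x; rewrite sum_ffunE; apply: eq_bigr => i _; rewrite ffunE.
Qed.

Lemma L2form_glue (F : 'I_m -> dform R n) k :
  (forall i, C1form (F i)) -> (forall i x, homog k (F i x)) ->
  L2form Om k (glue F).
Proof.
move=> CF hF; apply/(L2formP mOm); split=> [x _|]; first exact: glue_homog.
by apply: sqform_glue => i I; case: (CF i I).
Qed.

Lemma extd_cell w u i x : (forall y, T i y -> w y = u y) -> T i x -> extd w x = extd u x.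
Proof.
move=> wu Tx; apply: extd_near.
have : nbhs x (T i) by apply: open_nbhs_nbhs; split => //; exact: open_cell.
by apply: filterS => y; exact: wu.
Qed.

Lemma ipL2_cells w u : sqform Om w -> sqform Om u ->
  ipL2 Om w u = \sum_i ipL2 (T i) w u.
Proof.
move=> sw su; pose f x := extdot (w x) (u x).
have intf : mu.-integrable Om (EFin \o f) by exact: ip_integrable.
have intfi i : mu.-integrable Om (EFin \o (f \_ (T i))).
  rewrite (_ : _ \o _ = (EFin \o f) \_ (T i)); last first.
    by apply/funext => x /=; rewrite !patchE; case: ifP.
  apply/(integrable_restrict _ (measurable_cell i) mOm).
  apply: integrableS intf => //; apply: measurableI => //; exact: measurable_cell.
transitivity (\int[mu]_(x in Om) (\sum_i (f \_ (T i)) x)).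
  apply: ae_eq_Rintegral => //.
  - by have /integrableP[/measurable_EFinP] := intf.
  - by have /integrableP[/measurable_EFinP] := integrable_Rsum mOm (index_enum 'I_m) xpredT intfi.
  - apply: filterS ae_cell => x /[apply] -[i Tx].
    rewrite (bigD1 i)//= patchE mem_set// big1 ?addr0// => j ji.
    rewrite patchE memNset// => Tjx; have : (T j `&` T i) x by [].
    by rewrite (subdiv_disjoint subdiv ji).
rewrite Rintegral_sum//; apply: eq_bigr => i _.
rewrite -Rintegral_mkcondr setIidr//; exact: cell_sub.
Qed.

End mesh_theory.

(** * The interpolation on a cell *)

Section moments.
Variables (R : realType) (n : nat) (X : set 'rV[R]_n).
Hypotheses (mX : measurable X) (bX : bounded_set X).
Local Notation E := 'rV[R]_n.
Local Notation mu := (lebesgue_rV R n).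
Implicit Types (w u : dform R n) (c : extalg R n) (k : nat).

Definition integral_form w : extalg R n := [ffun I => \int[mu]_(x in X) w x I].
Definition moment (i : 'I_n) w : extalg R n := [ffun I => \int[mu]_(x in X) (x 0 i * w x I)].
Definition volume : R := fine (mu X).

Let coord_sqint (i : 'I_n) : sqint mu X (fun x : E => x 0 i).
Proof.
have := sqint_continuous_indic mX bX measurableT (@coord_continuous R 1 n ord0 i).
by apply: eq_sqint => // x _; rewrite indicT mul1r.
Qed.

Let one_sqint : sqint mu X (fun _ : E => 1 : R).
Proof.
have := sqint_continuous_indic mX bX measurableT (fun x : E => @cst_continuous _ _ (1 : R) x).
by apply: eq_sqint => // x _; rewrite indicT mul1r.
Qed.

Lemma form_integrable w I : sqform X w -> mu.-integrable X (EFin \o (fun x => w x I)).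
Proof.
move=> sw; have := sqint_mul_integrable mX (sw I) one_sqint.
by apply: eq_integrable => // x _; rewrite /= mulr1.
Qed.

Lemma moment_integrable i w I : sqform X w ->
  mu.-integrable X (EFin \o (fun x : E => x 0 i * w x I)).
Proof. by move=> sw; exact: (sqint_mul_integrable mX (coord_sqint i) (sw I)). Qed.

Lemma ipL2_cst w c : sqform X w -> ipL2 X w (cst c) = extdot (integral_form w) c.
Proof.
move=> sw; rewrite /ipL2 /extdot Rintegral_sum//=.
  by apply: eq_bigr => I _; rewrite ffunE RintegralZr//; exact: form_integrable.
move=> I; have := integrableZr mX (c I) (form_integrable I sw).
by apply: eq_integrable.
Qed.

(** Moving each exterior multiplication to the other side as a contraction leaves only first moments
    of w, so the pairing depends on finitely many integrals. *)
Lemma ipL2_dual_koszul w c c' : sqform X w ->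
  ipL2 X w (fun x => c + dual_koszul c' x) =
  extdot (integral_form w) c + extdot (\sum_i ext_contr i (moment i w)) c'.
Proof.
move=> sw.
have intI i I : mu.-integrable X (EFin \o (fun x : E => x 0 i * w x I * ext_wedge i c' I)).
  have := integrableZr mX (ext_wedge i c' I) (moment_integrable i I sw).
  by apply: eq_integrable.
have -> : extdot (\sum_i ext_contr i (moment i w)) c' =
    \int[mu]_(x in X) (\sum_i \sum_I x 0 i * w x I * ext_wedge i c' I).
  rewrite Rintegral_sum//; last by move=> i; apply: integrable_Rsum.
  rewrite extdot_suml; apply: eq_bigr => i _.
  rewrite extdotC -ext_wedge_contr extdotC Rintegral_sum//.
  by apply: eq_bigr => I _; rewrite ffunE RintegralZr//; exact: moment_integrable.
rewrite -ipL2_cst// /ipL2 -RintegralD//; first last.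
- by apply: integrable_Rsum => // i; apply: integrable_Rsum.
- by apply: ip_integrable => //; exact: sqform_cst.
apply: eq_Rintegral => x _; rewrite extdotDr; congr (_ + _).
rewrite extdot_sumr; apply: eq_bigr => i _; rewrite extdotZr mulr_sumr.
by apply: eq_bigr => I _; rewrite mulrA.
Qed.

Lemma Rintegral_eq0 (f : E -> R) : (forall x, X x -> f x = 0) -> \int[mu]_(x in X) f x = 0.
Proof.
move=> f0; rewrite /Rintegral (_ : (\int[mu]_(x in X) (f x)%:E = 0)%E)//.
by apply: integral0_eq => x /f0 ->.
Qed.

Lemma homog_integral_form k w : (forall x, X x -> homog k (w x)) -> homog k (integral_form w).
Proof.
move=> hw I Ik; by rewrite ffunE Rintegral_eq0// => x Xx; exact: hw.
Qed.

Lemma homog_moment k i w : (forall x, X x -> homog k (w x)) -> homog k (moment i w).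
Proof.
move=> hw I Ik; by rewrite ffunE Rintegral_eq0// => x Xx; rewrite hw ?mulr0.
Qed.

Lemma eqL2_integral_form w u : sqform X w -> sqform X u -> eqL2 X w u ->
  integral_form w = integral_form u.
Proof.
move=> sw su wu; apply/ffunP => I; rewrite !ffunE; apply: ae_eq_Rintegral => //.
- by case: (sw I).
- by case: (su I).
- by apply: filterS wu => x /[apply] ->.
Qed.

Lemma eqL2_moment i w u : sqform X w -> sqform X u -> eqL2 X w u ->
  moment i w = moment i u.
Proof.
move=> sw su wu; apply/ffunP => I; rewrite !ffunE; apply: ae_eq_Rintegral => //.
- by have /integrableP[/measurable_EFinP] := moment_integrable i I sw.
- by have /integrableP[/measurable_EFinP] := moment_integrable i I su.
- by apply: filterS wu => x /[apply] ->.
Qed.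

Lemma moment0 i : moment i 0 = 0.
Proof.
apply/ffunP => I; rewrite ffunE [RHS]ffunE; apply: Rintegral_eq0 => x _.
by rewrite ffunE mulr0.
Qed.

Lemma integral_form_cst c : integral_form (cst c) = volume *: c.
Proof.
apply/ffunP => I; rewrite !ffunE Rintegral_cst// mulrC.
by [].
Qed.

Lemma integral_form_affine A c :
  integral_form (fun x : E => c + \sum_j x 0 j *: A j) =
  volume *: c + \sum_j moment j (cst (A j)).
Proof.
apply/ffunP => I; rewrite -integral_form_cst [RHS]ffunE sum_ffunE !ffunE.
have i2 j : mu.-integrable X (EFin \o (fun x : E => x 0 j * A j I)).
  by have := moment_integrable j I (sqform_cst mX bX (A j)).
under [in RHS]eq_bigr do rewrite ffunE.
rewrite -Rintegral_sum// -RintegralD//; first last.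
- exact: integrable_Rsum.
- by have := form_integrable I (sqform_cst mX bX c).
apply: eq_Rintegral => x _; rewrite ffunE sum_ffunE; congr (_ + _).
by apply: eq_bigr => j _; rewrite ffunE.
Qed.

(* Against eta = e + dual_koszul e', the interpolation functional of (w, u = d w) is
   -<pairing_moment, e'> - <integral_form u, e> (see [pairing_momentE]). *)
Definition pairing_moment k w u : extalg R n :=
  (n - k)%:R *: integral_form w + \sum_i ext_contr i (moment i u).

Lemma pairing_momentE k w u (e e' : extalg R n) : sqform X w -> sqform X u -> homog k e' ->
  let eta := fun x => e + dual_koszul e' x in
  ipL2 X w (coextd eta) - ipL2 X u eta =
  - (extdot (pairing_moment k w u) e' + extdot (integral_form u) e).
Proof.
move=> sw su he' eta; rewrite /eta (coextd_dual_koszul _ he') (ipL2_cst _ sw).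
rewrite (ipL2_dual_koszul _ _ su) extdotNr extdotZr extdotDl extdotZl.
ring.
Qed.

Lemma homog_eqP k (a b : extalg R n) : homog k a -> homog k b ->
  (forall c, homog k c -> extdot a c = extdot b c) -> a = b.
Proof.
move=> ha hb ab; apply/ffunP => I; have [Ik|Ik] := eqVneq #|I| k.
  by rewrite -!extdot_basisr; apply: ab; rewrite -Ik; exact: homog_basis.
by rewrite ha// hb.
Qed.

Lemma homog_pairing_moment k w u : (forall x, X x -> homog k (w x)) ->
  (forall x, X x -> homog k.+1 (u x)) -> homog k (pairing_moment k w u).
Proof.
move=> hw hu; apply: homogD; first by apply: homogZ; exact: homog_integral_form.
by apply: homog_sum => i; apply: homog_contr; exact: homog_moment.
Qed.

(** The constants e and e' of the test form vary independently, so setting one of them to 0 isolates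
    each quantity. The interpolation conditions thus become two equations in the exterior
    algebra. *)
Lemma pairing_eqP k w u w' u' :
  sqform X w -> sqform X u -> sqform X w' -> sqform X u' ->
  (forall x, X x -> homog k (w x)) -> (forall x, X x -> homog k.+1 (u x)) ->
  (forall x, X x -> homog k (w' x)) -> (forall x, X x -> homog k.+1 (u' x)) ->
  (k < n)%N ->
  (forall eta, P1star k.+1 eta ->
    ipL2 X w (coextd eta) - ipL2 X u eta = ipL2 X w' (coextd eta) - ipL2 X u' eta) <->
  pairing_moment k w u = pairing_moment k w' u' /\ integral_form u = integral_form u'.
Proof.
move=> sw su sw' su' hw hu hw' hu' kn; split=> [eq_pair|[M1 M2] eta]; last first.
  move=> /(P1starP _ kn)[e [e' [he he' ->]]].
  by rewrite (pairing_momentE e sw su he') (pairing_momentE e sw' su' he') M1 M2.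
have key e e' : homog k.+1 e -> homog k e' ->
    extdot (pairing_moment k w u) e' + extdot (integral_form u) e =
    extdot (pairing_moment k w' u') e' + extdot (integral_form u') e.
  move=> he he'; apply: oppr_inj.
  rewrite -(pairing_momentE e sw su he') -(pairing_momentE e sw' su' he'); apply: eq_pair.
  by apply/(P1starP _ kn); exists e, e'.
split.
  apply: (@homog_eqP k); try exact: homog_pairing_moment.
  move=> e' he'; have := key 0 e' (@homog0 _ _ k.+1) he'.
  by rewrite !extdot0r !addr0.
apply: (@homog_eqP k.+1); try exact: homog_integral_form.
move=> e he; have := key e 0 he (@homog0 _ _ k).
by rewrite !extdot0r !add0r.
Qed.

End moments.

Section cell_interpolation.
Variables (R : realType) (n : nat).
Local Notation E := 'rV[R]_n.
Local Notation mu := (lebesgue_rV R n).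
Implicit Types (w u eta : dform R n) (c : extalg R n) (k : nat).

Lemma P1minus_C1 k u : P1minus k u -> C1form u.
Proof. by move=> [c [c' [_ _ ->]]]; exact: C1form_koszul. Qed.

Lemma P1minus_homog k u x : P1minus k u -> homog k (u x).
Proof.
by move=> [c [c' [hc hc' ->]]]; apply: homogD => //; exact: homog_koszul.
Qed.

Lemma koszul0 (x : E) : koszul 0 x = 0.
Proof. by rewrite /koszul big1// => i _; rewrite linear0 scaler0. Qed.

Lemma dual_koszul0 (x : E) : dual_koszul 0 x = 0.
Proof. by rewrite /dual_koszul big1// => i _; rewrite linear0 scaler0. Qed.

Lemma P1minus_cst k c : homog k c -> P1minus k (cst c : dform R n).
Proof.
move=> hc; exists c, 0; split=> //; first exact: homog0.
by apply/funext => x; rewrite koszul0 addr0.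
Qed.

Lemma P1star_cst k c : (k < n)%N -> homog k.+1 c -> P1star k.+1 (cst c : dform R n).
Proof.
move=> kn hc; apply/(P1starP _ kn); exists c, 0; split=> //; first exact: homog0.
by apply/funext => x; rewrite dual_koszul0 addr0.
Qed.

Lemma P1star_coextd k eta : (k < n)%N -> P1star k.+1 eta ->
  [/\ C1form eta, forall x, homog k.+1 (eta x) & exists2 c, homog k c & coextd eta = cst c].
Proof.
move=> kn /(P1starP _ kn)[c [c' [hc hc' ->]]]; split.
- exact: C1form_dual_koszul.
- by move=> x; apply: homogD => //; exact: homog_dual_koszul.
- exists (- ((n - k)%:R *: c')); last exact: coextd_dual_koszul.
  by apply: homogN; exact: homogZ.
Qed.

Lemma P1minus_extd k u : P1minus k u ->
  exists2 c, homog k.+1 c & extd u = cst c.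
Proof.
move=> [c [c' [hc hc' ->]]]; exists (k.+1%:R *: c'); first exact: homogZ.
exact: extd_koszul.
Qed.

Lemma ipL2_set0 w u : ipL2 set0 w u = 0.
Proof. exact: Rintegral_set0. Qed.

Variables (v : 'M[R]_(n.+1, n)) (k : nat) (w : dform R n).
Local Notation T := (cell v).
Hypotheses (bT : bounded_set T) (kn : (k < n)%N).
Hypotheses (Lw : L2form T k w) (Ldw : L2form T k.+1 (wextd T k w)).

Let oT : open T. Proof. exact: open_interior. Qed.
Let mT : measurable T := open_measurable_rV oT.
Let dw := wextd T k w.

Lemma volume_gt0 : T !=set0 -> 0 < volume T.
Proof.
move=> T0; apply: fine_gt0; rewrite open_lebesgue_gt0//=.
exact: bounded_lebesgue_lty.
Qed.

(* For u = c + koszul c', the condition on [integral_form] determines c', after which the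
   condition on [pairing_moment] determines c; on an empty cell both are void. *)
Lemma interp_cell_ex : exists u, P1minus k u /\ forall eta, P1star k.+1 eta ->
  ipL2 T u (coextd eta) - ipL2 T (extd u) eta = ipL2 T w (coextd eta) - ipL2 T dw eta.
Proof.
have [T0|/set0P/volume_gt0 vol0] := eqVneq T set0.
  exists (cst 0); split; first by apply: P1minus_cst; exact: homog0.
  by move=> eta _; rewrite T0 !ipL2_set0.
have [hw sw] := (L2formP mT k w).1 Lw; have [hdw sdw] := (L2formP mT k.+1 dw).1 Ldw.
have voln0 : volume T != 0 by rewrite gt_eqF.
have kn0 : (k.+1)%:R != 0 :> R by rewrite pnatr_eq0.
have nkn0 : (n - k)%:R != 0 :> R by rewrite pnatr_eq0 subn_eq0 -ltnNge.
pose d := (volume T)^-1 *: integral_form T dw.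
have hd : homog k.+1 d by apply: homogZ; exact: homog_integral_form.
pose c' := (k.+1)%:R^-1 *: d.
have hc' : homog k.+1 c' by exact: homogZ.
have dE : (k.+1)%:R *: c' = d by rewrite scalerA mulfV// scale1r.
pose s := \sum_i moment T i (cst (ext_contr i c')).
have hs : homog k s.
  apply: homog_sum => i; apply: homog_moment => x _; exact: homog_contr.
pose y := \sum_i ext_contr i (moment T i (cst d)).
have hy : homog k y.
  by apply: homog_sum => i; apply: homog_contr; apply: homog_moment => x _.
pose c := (volume T)^-1 *: ((n - k)%:R^-1 *: (pairing_moment T k w dw - y) - s).
have hc : homog k c.
  apply: homogZ; apply: homogD; last exact: homogN.
  by apply: homogZ; apply: homogD; [exact: homog_pairing_moment|exact: homogN].
pose u : dform R n := fun x => c + koszul c' x.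
have Pu : P1minus k u by exists c, c'.
have extdu : extd u = cst d by rewrite /u (extd_koszul _ hc') dE.
exists u; split => //.
apply/(pairing_eqP mT bT) => //.
- by apply: sqform_C1 => //; exact: P1minus_C1 Pu.
- by rewrite extdu; exact: sqform_cst.
- by move=> x _; exact: P1minus_homog.
- by rewrite extdu.
split; last first.
  by rewrite extdu integral_form_cst// scalerA mulfV// scale1r.
rewrite /pairing_moment extdu -/y.
rewrite (integral_form_affine mT bT (fun i => ext_contr i c')) -/s.
rewrite [volume T *: c]scalerA mulfV// scale1r subrK scalerA mulfV// scale1r subrK.
by [].
Qed.

Lemma interp_cellP : P1minus k (interp_cell v k w) /\ forall eta, P1star k.+1 eta ->
  ipL2 T (interp_cell v k w) (coextd eta) - ipL2 T (extd (interp_cell v k w)) eta =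
  ipL2 T w (coextd eta) - ipL2 T dw eta.
Proof. exact: (xgetPex 0 interp_cell_ex). Qed.

Lemma interp_cell_moments :
  pairing_moment T k (interp_cell v k w) (extd (interp_cell v k w)) = pairing_moment T k w dw /\
  integral_form T (extd (interp_cell v k w)) = integral_form T dw.
Proof.
have [Pu eq_pair] := interp_cellP; have [c hc extdu] := P1minus_extd Pu.
have [hw sw] := (L2formP mT k w).1 Lw; have [hdw sdw] := (L2formP mT k.+1 dw).1 Ldw.
apply/(pairing_eqP mT bT) => //.
- by apply: sqform_C1 => //; exact: P1minus_C1 Pu.
- by rewrite extdu; exact: sqform_cst.
- by move=> x _; exact: P1minus_homog.
- by rewrite extdu.
Qed.

Lemma extd_interp_cell : T !=set0 ->
  extd (interp_cell v k w) = cst ((volume T)^-1 *: integral_form T dw).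
Proof.
move=> /volume_gt0 vol0; have [_ <-] := interp_cell_moments.
have [Pu _] := interp_cellP; have [c _ ->] := P1minus_extd Pu.
by rewrite integral_form_cst// scalerA mulVf ?gt_eqF// scale1r.
Qed.

Lemma interp_cell_closed : T !=set0 -> eqL2 T dw 0 ->
  interp_cell v k w = cst ((volume T)^-1 *: integral_form T w).
Proof.
move=> T0 dw0; have vol0 := volume_gt0 T0; have voln0 : volume T != 0 by rewrite gt_eqF.
have [hdw sdw] := (L2formP mT k.+1 dw).1 Ldw.
have nkn0 : (n - k)%:R != 0 :> R by rewrite pnatr_eq0 subn_eq0 -ltnNge.
have mdw i : moment T i dw = 0.
  by rewrite (eqL2_moment mT bT i sdw (sqform0 T) dw0) moment0.
have extd0 : extd (interp_cell v k w) = 0.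
  rewrite extd_interp_cell// (eqL2_integral_form mT sdw (sqform0 T) dw0).
  by rewrite (integral_form_cst mT 0) !scaler0.
have [M _] := interp_cell_moments; have [[c [c' [hc hc' uE]]] _] := interp_cellP.
(* The differential of the interpolant is (k + 1) c' and vanishes, so only its constant part c is
   left; [pairing_moment] then reduces to (n - k) times the integral. *)
have c'0 : c' = 0.
  have := congr1 (fun f => f 0) (extd_koszul c hc'); rewrite -uE extd0 /=.
  by move/esym/eqP; rewrite scaler_eq0 pnatr_eq0 /= => /eqP.
have uc : interp_cell v k w = cst c.
  by rewrite uE c'0; apply/funext => x; rewrite koszul0 addr0.
move: M; rewrite /pairing_moment extd0 uc integral_form_cst//.
rewrite !big1 => [|i _|i _]; rewrite ?mdw ?moment0 ?linear0// !addr0.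
move=> /(scalerI nkn0) <-.
by rewrite scalerA mulVf// scale1r.
Qed.

End cell_interpolation.

(** * The nonconforming complexes *)

Section nonconforming_complex.
Variables (R : realType) (n : nat) (Om : set 'rV[R]_n) (m : nat) (G : 'I_m -> 'M[R]_(n.+1, n)).
Hypotheses (n_gt0 : (0 < n)%N) (oOm : open Om) (bOm : bounded_set Om).
Hypothesis (subdiv : simplicial_subdivision Om G).
Local Notation E := 'rV[R]_n.
Local Notation mu := (lebesgue_rV R n).
Local Notation T i := (cell (G i)).
Implicit Types (w u eta : dform R n) (k : nat) (i : 'I_m) (c : 'I_m -> extalg R n).

Let mOm : measurable Om := open_measurable_rV oOm.
Let oT i : open (T i). Proof. exact: open_cell. Qed.
Let mT i : measurable (T i). Proof. exact: measurable_cell. Qed.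
Let bT i : bounded_set (T i). Proof. exact: bounded_cell bOm subdiv i. Qed.
Let TO i : T i `<=` Om. Proof. exact: cell_sub. Qed.
Let sqO k w : L2form Om k w -> sqform Om w := @L2form_sqform R n Om mOm k w.

Definition glue_cst c : dform R n := glue G (fun i => cst (c i)).

Lemma glue_cstE c i x : T i x -> glue_cst c x = c i.
Proof. by move=> Tx; rewrite /glue_cst (glueE subdiv _ Tx). Qed.

Lemma L2form_glue_cst c k : (forall i, homog k (c i)) -> L2form Om k (glue_cst c).
Proof.
move=> hc; apply: (L2form_glue G oOm bOm) => [i|i x]; first exact: C1form_cst.
exact: hc.
Qed.

Lemma piecewise_P1minus_cst c k : (forall i, homog k (c i)) ->
  piecewise Om G (@P1minus R n) k (glue_cst c).
Proof.
move=> hc; split; first exact: L2form_glue_cst.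
move=> i; exists (cst (c i)); first exact: P1minus_cst.
by move=> x; exact: glue_cstE.
Qed.

Lemma piecewise_P1star_cst c k : (k < n)%N -> (forall i, homog k.+1 (c i)) ->
  piecewise Om G (@P1star R n) k.+1 (glue_cst c).
Proof.
move=> kn hc; split; first exact: L2form_glue_cst.
move=> i; exists (cst (c i)); first exact: P1star_cst.
by move=> x; exact: glue_cstE.
Qed.

Lemma piecewise_P0_cst c k : (forall i, homog k (c i)) ->
  piecewise Om G (@P0forms R n) k (glue_cst c).
Proof.
move=> hc; split; first exact: L2form_glue_cst.
move=> i; exists (cst (c i)); first by exists (c i).
by move=> x; exact: glue_cstE.
Qed.

Lemma extd_hE u i x : T i x -> extd_h G u x = extd u x.
Proof. by move=> Tx; rewrite -[LHS]/(glue G (fun=> extd u) x) (glueE subdiv _ Tx). Qed.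

Lemma extd_h_glue w c : (forall i x, T i x -> extd w x = c i) -> extd_h G w = glue_cst c.
Proof.
move=> wc; apply/funext => x; apply: eq_bigr => i _; rewrite indicE.
case: (boolP (x \in T i)) => [/set_mem Tx|_]; last by rewrite !scale0r.
by rewrite (wc i x Tx).
Qed.

Lemma extd_h_P1minus k w : piecewise Om G (@P1minus R n) k w ->
  exists2 c, forall i, homog k.+1 (c i) & extd_h G w = glue_cst c.
Proof.
move=> [_ pw].
have /choice[c cP] : forall i, exists c : extalg R n,
    homog k.+1 c /\ forall x, T i x -> extd w x = c.
  move=> i; have [p Pp wp] := pw i; have [c hc pc] := P1minus_extd Pp.
  by exists c; split => // x Tx; rewrite (extd_cell wp Tx) pc.
exists c; first by move=> i; case: (cP i).
by apply: extd_h_glue => i x; case: (cP i) => _; apply.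
Qed.

Lemma extd_h_glue_cst c : extd_h G (glue_cst c) = 0.
Proof.
rewrite (extd_h_glue (c := fun=> 0)).
  by apply/funext => x; rewrite /glue_cst /glue big1// => i _; rewrite scaler0.
move=> i x Tx; rewrite (@extd_cell _ _ _ G (glue_cst c) (cst (c i)) i x)// ?extd_cst//.
by move=> y; exact: glue_cstE.
Qed.

Lemma extd_h_extd_h k w : piecewise Om G (@P1minus R n) k w -> extd_h G (extd_h G w) = 0.
Proof. by move=> /extd_h_P1minus[c _ ->]; exact: extd_h_glue_cst. Qed.

(** On a cell, the restriction of the global weak codifferential and the classical codifferential of
    the polynomial q i are weak codifferentials of the same form, hence equal almost everywhere. *)
Lemma wcoextd_P1star k eta : (k < n)%N -> piecewise Om G (@P1star R n) k.+1 eta ->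
  Hstar Om k.+1 eta ->
  exists q c, forall i, [/\ P1star k.+1 (q i), forall x, T i x -> eta x = q i x,
    homog k (c i), coextd (q i) = cst (c i) &
    eqL2 (T i) (wcoextd Om k.+1 eta) (cst (c i))].
Proof.
move=> kn [_ peta] Heta; have [Leta Lde ewd] := HstarP oOm Heta.
have /choice[q qP] : forall i, exists q : dform R n,
    P1star k.+1 q /\ forall x, T i x -> eta x = q x.
  by move=> i; have [p Pp ep] := peta i; exists p.
have /choice[c cP] : forall i, exists c : extalg R n, homog k c /\ coextd (q i) = cst c.
  by move=> i; have [_ _ [c hc qc]] := P1star_coextd kn (qP i).1; exists c.
exists q, c => i; have [Pq eq_q] := qP i; have [hc qc] := cP i; split=> //.
have [Cq hq _] := P1star_coextd kn Pq.
have Lq : L2form (T i) k.+1 (q i).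
  by apply/(L2formP (mT i)); split=> [x _ //|]; exact: sqform_C1.
have Lc : L2form (T i) k (cst (c i) : dform R n).
  by apply/(L2formP (mT i)); split=> [x _ //|]; exact: sqform_cst.
have Li : L2form (T i) k (wcoextd Om k.+1 eta).
  exact: (L2form_sub oOm (@oT i) (@TO i) Lde).
apply: (is_wcoextd_unique (@oT i) (k := k.+1) (eta := eta)) => //.
  exact: (is_wcoextd_sub (@TO i)).
rewrite -qc; have : is_wcoextd (T i) k.+1 (q i) (coextd (q i)) by exact: is_wcoextd_C1.
move=> h phi Tphi; rewrite -(h phi Tphi); apply: eq_Rintegral => x /set_mem Tx.
by rewrite eq_q.
Qed.

(* Representing the weak codifferential, which is only determined almost everywhere, by a
   genuinely piecewise constant form. *)
Lemma Wstar_wcoextd k eta : (k.+1 < n)%N -> piecewise Om G (@P1star R n) k.+2 eta ->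
  Hstar Om k.+2 eta -> exists c, [/\ piecewise Om G (@P1star R n) k.+1 (glue_cst c),
    L2form Om k.+1 (glue_cst c) & eqL2 Om (wcoextd Om k.+2 eta) (glue_cst c)].
Proof.
move=> kn peta Heta; have [q [c qc]] := wcoextd_P1star kn peta Heta.
have hc i : homog k.+1 (c i) by case: (qc i).
exists c; split; first exact: (piecewise_P1star_cst (ltnW kn)).
  exact: L2form_glue_cst.
apply: (eqL2_cells n_gt0 subdiv) => i; case: (qc i) => _ _ _ _.
by apply: filterS => x h Tx; rewrite h// (glue_cstE _ Tx).
Qed.

(** For a coclosed eta, the condition defining the nonconforming spaces is orthogonality of the
    cellwise differential to eta. *)
Lemma coclosed_pairing k w u eta : sqform Om w -> Hstar Om k.+1 eta ->
  eqL2 Om (wcoextd Om k.+1 eta) 0 ->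
  ipL2 Om w (wcoextd Om k.+1 eta) - ipL2 Om u eta = 0 -> ipL2 Om u eta = 0.
Proof.
move=> sw Heta de0; have [_ Lde _] := HstarP oOm Heta.
rewrite (eqL2_ipr mOm sw (sqO Lde) (sqform0 Om) de0) ipL20r sub0r.
by move/eqP; rewrite oppr_eq0 => /eqP.
Qed.

Lemma Wnc_extd_h k w : (k < n)%N -> Wnc Om G k w -> Wnc Om G k.+1 (extd_h G w).
Proof.
move=> kn; rewrite {1}/Wnc kn => -[pw ww]; have [c hc wc] := extd_h_P1minus pw.
have sw := sqO pw.1; rewrite /Wnc; case: ifPn => [kn1|_]; last first.
  by rewrite wc; exact: piecewise_P0_cst.
split=> [|eta [peta Heta]]; first by rewrite wc; exact: piecewise_P1minus_cst.
(* What remains is the pairing of d_h w with delta eta, to be read as the condition on w tested with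
   delta eta. *)
rewrite (extd_h_extd_h pw) ipL20l subr0.
have [c' [pc' Lc' ec']] := Wstar_wcoextd kn1 peta Heta.1.
have [_ Lde _] := HstarP oOm Heta.1.
have [Hc' wc'0] := Hstar_wcoextd oOm Heta.1 Lc' ec'.
have sdw : sqform Om (extd_h G w) by rewrite wc; exact: sqO (L2form_glue_cst hc).
rewrite (eqL2_ipr mOm sdw (sqO Lde) (sqO Lc') ec').
apply: (coclosed_pairing sw Hc' wc'0); apply: ww; split => //.
exact: (Hstar0_wcoextd oOm Heta).
Qed.

Definition top_form : extalg R n := ext_basis R [set: 'I_n]%SET.

Lemma homog_top : homog n top_form.
Proof. by have := @homog_basis R n [set: 'I_n]%SET; rewrite cardsT card_ord. Qed.

Lemma integral_topE w : integral_top Om w = ipL2 Om w (cst top_form).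
Proof. by apply: eq_Rintegral => x _; rewrite extdot_basisr. Qed.

Lemma Hstar_cst k (e : extalg R n) : homog k.+1 e ->
  Hstar Om k.+1 (cst e) /\ eqL2 Om (wcoextd Om k.+1 (cst e)) 0.
Proof.
move=> he; have L : L2form Om k.+1 (cst e : dform R n).
  by apply/(L2formP mOm); split=> [x _ //|]; exact: sqform_cst.
have w0 : is_wcoextd Om k.+1 (cst e) 0.
  by have := is_wcoextd_C1 (X := Om) (k := k.+1) (C1form_cst e); rewrite coextd_cst.
have L0 : L2form Om k (0 : dform R n) by exact: L2form0.
split; first by split => //; exists 0.
by have [] := wcoextdP oOm (L0 : L2form Om k.+1.-1 0) w0.
Qed.

Lemma piecewise_P1star_const k (e : extalg R n) : (k < n)%N -> homog k.+1 e ->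
  piecewise Om G (@P1star R n) k.+1 (cst e).
Proof.
move=> kn he; split; first by apply/(L2formP mOm); split=> [x _ //|]; exact: sqform_cst.
by move=> i; exists (cst e) => //; exact: P1star_cst.
Qed.

Lemma Wnc0_extd_h k w : (k < n)%N -> Wnc0 Om G k w -> Wnc0 Om G k.+1 (extd_h G w).
Proof.
move=> kn; rewrite {1}/Wnc0 kn => -[pw ww]; have [c hc wc] := extd_h_P1minus pw.
have sw := sqO pw.1.
rewrite /Wnc0; case: ifPn => [kn1|]; last first.
  rewrite -leqNgt => nk; have kE : k.+1 = n by apply/eqP; rewrite eqn_leq nk kn.
  split; first by rewrite wc; exact: piecewise_P0_cst.
  (* In top degree the volume form is a coclosed element of W^*_h, and pairing with it is
     integration over Om. *)
  have ht : homog k.+1 top_form by rewrite kE; exact: homog_top.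
  have [Ht wt0] := Hstar_cst ht.
  rewrite integral_topE; apply: (coclosed_pairing sw Ht wt0); apply: ww.
  by split => //; exact: piecewise_P1star_const.
split=> [|eta [peta Heta]]; first by rewrite wc; exact: piecewise_P1minus_cst.
rewrite (extd_h_extd_h pw) ipL20l subr0.
have [c' [pc' Lc' ec']] := Wstar_wcoextd kn1 peta Heta.
have [_ Lde _] := HstarP oOm Heta.
have [Hc' wc'0] := Hstar_wcoextd oOm Heta Lc' ec'.
have sdw : sqform Om (extd_h G w) by rewrite wc; exact: sqO (L2form_glue_cst hc).
rewrite (eqL2_ipr mOm sdw (sqO Lde) (sqO Lc') ec').
by apply: (coclosed_pairing sw Hc' wc'0); apply: ww.
Qed.

Section interpolation.
Variables (k : nat) (w : dform R n).
Hypotheses (kn : (k < n)%N) (Hw : HL Om k w).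

Let Lw : L2form Om k w. Proof. by have [] := HLP oOm kn Hw. Qed.
Let Ldw : L2form Om k.+1 (wextd Om k w). Proof. by have [] := HLP oOm kn Hw. Qed.
Let wdw : is_wextd Om k w (wextd Om k w). Proof. by have [] := HLP oOm kn Hw. Qed.
Let LTw i : L2form (T i) k w. Proof. exact: (L2form_sub oOm (@oT i) (@TO i) Lw). Qed.
Let LTdw i : L2form (T i) k.+1 (wextd Om k w).
Proof. exact: (L2form_sub oOm (@oT i) (@TO i) Ldw). Qed.

(** [interp_cell] uses a representative chosen on the cell, the global pairings one chosen on Om;
    only their classes agree. *)
Lemma wextd_cell i : L2form (T i) k.+1 (wextd (T i) k w) /\
  eqL2 (T i) (wextd (T i) k w) (wextd Om k w).
Proof.
have wdi : is_wextd (T i) k w (wextd Om k w) by exact: (is_wextd_sub (@TO i)).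
by have [] := wextdP (@oT i) (LTdw i) wdi.
Qed.

Let local i := interp_cell (G i) k w.

Let local_P1minus i : P1minus k (local i).
Proof. by have [] := interp_cellP (bT i) kn (LTw i) (wextd_cell i).1. Qed.

Lemma interpE i x : T i x -> interp Om G k w x = interp_cell (G i) k w x.
Proof. by rewrite /interp kn => Tx; rewrite -[LHS]/(glue G local x) (glueE subdiv _ Tx). Qed.

Lemma interp_P1minus : piecewise Om G (@P1minus R n) k (interp Om G k w).
Proof.
split; last by move=> i; exists (local i) => // x; exact: interpE.
rewrite /interp kn; apply: (L2form_glue G oOm bOm (F := local)) => [i|i x].
  exact: P1minus_C1 (local_P1minus i).
exact: P1minus_homog (local_P1minus i).
Qed.

Lemma interp_pairing eta : piecewise Om G (@P1star R n) k.+1 eta -> Hstar Om k.+1 eta ->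
  ipL2 Om (interp Om G k w) (wcoextd Om k.+1 eta) - ipL2 Om (extd_h G (interp Om G k w)) eta =
  ipL2 Om w (wcoextd Om k.+1 eta) - ipL2 Om (wextd Om k w) eta.
Proof.
move=> peta Heta; have [q [c qc]] := wcoextd_P1star kn peta Heta.
have [Leta Lde _] := HstarP oOm Heta.
have [d hd dE] := extd_h_P1minus interp_P1minus.
have si := sqO interp_P1minus.1; have se := sqO Leta; have sde := sqO Lde.
have sd : sqform Om (extd_h G (interp Om G k w)).
  by rewrite dE; exact: sqO (L2form_glue_cst hd).
rewrite !(ipL2_cells n_gt0 oOm subdiv)//; try exact: (sqO Lw); try exact: (sqO Ldw).
rewrite -!sumrB; apply: eq_bigr => i _.
have [Pq eq_q hc coq ec] := qc i; have [Cq hq _] := P1star_coextd kn Pq.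
have [Ldi edi] := wextd_cell i.
have sT u : sqform Om u -> sqform (T i) u by apply: (sqform_sub oOm (@oT i)).
have sc : sqform (T i) (cst (c i) : dform R n) by exact: sqform_cst.
have Clocal := P1minus_C1 (local_P1minus i).
have slocal : sqform (T i) (local i) by exact: sqform_C1.
have [_ /(_ (q i) Pq)] := interp_cellP (bT i) kn (LTw i) Ldi.
rewrite coq -!(eqL2_ipr (mT i) _ (sT _ sde) sc ec)//; last exact: sT (sqO Lw).
have -> : ipL2 (T i) (wextd (T i) k w) (q i) = ipL2 (T i) (wextd Om k w) eta.
  have sq : sqform (T i) (q i) by exact: sqform_C1.
  rewrite (eqL2_ipl (mT i) (L2form_sqform (mT i) Ldi) (L2form_sqform (mT i) (LTdw i)) sq edi).
  by apply: eq_Rintegral => x /set_mem Tx; rewrite eq_q.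
move=> <-; congr (_ - _); apply: eq_Rintegral => x /set_mem Tx.
  by rewrite (interpE Tx).
by rewrite eq_q// (extd_hE _ Tx) (extd_cell (fun y => @interpE i y) Tx).
Qed.

Lemma interp_Wnc : Wnc Om G k (interp Om G k w).
Proof.
rewrite /Wnc kn; split; first exact: interp_P1minus.
move=> eta [peta Heta]; rewrite (interp_pairing peta Heta.1).
by rewrite (Hstar0_pair oOm Heta (sqO Lw) (sqO Ldw)) ?subrr.
Qed.

Lemma interp_Wnc0 : HL0 Om k w -> Wnc0 Om G k (interp Om G k w).
Proof.
move=> H0; rewrite /Wnc0 kn; split; first exact: interp_P1minus.
move=> eta [peta Heta]; rewrite (interp_pairing peta Heta).
have [Leta Lde ewd] := HstarP oOm Heta.
rewrite (HL0_pair oOm kn H0 (sqO Leta) (sqO Lde)) ?subrr// => phi Tphi.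
by rewrite ewd.
Qed.

Lemma extd_h_interp i x : T i x -> extd_h G (interp Om G k w) x =
  (volume (T i))^-1 *: integral_form (T i) (wextd Om k w).
Proof.
move=> Tx; rewrite (extd_hE _ Tx) (extd_cell (fun y => @interpE i y) Tx).
have [Ldi edi] := wextd_cell i.
rewrite (extd_interp_cell (bT i) kn (LTw i) Ldi); last by exists x.
congr (_ *: _); apply: eqL2_integral_form edi => //.
  exact: L2form_sqform Ldi.
exact: L2form_sqform (LTdw i).
Qed.

End interpolation.

Lemma interp_wextd k w i x : (k.+1 < n)%N -> HL Om k w -> T i x ->
  interp Om G k.+1 (wextd Om k w) x =
  (volume (T i))^-1 *: integral_form (T i) (wextd Om k w).
Proof.
move=> kn1 Hw Tx; have Hdw := HL_wextd oOm (ltnW kn1) Hw.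
have [Lw Ldw wdw] := HLP oOm (ltnW kn1) Hw.
have LTdw : L2form (T i) k.+1 (wextd Om k w) := L2form_sub oOm (@oT i) (@TO i) Ldw.
rewrite (interpE _ kn1 Tx).
have L0 : L2form (T i) k.+2 (0 : dform R n) by exact: L2form0.
have d0 : is_wextd (T i) k.+1 (wextd Om k w) 0.
  by apply: (is_wextd_sub (@TO i)); exact: is_wextd_wextd wdw.
have [Ldd _ dd0] := wextdP (@oT i) L0 d0.
rewrite (interp_cell_closed (bT i) kn1 LTdw Ldd)//.
by exists x.
Qed.

Section projection.
Variable w : dform R n.
Hypothesis Lw : L2form Om n w.

Let LTw i : L2form (T i) n w. Proof. exact: (L2form_sub oOm (@oT i) (@TO i) Lw). Qed.

Let sTw i : sqform (T i) w. Proof. exact: L2form_sqform (LTw i). Qed.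

Let mean i := (volume (T i))^-1 *: integral_form (T i) w.

Let homog_mean i : homog n (mean i).
Proof.
by apply: homogZ; apply: homog_integral_form; have [] := (L2formP (mT i) n w).1 (LTw i).
Qed.

Lemma ipL2_glue_cst u c : sqform Om u -> (forall i, homog n (c i)) ->
  ipL2 Om u (glue_cst c) = \sum_i extdot (integral_form (T i) u) (c i).
Proof.
move=> su hc; rewrite (ipL2_cells n_gt0 oOm subdiv)//; last exact: sqO (L2form_glue_cst hc).
apply: eq_bigr => i _; rewrite -ipL2_cst//; last exact: (sqform_sub oOm (@oT i)).
by apply: eq_Rintegral => x /set_mem Tx; rewrite (glue_cstE _ Tx).
Qed.

Lemma piecewise_P0P u : piecewise Om G (@P0forms R n) n u ->
  exists2 c, forall i, homog n (c i) & forall i x, T i x -> u x = c i.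
Proof.
move=> [_ pu]; have /choice[c cP] : forall i, exists c : extalg R n,
    homog n c /\ forall x, T i x -> u x = c.
  by move=> i; have [_ [c hc ->] uc] := pu i; exists c.
by exists c => i; case: (cP i).
Qed.

Lemma proj_P0_ex : exists u, piecewise Om G (@P0forms R n) n u /\
  forall p, piecewise Om G (@P0forms R n) n p -> ipL2 Om u p = ipL2 Om w p.
Proof.
exists (glue_cst mean); split; first exact: piecewise_P0_cst.
move=> p pp; have [c hc pc] := piecewise_P0P pp.
have sp := sqO pp.1; have sm := sqO (L2form_glue_cst homog_mean).
rewrite !(ipL2_cells n_gt0 oOm subdiv)//; last exact: sqO Lw.
(* The mean divides by the volume, which is nonzero only on a nonempty cell; over an empty one both
   pairings vanish. *)
apply: eq_bigr => i _; have [T0|/set0P T0] := eqVneq (T i) set0; first by rewrite T0 !ipL2_set0.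
have vol0 : volume (T i) != 0 by rewrite gt_eqF// volume_gt0.
transitivity (ipL2 (T i) (cst (mean i)) (cst (c i))).
  by apply: eq_Rintegral => x /set_mem Tx; rewrite (glue_cstE _ Tx) (pc i).
transitivity (ipL2 (T i) w (cst (c i))); last first.
  by apply: eq_Rintegral => x /set_mem Tx; rewrite (pc i).
rewrite !ipL2_cst//; last exact: sqform_cst.
by rewrite integral_form_cst// /mean scalerA mulfV// scale1r.
Qed.

Lemma proj_P0P : piecewise Om G (@P0forms R n) n (proj_P0 Om G n w) /\
  forall p, piecewise Om G (@P0forms R n) n p -> ipL2 Om (proj_P0 Om G n w) p = ipL2 Om w p.
Proof. exact: (xgetPex 0 proj_P0_ex). Qed.

Lemma proj_P0E i x : T i x -> proj_P0 Om G n w x = mean i.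
Proof.
move=> Tx; have [pp eq_p] := proj_P0P; have [c hc pc] := piecewise_P0P pp.
have vol0 : volume (T i) != 0 by rewrite gt_eqF// volume_gt0//; exists x.
rewrite (pc i x Tx); apply: (@homog_eqP _ _ n) => // e he.
(* [proj_P0] is known only through its defining property; a test form supported on the single cell i
   recovers its value there. *)
pose d j := if j == i then e else 0.
have hd j : homog n (d j) by rewrite /d; case: ifP => // _; exact: homog0.
have sumd u : \sum_j extdot (integral_form (T j) u) (d j) = extdot (integral_form (T i) u) e.
  rewrite (bigD1 i)//= /d eqxx big1 ?addr0// => j /negbTE ->.
  by rewrite extdot0r.
have := eq_p (glue_cst d) (piecewise_P0_cst hd).
rewrite !ipL2_glue_cst//; [|exact: sqO Lw|exact: sqO pp.1].
rewrite !sumd => iE; rewrite /mean extdotZl -iE.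
have -> : integral_form (T i) (proj_P0 Om G n w) = integral_form (T i) (cst (c i)).
  apply/ffunP => I; rewrite !ffunE; apply: eq_Rintegral => y /set_mem Ty.
  by rewrite (pc i).
by rewrite integral_form_cst// extdotZl mulrA mulVf// mul1r.
Qed.

Lemma integral_top_proj_P0 : integral_top Om (proj_P0 Om G n w) = integral_top Om w.
Proof.
rewrite !integral_topE; apply: proj_P0P.2; split.
  by apply/(L2formP mOm); split=> [x _|]; [exact: homog_top|exact: sqform_cst].
by move=> i; exists (cst top_form) => //; exists top_form => //; exact: homog_top.
Qed.

End projection.

End nonconforming_complex.

(** * Constants, top degree and assembly of the two diagrams *)

Section complexes.
Variables (R : realType) (n : nat) (Om : set 'rV[R]_n) (m : nat) (G : 'I_m -> 'M[R]_(n.+1, n)).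
Hypotheses (n_gt0 : (0 < n)%N) (oOm : open Om) (bOm : bounded_set Om).
Hypothesis (subdiv : simplicial_subdivision Om G).
Implicit Types (w u eta : dform R n) (k : nat) (e : extalg R n).

Let mOm : measurable Om := open_measurable_rV oOm.

Lemma L2form_cst k e : homog k e -> L2form Om k (cst e).
Proof. by move=> he; apply/(L2formP mOm); split=> [x _ //|]; exact: sqform_cst. Qed.

Lemma wextd_cst k e : eqL2 Om (wextd Om k (cst e)) 0.
Proof.
have d0 : is_wextd Om k (cst e) 0.
  by have := is_wextd_C1 (X := Om) (k := k) (C1form_cst e); rewrite extd_cst.
by have [] := wextdP oOm (L2form0 mOm k.+1) d0.
Qed.

Lemma HL_cst k e : homog k e -> HL Om k (cst e).
Proof.
move=> he; split; first exact: L2form_cst.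
move=> _; exists 0; first exact: L2form0.
by have := is_wextd_C1 (X := Om) (k := k) (C1form_cst e); rewrite extd_cst.
Qed.

Lemma extd_h_cst e : extd_h G (cst e) = 0.
Proof.
rewrite (extd_h_glue (c := fun=> 0)) => [|i x _]; last by rewrite extd_cst.
by apply/funext => x; rewrite /glue_cst /glue big1// => i _; rewrite scaler0.
Qed.

Lemma piecewise_P1minus_const k e : homog k e -> piecewise Om G (@P1minus R n) k (cst e).
Proof.
move=> he; split; first exact: L2form_cst.
by move=> i; exists (cst e) => //; exact: P1minus_cst.
Qed.

(** A constant has zero differential, so the condition says that it is orthogonal to the
    codifferentials of W^*_{h0}; this holds for test forms by parts and passes to the closure. *)
Lemma Wnc_cst k e : (k < n)%N -> homog k e -> Wnc Om G k (cst e).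
Proof.
move=> kn he; rewrite /Wnc kn; split; first exact: piecewise_P1minus_const.
move=> eta [_ Heta]; rewrite extd_h_cst ipL20l subr0.
rewrite (Hstar0_pair oOm Heta (u := 0)) ?ipL20l//; last 2 first.
- exact: sqform0.
- move=> phi Tphi; rewrite ipL20l (is_wextd_C1 (X := Om) (k := k) (C1form_cst e))//.
  by rewrite extd_cst ipL20l.
exact: sqform_cst.
Qed.

Lemma HL0_0 k : (k < n)%N -> HL0 Om k 0.
Proof.
move=> kn; split; first exact: (HL_cst (@homog0 R n k)).
rewrite kn => e e0; exists 0; first exact: test_form0.
rewrite subr0 /HL_norm ipL20l add0r.
have [_ L _] := HLP oOm kn (HL_cst (@homog0 R n k)).
have s := L2form_sqform mOm L.
by rewrite (eqL2_ipl mOm s (sqform0 Om) s (wextd_cst k 0)) ipL20l sqrtr0.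
Qed.

Lemma Wnc0_0 k : (k < n)%N -> Wnc0 Om G k 0.
Proof.
move=> kn; rewrite /Wnc0 kn; split; first exact: (piecewise_P1minus_const (@homog0 R n k)).
by move=> eta _; rewrite (extd_h_cst 0) !ipL20l subrr.
Qed.

Lemma HL0_next k w : (k < n)%N -> HL0 Om k w -> HL0 Om k.+1 (wextd Om k w).
Proof.
move=> kn H; have [kn1|nk] := ltnP k.+1 n; first exact: HL0_wextd.
split; first exact: HL_wextd H.1.
rewrite ltnNge nk /= integral_topE.
have st : sqform Om (cst (top_form R n)) by exact: sqform_cst.
(* In top degree zero mean is claimed: the volume form is coclosed, so it is orthogonal to d phi for
   every test form phi, and by density to d w. *)
rewrite -(HL0_pair oOm kn H st (sqform0 Om)) ?ipL20r// => phi Tphi.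
have := is_wcoextd_C1 (X := Om) (k := k.+1) (C1form_cst (top_form R n)) => /(_ _ Tphi) ->.
by rewrite coextd_cst.
Qed.

Lemma interp_commutes k w : (k < n)%N -> HL Om k w ->
  eqL2 Om (interp Om G k.+1 (wextd Om k w)) (extd_h G (interp Om G k w)).
Proof.
move=> kn Hw; apply: (eqL2_cells n_gt0 subdiv) => i; apply: aeW => x Tx.
rewrite (extd_h_interp oOm bOm subdiv kn Hw Tx).
have [kn1|nk] := ltnP k.+1 n; first exact: interp_wextd.
(* In top degree the interpolator is the L^2 projection, whose value on a cell is again the mean. *)
have kE : k.+1 = n by apply/eqP; rewrite eqn_leq nk kn.
have [_ L _] := HLP oOm kn Hw; rewrite kE in L.
by rewrite /interp ltnNge nk /= kE (proj_P0E n_gt0 oOm bOm subdiv L Tx).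
Qed.

Lemma interp_top w : interp Om G n w = proj_P0 Om G n w.
Proof. by rewrite /interp ltnn. Qed.

Lemma Wnc_complex : is_complex Om (@inc R n) (Wnc Om G) (fun=> extd_h G).
Proof.
split.
- move=> c; apply: Wnc_cst => // I; rewrite ffunE cards_eq0.
  by case: ifP.
- by move=> c; apply: aeW => x _; rewrite [extd_h _ _]extd_h_cst.
- by move=> k kn w; exact: Wnc_extd_h.
- move=> k kn w; rewrite /Wnc (ltnW kn) => -[pw _].
  by apply: aeW => x _; rewrite (extd_h_extd_h subdiv pw).
Qed.

Lemma Wnc0_complex : is_complex Om (fun _ : unit => 0) (Wnc0 Om G) (fun=> extd_h G).
Proof.
split.
- by move=> _; exact: Wnc0_0.
- by move=> _; apply: aeW => x _; rewrite (extd_h_cst 0).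
- by move=> k kn w; exact: Wnc0_extd_h.
- move=> k kn w; rewrite /Wnc0 (ltnW kn) => -[pw _].
  by apply: aeW => x _; rewrite (extd_h_extd_h subdiv pw).
Qed.

Lemma HL_complex : is_complex Om (@inc R n) (HL Om) (wextd Om).
Proof.
split.
- move=> c; apply: HL_cst => // I; rewrite ffunE cards_eq0.
  by case: ifP.
- by move=> c; exact: wextd_cst.
- by move=> k kn w; exact: HL_wextd.
- by move=> k kn w; exact: wextd_wextd.
Qed.

Lemma HL0_complex : is_complex Om (fun _ : unit => 0) (HL0 Om) (wextd Om).
Proof.
split.
- by move=> _; exact: HL0_0.
- by move=> _; exact: (wextd_cst 0 0).
- by move=> k kn w; exact: HL0_next.
- by move=> k kn w [Hw _]; exact: wextd_wextd.
Qed.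

Lemma interp_cochain_map : is_cochain_map Om (HL Om) (wextd Om)
  (Wnc Om G) (fun=> extd_h G) (interp Om G).
Proof.
split; last by move=> k kn w; exact: interp_commutes.
move=> k; rewrite leq_eqVlt => /predU1P[->|kn] w Hw; last exact: interp_Wnc.
rewrite interp_top /Wnc ltnn.
by have [] := proj_P0P n_gt0 oOm bOm subdiv Hw.1.
Qed.

Lemma interp_cochain_map0 : is_cochain_map Om (HL0 Om) (wextd Om)
  (Wnc0 Om G) (fun=> extd_h G) (interp Om G).
Proof.
split; last by move=> k kn w [Hw _]; exact: interp_commutes.
move=> k; rewrite leq_eqVlt => /predU1P[->|kn] w Hw; last exact: interp_Wnc0 Hw.1 Hw.
rewrite interp_top /Wnc0 ltnn; have [pp _] := proj_P0P n_gt0 oOm bOm subdiv Hw.1.1.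
split => //; rewrite (integral_top_proj_P0 n_gt0 oOm bOm subdiv Hw.1.1).
by case: Hw => _; rewrite ltnn.
Qed.

End complexes.

Theorem theorem3p17 (R : realType) (n : nat) (n_ge1 : (1 <= n)%N)
    (Om : set 'rV[R]_n) (Om_polyhedral : polyhedral_domain Om)
    (m : nat) (G : 'I_m -> 'M[R]_(n.+1, n)) (G_subdiv : simplicial_subdivision Om G) :
  [/\ is_complex Om (@inc R n) (HL Om) (wextd Om),
      is_complex Om (@inc R n) (Wnc Om G) (fun=> extd_h G) &
      is_cochain_map Om (HL Om) (wextd Om)
        (Wnc Om G) (fun=> extd_h G) (interp Om G)] /\
  [/\ is_complex Om (fun _ : unit => 0) (HL0 Om) (wextd Om),
      is_complex Om (fun _ : unit => 0) (Wnc0 Om G) (fun=> extd_h G) &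
      is_cochain_map Om (HL0 Om) (wextd Om)
        (Wnc0 Om G) (fun=> extd_h G) (interp Om G)].
Proof.
have [oOm _ _ bOm _] := Om_polyhedral.
split; split.
- exact: HL_complex.
- exact: Wnc_complex.
- exact: interp_cochain_map.
- exact: HL0_complex.
- exact: Wnc0_complex.
- exact: interp_cochain_map0.
Qed.
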